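(* Let $Q$ be a tame quiver without oriented cycles and $\mathbf{k}$ a finite field. Let $P,P'$ be indecomposable preprojective $\mathbf{k}Q$-modules of defect $-1$, let $R$ be an indecomposable regular $\mathbf{k}Q$-module and let $R'$ be a regular $\mathbf{k}Q$-module (possibly zero). Then there exists a short exact sequence $$0\longrightarrow P\longrightarrow P'\oplus R'\longrightarrow R\longrightarrow 0$$ if and only if $R'$ is (isomorphic to) a submodule of $R$ such that there is a short exact sequence $$0\longrightarrow P\longrightarrow P'\longrightarrow R/R'\longrightarrow 0.$$ In this case, we have $$F_{RP}^{P'\oplus R'}=\begin{cases}|\mathrm{Hom}(P,R)|,&\text{if }R\cong R';\\ a_{R'},&\text{if }R\not\cong R'.\end{cases}$$
   Context: A tame quiver is a (connected) quiver whose underlying graph is an extended Dynkin diagram of type $\widetilde{\mathbb{A}},\widetilde{\mathbb{D}},\widetilde{\mathbb{E}}_6,\widetilde{\mathbb{E}}_7$ or $\widetilde{\mathbb{E}}_8$. $\mathbf{k}Q$-modules are finite dimensional left modules over the path algebra; each indecomposable one is preprojective, regular or preinjective, and a regular module is a direct sum of indecomposable regular ones. The defect of $M$ is $\langle\delta,[M]\rangle$, where $\langle-,-\rangle$ is the Euler form and $\delta$ is the minimal positive imaginary root (so indecomposable preprojectives have negative defect). Hall number: $F_{MN}^{L}=|\{X\subseteq L\mid X\cong N,\ L/X\cong M\}|$. For a module $M$, $a_M=|\mathrm{Aut}(M)|$ (so $a_0=1$). *)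

(* Defs.v *)
From HB Require Import structures.
From mathcomp Require Import all_boot all_order all_algebra.
From mathcomp Require Import finmap.
From mathcomp Require Import boolp classical_sets cardinality.
Set Implicit Arguments.
Unset Strict Implicit.
Unset Printing Implicit Defensive.
Import GRing.Theory Num.Theory.
Local Open Scope ring_scope.

Record quiver := Quiver {
  vtx : finType;
  arr : finType;
  src : arr -> vtx;
  tgt : arr -> vtx }.

Definition op_quiver (Q : quiver) := Quiver (@tgt Q) (@src Q).

Section Paths.
Variable Q : quiver.
Implicit Types (i : vtx Q) (s : seq (arr Q)).

(* A path is a starting vertex together with the sequence of its arrows, the  *)
(* first arrow traversed being the head of the sequence.                      *)
Fixpoint is_qpath i s : bool :=
  if s is a :: s' then (src a == i) && is_qpath (tgt a) s' else true.

Definition qend i s : vtx Q := last i (map (@tgt Q) s).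

Definition acyclic := forall i s, is_qpath i s -> qend i s = i -> s = [::].

(* The basis of the path algebra of an acyclic quiver: a path visits no vertex *)
(* twice, so that the bound on the length excludes nothing in that case.      *)
Definition qpath := {x : vtx Q * (#|vtx Q|).-bseq (arr Q) | is_qpath x.1 x.2}.

Definition pstart (p : qpath) : vtx Q := (val p).1.
Definition parrows (p : qpath) : seq (arr Q) := (val p).2.
Definition pend (p : qpath) : vtx Q := qend (pstart p) (parrows p).

End Paths.

Arguments acyclic : clear implicits.
Arguments qpath : clear implicits.

(* A multigraph with vertices 0, ..., n-1 is given by the list of its edges;  *)
(* an edge occurs in one of its two orientations, once per multiplicity.      *)
Definition edge_mult (e : seq (nat * nat)) (i j : nat) : nat :=
  count [pred x | (x == (i, j)) || (x == (j, i))] e.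

Definition arrow_mult (Q : quiver) (i j : vtx Q) : nat :=
  #|[set a : arr Q | ((src a, tgt a) == (i, j)) || ((src a, tgt a) == (j, i))]|.

Definition underlying_graph_is (Q : quiver) (n : nat) (e : seq (nat * nat)) :=
  exists f : vtx Q -> 'I_n,
    bijective f /\ forall i j, arrow_mult i j = edge_mult e (f i) (f j).

Definition edges_affA (n : nat) : seq (nat * nat) :=
  (n, 0)%N :: [seq (i, i.+1) | i <- iota 0 n].
Definition edges_affD (n : nat) : seq (nat * nat) :=
  [:: (0, 2); (1, 2); (n - 2, n - 1); (n - 2, n)]%N
    ++ [seq (i, i.+1) | i <- iota 2 (n - 4)].
Definition edges_affE6 : seq (nat * nat) :=
  [:: (0, 1); (1, 2); (0, 3); (3, 4); (0, 5); (5, 6)]%N.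
Definition edges_affE7 : seq (nat * nat) :=
  [:: (0, 1); (1, 2); (2, 3); (0, 4); (4, 5); (5, 6); (0, 7)]%N.
Definition edges_affE8 : seq (nat * nat) :=
  [:: (0, 1); (1, 2); (2, 3); (3, 4); (4, 5); (0, 6); (6, 7); (0, 8)]%N.

Definition tame (Q : quiver) : Prop :=
  [\/ exists n : nat, underlying_graph_is Q n.+1 (edges_affA n),
      exists2 n : nat, (4 <= n)%N & underlying_graph_is Q n.+1 (edges_affD n) |
      [\/ underlying_graph_is Q 7 edges_affE6,
          underlying_graph_is Q 8 edges_affE7 |
          underlying_graph_is Q 9 edges_affE8]].

Section Roots.
Variable Q : quiver.
Implicit Types x y : {ffun vtx Q -> int}.

Definition euler x y : int :=
  \sum_(i : vtx Q) x i * y i - \sum_(a : arr Q) x (src a) * y (tgt a).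

(* For an extended Dynkin graph, the imaginary roots are the nonzero vectors  *)
(* on which the Tits form x |-> <x, x> vanishes.                              *)
Definition pos_imag_root x : Prop :=
  [/\ x != 0, forall i, 0 <= x i & euler x x = 0].

Definition min_pos_imag_root x : Prop :=
  pos_imag_root x /\
  forall y, pos_imag_root y -> (forall i, y i <= x i) -> y = x.

End Roots.

(* A finite dimensional left module over the path algebra kQ, which is        *)
(* generated by the e_i and the arrows subject to e_i e_j = [i = j] e_i,      *)
(* sum_i e_i = 1 and a = e_(tgt a) a e_(src a).                               *)
Record kQmodule (k : fieldType) (Q : quiver) := KQModule {
  kQsort :> vectType k;
  idem : vtx Q -> 'End(kQsort);
  arrow : arr Q -> 'End(kQsort);
  idemM : forall i j, (idem i \o idem j)%VF = if i == j then idem i else 0;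
  idem_sum : \sum_i idem i = \1%VF;
  arrowE : forall a, arrow a = (idem (tgt a) \o arrow a \o idem (src a))%VF }.

Arguments idem {k Q} _ _.
Arguments arrow {k Q} _ _.

Section Modules.
Variables (k : fieldType) (Q : quiver).
Implicit Types L M N : kQmodule k Q.

Definition is_hom M N (f : 'Hom(M, N)) : bool :=
  [forall i, (f \o idem M i)%VF == (idem N i \o f)%VF] &&
  [forall a, (f \o arrow M a)%VF == (arrow N a \o f)%VF].

Definition is_iso M N (f : 'Hom(M, N)) : bool :=
  [&& is_hom f, lker f == 0%VS & limg f == fullv].

Definition isom M N : Prop := exists f : 'Hom(M, N), is_iso f.

Definition short_exact L M N : Prop :=
  exists (f : 'Hom(L, M)) (g : 'Hom(M, N)),
    [/\ is_hom f, is_hom g, lker f = 0%VS, limg f = lker g & limg g = fullv].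

Definition is_zero M : Prop := \dim {:M} = 0%N.

Definition dimvec M : {ffun vtx Q -> int} :=
  [ffun i => Posz (\dim (limg (idem M i)))].

Definition defect (delta : {ffun vtx Q -> int}) M : int :=
  euler delta (dimvec M).

Definition is_submod M (X : {vspace M}) : bool :=
  [forall i, (idem M i @: X <= X)%VS] && [forall a, (arrow M a @: X <= X)%VS].

Lemma submod_idem M (X : {vspace M}) i u :
  is_submod X -> u \in X -> idem M i u \in X.
Proof.
by case/andP=> /forallP/(_ i) h _ uX; apply: (subvP h); apply: memv_img.
Qed.

Lemma submod_arrow M (X : {vspace M}) a u :
  is_submod X -> u \in X -> arrow M a u \in X.
Proof.
by case/andP=> _ /forallP/(_ a) h uX; apply: (subvP h); apply: memv_img.
Qed.

Lemma idem_app M i j (u : M) :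
  idem M i (idem M j u) = if i == j then idem M i u else 0.
Proof.
by rewrite -comp_lfunE idemM; case: eqP => // _; rewrite zero_lfunE.
Qed.

Lemma idem_sum_app M (u : M) : \sum_i idem M i u = u.
Proof. by rewrite -sum_lfunE idem_sum id_lfunE. Qed.

Lemma arrow_app M a (u : M) :
  idem M (tgt a) (arrow M a (idem M (src a) u)) = arrow M a u.
Proof. by rewrite [in RHS]arrowE !comp_lfunE. Qed.

Section ZeroModule.

Let z : 'End('rV[k]_0) := 0.

Fact zero_lfun_eq (f g : 'End('rV[k]_0)) : f = g.
Proof. by apply/lfunP=> u; rewrite [LHS]thinmx0 [RHS]thinmx0. Qed.

Definition zero_mod : kQmodule k Q :=
  @KQModule k Q 'rV[k]_0 (fun=> z) (fun=> z)
    (fun _ _ => zero_lfun_eq _ _) (zero_lfun_eq _ _)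
    (fun _ => zero_lfun_eq _ _).

End ZeroModule.

Section DirectSum.
Variables M N : kQmodule k Q.

Definition pair_fun (f : 'End(M)) (g : 'End(N)) (u : (M * N)%type) :
  (M * N)%type := (f u.1, g u.2).

Fact pair_fun_linear f g : linear (pair_fun f g).
Proof. by move=> c [u1 u2] [v1 v2]; rewrite /pair_fun /= !linearP. Qed.
HB.instance Definition _ f g :=
  GRing.isLinear.Build k (M * N)%type (M * N)%type _ (pair_fun f g)
    (pair_fun_linear f g).

Definition pair_lfun f g : 'End((M * N)%type) := linfun (pair_fun f g).

Fact dsum_idemM i j :
  (pair_lfun (idem M i) (idem N i) \o pair_lfun (idem M j) (idem N j))%VF =
  if i == j then pair_lfun (idem M i) (idem N i) else 0.
Proof.
apply/lfunP=> u; rewrite comp_lfunE !lfunE /= /pair_fun /= !idem_app.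
by case: eqP => _; rewrite ?lfunE //= zero_lfunE.
Qed.

Fact dsum_idem_sum : \sum_i pair_lfun (idem M i) (idem N i) = \1%VF.
Proof.
apply/lfunP=> u; rewrite sum_lfunE id_lfunE.
rewrite (eq_bigr (fun i => (idem M i u.1, idem N i u.2))); last first.
  by move=> i _; rewrite lfunE.
rewrite [LHS]surjective_pairing !raddf_sum /= !idem_sum_app.
by rewrite -surjective_pairing.
Qed.

Fact dsum_arrowE a : pair_lfun (arrow M a) (arrow N a) =
  (pair_lfun (idem M (tgt a)) (idem N (tgt a)) \o
   pair_lfun (arrow M a) (arrow N a) \o
   pair_lfun (idem M (src a)) (idem N (src a)))%VF.
Proof.
by apply/lfunP=> u; rewrite !comp_lfunE !lfunE /= /pair_fun /= !arrow_app.
Qed.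

Definition dsum : kQmodule k Q :=
  KQModule dsum_idemM dsum_idem_sum dsum_arrowE.

End DirectSum.

Section Submodule.
Variables (M : kQmodule k Q) (X : {vspace M}) (sX : is_submod X).

Definition res_lfun (f : 'End(M)) : 'End(subvs_of X) :=
  (linfun (vsproj X) \o f \o linfun vsval)%VF.

Fact res_lfunE f u : res_lfun f u = vsproj X (f (vsval u)).
Proof. by rewrite !comp_lfunE !lfunE. Qed.

Fact sub_idemM i j :
  (res_lfun (idem M i) \o res_lfun (idem M j))%VF =
  if i == j then res_lfun (idem M i) else 0.
Proof.
apply/lfunP=> u; rewrite comp_lfunE !res_lfunE vsprojK; last first.
  exact: submod_idem sX (subvsP u).
rewrite idem_app; case: eqP => _; first by rewrite res_lfunE.
by rewrite zero_lfunE linear0.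
Qed.

Fact sub_idem_sum : \sum_i res_lfun (idem M i) = \1%VF.
Proof.
apply/lfunP=> u; rewrite sum_lfunE id_lfunE.
under eq_bigr do rewrite res_lfunE.
by rewrite -linear_sum /= idem_sum_app vsvalK.
Qed.

Fact sub_arrowE a : res_lfun (arrow M a) =
  (res_lfun (idem M (tgt a)) \o res_lfun (arrow M a) \o
   res_lfun (idem M (src a)))%VF.
Proof.
apply/lfunP=> u; rewrite 2!comp_lfunE !res_lfunE.
rewrite [vsval (vsproj X (idem _ _ _))]vsprojK; last first.
  exact: submod_idem sX (subvsP u).
rewrite vsprojK ?arrow_app //.
by apply: submod_arrow => //; apply: submod_idem sX (subvsP u).
Qed.

Definition submod : kQmodule k Q := KQModule sub_idemM sub_idem_sum sub_arrowE.

End Submodule.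

(* The quotient M / X is carried by a complement of X in M, on which M is     *)
(* projected along X; see quo_proj_hom, lker_quo_proj and limg_quo_proj.      *)
Section Quotient.
Variables (M : kQmodule k Q) (X : {vspace M}) (sX : is_submod X).

Definition quo_proj : 'Hom(M, subvs_of X^C) :=
  linfun (vsproj X^C \o daddv_pi X^C X).

Definition quo_incl : 'Hom(subvs_of X^C, M) := linfun vsval.

Definition quo_lfun (f : 'End(M)) : 'End(subvs_of X^C) :=
  (quo_proj \o f \o quo_incl)%VF.

Fact quo_cap : (X^C :&: X = 0)%VS.
Proof. by rewrite capvC capv_compl. Qed.

Fact quo_projK (u : M) : u - quo_incl (quo_proj u) \in X.
Proof.
rewrite !lfunE /= vsprojK ?memv_pi //.
have uE : daddv_pi X^C X u + daddv_pi X X^C u = u.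
  by apply: daddv_pi_add; rewrite ?quo_cap // addvC addv_complf memvf.
by rewrite -{1}uE addrC addKr memv_pi.
Qed.

Fact quo_inclK u : quo_proj (quo_incl u) = u.
Proof.
rewrite !lfunE /= daddv_pi_id ?vsvalK //; [exact: quo_cap | exact: subvsP].
Qed.

Fact quo_proj0 u : (quo_proj u == 0) = (u \in X).
Proof.
apply/eqP/idP => [u0|uX]; first by have := quo_projK u; rewrite u0 linear0 subr0.
have := daddv_pi_add quo_cap (w := u); rewrite addvC addv_complf memvf.
rewrite [daddv_pi X X^C u]daddv_pi_id ?capv_compl // => /(_ isT).
by move/(canRL (addrK _)); rewrite subrr lfunE /= => ->; rewrite linear0.
Qed.

Fact quo_projE u v : u - v \in X -> quo_proj u = quo_proj v.
Proof. by rewrite -quo_proj0 linearB subr_eq0 => /eqP. Qed.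

Fact quo_lfunE (f : 'End(M)) : (forall u, u \in X -> f u \in X) ->
  forall u, quo_lfun f (quo_proj u) = quo_proj (f u).
Proof.
move=> fX u; rewrite !comp_lfunE; apply: quo_projE.
by rewrite -linearB -opprB linearN memvN; apply/fX/quo_projK.
Qed.

Let idX i u (uX : u \in X) := submod_idem i sX uX.
Let arX a u (uX : u \in X) := submod_arrow a sX uX.

Fact quo_idemM i j :
  (quo_lfun (idem M i) \o quo_lfun (idem M j))%VF =
  if i == j then quo_lfun (idem M i) else 0.
Proof.
apply/lfunP=> u; rewrite -(quo_inclK u) comp_lfunE.
rewrite !(quo_lfunE (idX _)) idem_app; case: eqP => _.
  by rewrite (quo_lfunE (idX _)).
by rewrite zero_lfunE linear0.
Qed.

Fact quo_idem_sum : \sum_i quo_lfun (idem M i) = \1%VF.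
Proof.
apply/lfunP=> u; rewrite -(quo_inclK u) sum_lfunE id_lfunE.
under eq_bigr do rewrite (quo_lfunE (idX _)).
by rewrite -linear_sum idem_sum_app.
Qed.

Fact quo_arrowE a : quo_lfun (arrow M a) =
  (quo_lfun (idem M (tgt a)) \o quo_lfun (arrow M a) \o
   quo_lfun (idem M (src a)))%VF.
Proof.
apply/lfunP=> u; rewrite -(quo_inclK u) 2!comp_lfunE.
by rewrite !(quo_lfunE (idX _), quo_lfunE (arX _)) arrow_app.
Qed.

Definition quomod : kQmodule k Q := KQModule quo_idemM quo_idem_sum quo_arrowE.

Lemma quo_proj_hom : is_hom (quo_proj : 'Hom(M, quomod)).
Proof.
apply/andP; split; apply/forallP=> x; apply/eqP/lfunP=> u.
  rewrite comp_lfunE [RHS]comp_lfunE; exact/esym/(quo_lfunE (idX x)).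
rewrite comp_lfunE [RHS]comp_lfunE; exact/esym/(quo_lfunE (arX x)).
Qed.

Lemma lker_quo_proj : lker quo_proj = X.
Proof. by apply/vspaceP=> u; rewrite memv_ker quo_proj0. Qed.

Lemma limg_quo_proj : limg quo_proj = fullv.
Proof.
by apply/vspaceP=> u; rewrite memvf -(quo_inclK u) memv_img ?memvf.
Qed.

End Quotient.

Definition indecomposable M : Prop :=
  ~ is_zero M /\ forall X Y, isom M (dsum X Y) -> is_zero X \/ is_zero Y.

Definition hom_set M N : set 'Hom(M, N) := [set f | is_hom f]%classic.

Definition aut_set M : set 'End(M) := [set f | is_iso f]%classic.

(* The number of elements of a finite set; hom_set, aut_set and the set of    *)
(* submodules counted by hall are finite over a finite field, see             *)
(* finite_lfun_set and finite_vspace_set.                                     *)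
Definition ncard (T : choiceType) (A : set T) : nat := #|` fset_set A|.

Definition hall M N L : nat :=
  ncard [set X : {vspace L} |
    exists sX : is_submod X,
      isom (submod sX) N /\ isom (quomod sX) M]%classic.

End Modules.

Arguments zero_mod {k Q}.
Arguments hom_set {k Q} M N _.
Arguments aut_set {k Q} M _.

Lemma finite_inj_set (T : Type) (F : finType) (f : T -> F) (A : set T) :
  injective f -> finite_set A.
Proof.
move=> fI; apply: (sub_finite_set (B := (f @^-1` setT)%classic)) => //.
by apply: finite_preimage => [? ? _ _ /fI //|]; exact: finite_finset.
Qed.

Lemma finite_lfun_set (k : finFieldType) (U V : vectType k) (A : set 'Hom(U, V)) :
  finite_set A.
Proof.
pose f (g : 'Hom(U, V)) : 'M[k]_(dim U, dim V) := VectorInternalTheory.f2mx g.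
apply: (@finite_inj_set _ 'M[k]_(dim U, dim V) f) => [[g] [h]].
by rewrite /f /= => ->.
Qed.

Lemma finite_vspace_set (k : finFieldType) (U : vectType k) (A : set {vspace U}) :
  finite_set A.
Proof.
pose f (X : {vspace U}) : 'M[k]_(dim U) := VectorInternalTheory.vs2mx X.
apply: (@finite_inj_set _ 'M[k]_(dim U) f) => X Y; rewrite /f => XY.
by rewrite -[X]VectorInternalTheory.vs2mxK XY VectorInternalTheory.vs2mxK.
Qed.

Section Dual.
Variables (k : fieldType) (Q : quiver) (M : kQmodule k Q).

Definition dual_fun (f : 'End(M)) (h : 'Hom(M, k^o)) : 'Hom(M, k^o) :=
  (h \o f)%VF.

Fact dual_fun_linear f : linear (dual_fun f).
Proof. by move=> c g h; rewrite /dual_fun comp_lfunDl comp_lfunZl. Qed.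
HB.instance Definition _ f :=
  GRing.isLinear.Build k 'Hom(M, k^o) 'Hom(M, k^o) _ (dual_fun f)
    (dual_fun_linear f).

Definition dual_lfun f : 'End('Hom(M, k^o)) := linfun (dual_fun f).

Fact dual_idemM (i j : vtx (op_quiver Q)) :
  (dual_lfun (idem M i) \o dual_lfun (idem M j))%VF =
  if i == j then dual_lfun (idem M i) else 0.
Proof.
apply/lfunP=> h; rewrite comp_lfunE !lfunE /= /dual_fun -comp_lfunA idemM.
rewrite eq_sym; case: eqP => [->|_]; first by rewrite lfunE.
by rewrite zero_lfunE comp_lfun0r.
Qed.

Fact dual_idem_sum : \sum_(i : vtx (op_quiver Q)) dual_lfun (idem M i) = \1%VF.
Proof.
apply/lfunP=> h; rewrite sum_lfunE id_lfunE.
rewrite (eq_bigr (fun i => h \o idem M i)%VF); last by move=> i _; rewrite lfunE.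
apply/lfunP=> u; rewrite sum_lfunE.
under eq_bigr do rewrite comp_lfunE.
by rewrite -linear_sum idem_sum_app.
Qed.

Fact dual_arrowE (a : arr (op_quiver Q)) : dual_lfun (arrow M a) =
  (dual_lfun (idem M (tgt a)) \o dual_lfun (arrow M a) \o
   dual_lfun (idem M (src a)))%VF.
Proof.
apply/lfunP=> h; rewrite 2!comp_lfunE !lfunE /= /dual_fun.
by rewrite -!comp_lfunA [in LHS]arrowE -comp_lfunA.
Qed.

Definition dual : kQmodule k (op_quiver Q) :=
  KQModule dual_idemM dual_idem_sum dual_arrowE.

End Dual.

(* The left module Hom_k(kQ, U), with (x f)(y) = f (y x), a function being    *)
(* given by its values on the paths.                                          *)
Section Coinduced.
Variables (k : fieldType) (Q : quiver) (U : vectType k).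
Local Notation W := {ffun qpath Q -> U}.

(* f (i, s) if the path (i, s) exists, 0 otherwise; the sum has at most one   *)
(* term.                                                                      *)
Definition pval (f : W) (i : vtx Q) (s : seq (arr Q)) : U :=
  \sum_(p : qpath Q | (pstart p == i) && (parrows p == s)) f p.

Fact pval_linear i s : linear (fun f => pval f i s).
Proof.
move=> c f g; rewrite /pval scaler_sumr -big_split.
by apply: eq_bigr => p _; rewrite !ffunE.
Qed.

Fact pvalE f (p : qpath Q) : pval f (pstart p) (parrows p) = f p.
Proof. by rewrite /pval (big_pred1 p). Qed.

Definition coind_idem_fun i (f : W) : W :=
  [ffun p => if pstart p == i then f p else 0].
Definition coind_arrow_fun a (f : W) : W :=
  [ffun p => if pstart p == tgt a then pval f (src a) (a :: parrows p) else 0].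

Fact coind_idem_linear i : linear (coind_idem_fun i).
Proof.
move=> c f g; apply/ffunP=> p; rewrite !ffunE; case: eqP => _ //.
by rewrite scaler0 addr0.
Qed.
HB.instance Definition _ i :=
  GRing.isLinear.Build k W W _ (coind_idem_fun i) (coind_idem_linear i).

Fact coind_arrow_linear a : linear (coind_arrow_fun a).
Proof.
move=> c f g; apply/ffunP=> p; rewrite !ffunE; case: eqP => _.
  exact: pval_linear.
by rewrite scaler0 addr0.
Qed.
HB.instance Definition _ a :=
  GRing.isLinear.Build k W W _ (coind_arrow_fun a) (coind_arrow_linear a).

Definition coind_idem i : 'End(W) := linfun (coind_idem_fun i).
Definition coind_arrow a : 'End(W) := linfun (coind_arrow_fun a).

Fact coind_idemM i j : (coind_idem i \o coind_idem j)%VF =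
  if i == j then coind_idem i else 0.
Proof.
apply/lfunP=> f; rewrite comp_lfunE !lfunE /=; apply/ffunP=> p.
rewrite !ffunE; case: (eqVneq i j) => [<-|ij].
  by rewrite lfunE /= ffunE; case: eqP.
rewrite zero_lfunE ffunE; case: (eqVneq (pstart p) i) => // ->.
by rewrite (negPf ij).
Qed.

Fact coind_idem_sum : \sum_i coind_idem i = \1%VF.
Proof.
apply/lfunP=> f; rewrite sum_lfunE id_lfunE; apply/ffunP=> p.
rewrite sum_ffunE (bigD1 (pstart p)) //= big1 => [|i ip].
  by rewrite addr0 lfunE /= ffunE eqxx.
by rewrite lfunE /= ffunE eq_sym (negPf ip).
Qed.

Fact coind_arrowE a :
  coind_arrow a = (coind_idem (tgt a) \o coind_arrow a \o coind_idem (src a))%VF.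
Proof.
apply/lfunP=> f; rewrite !comp_lfunE !lfunE /=; apply/ffunP=> p; rewrite !ffunE.
case: eqP => // _; apply: eq_bigr => q /andP[/eqP qs _].
by rewrite ffunE qs eqxx.
Qed.

Definition coind : kQmodule k Q :=
  KQModule coind_idemM coind_idem_sum coind_arrowE.

End Coinduced.

(* The Auslander-Reiten translate tau M = D Ext^1(M, kQ), computed from the   *)
(* standard projective resolution                                             *)
(*   0 -> \oplus_a kQ e_(tgt a) (x) e_(src a) M -> \oplus_i kQ e_i (x) e_i M  *)
(*     -> M -> 0,     p (x) m |-> p a (x) m - p (x) a m,                      *)
(* to which D Hom(-, kQ) is applied. As D Hom(kQ e_i, kQ) = D (e_i kQ), the   *)
(* module D (e_(tgt a) kQ) (x) e_(src a) M consists of the functions from the *)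
(* paths ending at tgt a to e_(src a) M. So tau M is the set of the families  *)
(* (f_a) of such functions (extended by 0 to the other paths) which satisfy   *)
(*   \sum_a f_a (a q) = \sum_a a f_a (q)     for each path q.                 *)
Section Translate.
Variables (k : fieldType) (Q : quiver) (M : kQmodule k Q).
Local Notation B := {ffun arr Q -> M}.
Local Notation W := {ffun qpath Q -> B}.

Definition tau_supp_fun (f : W) : W :=
  [ffun p => [ffun a =>
    f p a - (if pend p == tgt a then idem M (src a) (f p a) else 0)]].

Definition tau_rel_fun (f : W) : {ffun qpath Q -> M} :=
  [ffun q => \sum_a pval f (pstart q) (rcons (parrows q) a) a
           - \sum_a arrow M a (f q a)].

Fact tau_supp_linear : linear tau_supp_fun.
Proof.
move=> c f g; apply/ffunP=> p; apply/ffunP=> a; rewrite !ffunE.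
case: eqP => _; first by rewrite linearP scalerBr opprD addrACA.
by rewrite !subr0.
Qed.
HB.instance Definition _ :=
  GRing.isLinear.Build k W W _ tau_supp_fun tau_supp_linear.

Fact tau_rel_linear : linear tau_rel_fun.
Proof.
move=> c f g; apply/ffunP=> q; rewrite !ffunE scalerBr addrACA -opprD.
rewrite !scaler_sumr -!big_split; congr (_ - _); apply: eq_bigr => a _.
  by rewrite (pval_linear _ _ c f g) !ffunE.
by rewrite !ffunE linearP.
Qed.
HB.instance Definition _ :=
  GRing.isLinear.Build k W {ffun qpath Q -> M} _ tau_rel_fun tau_rel_linear.

Definition tau_space : {vspace W} :=
  (lker (linfun tau_supp_fun) :&: lker (linfun tau_rel_fun))%VS.

Lemma tau_spaceP (f : W) :
  f \in tau_space <->
  (forall p a, f p a = if pend p == tgt a then idem M (src a) (f p a) else 0) /\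
  (forall q, \sum_a pval f (pstart q) (rcons (parrows q) a) a =
             \sum_a arrow M a (f q a)).
Proof.
rewrite memv_cap !memv_ker !lfunE /=; split.
  case/andP=> /eqP/ffunP h1 /eqP/ffunP h2; split=> [p a|q].
    by move/ffunP/(_ a): (h1 p); rewrite !ffunE => /eqP; rewrite subr_eq0 => /eqP.
  by move: (h2 q); rewrite !ffunE => /eqP; rewrite subr_eq0 => /eqP.
case=> h1 h2; apply/andP; split; apply/eqP/ffunP=> p.
  by apply/ffunP=> a; rewrite !ffunE -h1 subrr.
by rewrite !ffunE h2 subrr.
Qed.

Fact pval_coord (f : W) i s a :
  pval f i s a = \sum_(p : qpath Q | (pstart p == i) && (parrows p == s)) f p a.
Proof. by rewrite /pval sum_ffunE. Qed.

Fact pval0 (f : W) i s :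
  ~~ (is_qpath i s && (size s <= #|vtx Q|)%N) -> pval f i s = 0.
Proof.
move=> h; rewrite /pval big_pred0 // => p; apply/negP=> /andP[/eqP pi /eqP ps].
case/negP: h; rewrite -pi -ps /pstart /parrows (valP p) /=; exact: size_bseq.
Qed.

Fact qpath_ex i s : is_qpath i s -> (size s <= #|vtx Q|)%N ->
  exists p : qpath Q, pstart p = i /\ parrows p = s.
Proof.
move=> h1 h2; pose x := (i, Bseq h2 : (#|vtx Q|).-bseq (arr Q)).
by exists (exist (fun y : vtx Q * (#|vtx Q|).-bseq (arr Q) => is_qpath y.1 y.2) x h1).
Qed.

Fact tau_submod : is_submod (M := coind Q B) tau_space.
Proof.
apply/andP; split; apply/forallP=> x; apply/subvP=> _ /memv_imgP[f + ->].
- case/tau_spaceP=> h1 h2; apply/tau_spaceP; rewrite lfunE /=; split=> [p a|q].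
    rewrite !ffunE; case: eqP => _; first exact: h1.
    by rewrite ffunE linear0 if_same.
  case: (eqVneq (pstart q) x) => [qx|qx].
    transitivity (\sum_a arrow M a (f q a)); last first.
      by apply: eq_bigr => a _; rewrite ffunE qx eqxx.
    rewrite -h2; apply: eq_bigr => a _; rewrite !pval_coord.
    by apply: eq_bigr => p /andP[/eqP pq _]; rewrite ffunE pq qx eqxx.
  transitivity (0 : M); [|apply: esym]; apply: big1 => a _; last first.
    by rewrite ffunE (negPf qx) ffunE linear0.
  rewrite pval_coord big1 // => p /andP[/eqP pq _].
  by rewrite ffunE pq (negPf qx) ffunE.
case/tau_spaceP=> h1 h2; apply/tau_spaceP; rewrite lfunE /=.
have h1' p a i s : pstart p = tgt x -> parrows p = s -> i = src x ->
    pval f i (x :: s) a =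
    if pend p == tgt a then idem M (src a) (pval f i (x :: s) a) else 0.
  move=> px ps ->; case: (boolP (is_qpath (src x) (x :: s) &&
    (size (x :: s) <= #|vtx Q|)%N)) => [/andP[u1 u2]|u]; last first.
    by rewrite pval0 // ffunE linear0 if_same.
  have [r [r1 r2]] := qpath_ex u1 u2.
  rewrite -r1 -r2 pvalE [LHS]h1; congr (if _ == _ then _ else _).
  by rewrite /pend /qend r1 r2 px ps /=.
split=> [p a|q].
  rewrite !ffunE; case: eqP => [px|_]; last by rewrite ffunE linear0 if_same.
  exact: h1'.
case: (eqVneq (pstart q) (tgt x)) => [qx|qx]; last first.
  transitivity (0 : M); [|apply: esym]; apply: big1 => a _; last first.
    by rewrite ffunE (negPf qx) ffunE linear0.
  rewrite pval_coord big1 // => p /andP[/eqP pq _].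
  by rewrite ffunE pq (negPf qx) ffunE.
transitivity (\sum_a pval f (src x) (x :: rcons (parrows q) a) a).
  apply: eq_bigr => a _; case: (boolP (is_qpath (tgt x) (rcons (parrows q) a) &&
    (size (rcons (parrows q) a) <= #|vtx Q|)%N)) => [/andP[u1 u2]|u].
    have [r [r1 r2]] := qpath_ex u1 u2.
    by rewrite qx -r1 -r2 pvalE ffunE r1 eqxx.
  rewrite qx !pval0 //; apply: contra u => /andP[/= /andP[_ ->] u2] /=.
  exact: ltnW.
transitivity (\sum_a arrow M a (pval f (src x) (x :: parrows q) a)); last first.
  by apply: eq_bigr => a _; rewrite ffunE qx eqxx.
case: (boolP (is_qpath (src x) (x :: parrows q) &&
    (size (x :: parrows q) <= #|vtx Q|)%N)) => [/andP[u1 u2]|u].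
  have [r [r1 r2]] := qpath_ex u1 u2.
  by rewrite -r1 -r2 pvalE -h2 r1 r2.
rewrite !big1 // => a _; rewrite pval0 ?ffunE ?linear0 //.
apply: contra u; rewrite /= eqxx size_rcons /=.
have -> : is_qpath (tgt x) (parrows q) by rewrite -qx /parrows; exact: (valP q).
by case/andP=> _ /ltnW.
Qed.

Definition tau : kQmodule k Q := submod tau_submod.

End Translate.

Section Regular.
Variables (k : fieldType) (Q : quiver).
Implicit Type M : kQmodule k Q.

Definition preprojective M : Prop :=
  indecomposable M /\ exists n : nat, is_zero (iter n (@tau k Q) M).

(* The inverse translate is D tau D, D being the duality between kQ-modules   *)
(* and kQ^op-modules; so the condition says that tau^-n M = 0.                *)
Definition preinjective M : Prop :=
  indecomposable M /\
  exists n : nat, is_zero (iter n (@tau k (op_quiver Q)) (dual M)).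

Definition indec_regular M : Prop :=
  [/\ indecomposable M, ~ preprojective M & ~ preinjective M].

Definition regular M : Prop :=
  exists Rs : seq (kQmodule k Q),
    (forall n, (n < size Rs)%N -> indec_regular (nth zero_mod Rs n)) /\
    isom M (foldr (@dsum k Q) zero_mod Rs).

End Regular.

(* Main.v *)
From HB Require Import structures.
From mathcomp Require Import finmap boolp classical_sets cardinality.
From mathcomp Require Import all_boot all_order all_algebra.
From mathcomp Require Import zify ring.
Require Import Defs.
Set Implicit Arguments.
Unset Strict Implicit.
Unset Printing Implicit Defensive.
Import Order.TTheory GRing.Theory Num.Theory.
Local Open Scope ring_scope.

(* Write ext(M, N) for dim Hom(N, tau M); the Euler form computes             *)
(* hom(M, N) - ext(M, N), and ext(M, N) = 0 allows lifting. The modules       *)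
(* killed by a power of tau are the torsion-free part of a torsion pair, on   *)
(* which the defect is negative, while it is nonnegative on the torsion part; *)
(* hence regular modules form an abelian category, closed under extensions.   *)
(* As tau preserves regular simples and dim Hom(T, R / soc R) is at most      *)
(* ext(T, soc R), a regular module with a simple socle, or dually a simple    *)
(* top, is uniserial, and so is every indecomposable regular module R.        *)
(*   A preprojective P of defect -1 has End P = k, and its nonzero maps to    *)
(* preprojectives are injective. There is a preprojective L of dimension      *)
(* dim P + delta, so dim Hom(P, L) >= 2; from the pencil of maps P -> L one   *)
(* builds, for each regular simple T with Hom(P, T) <> 0, a local regular     *)
(* module C with top T and dimension a multiple of delta such that            *)
(* Hom(P, rad C) = 0 and dim Hom(P, T) <= dim End T. Consequently, if R is    *)
(* uniserial with top T, then T is the only regular composition factor of R   *)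
(* which receives a nonzero map from P, and End R acts transitively on        *)
(* Hom(P, R) from any map with image outside rad R.                           *)
(*   In a sequence 0 -> P -> P' (+) R' -> R -> 0 the components P -> P' and   *)
(* R' -> R are injective. If R' is isomorphic to R, the submodules to count   *)
(* are the graphs of the maps P -> R'. Otherwise the component P' -> R is not *)
(* contained in rad R, so up to a unique automorphism of R it is fixed, and   *)
(* R' -> R, whose image is determined by its dimension, varies by Aut R'.     *)

(** * Linear algebra *)

(** Write ext(M, N) for [hom N (tau M)]. The trace pairing identifies Hom(N, tau M) with the dual of
    the cokernel of [cobd], so [euler_formula] computes hom - ext, and a vanishing ext gives lifts
    ([ext0_lift]). The rest is an interplay of these dimensions with the defect.

    Structure of regular modules: every module is the sum of a torsion and a preprojective part
    ([torsion_split]); the defect is negative on nonzero preprojectives ([pp_def_lt0]) and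
    nonnegative on torsion modules ([tor_def_ge0]). With duality, submodules of defect 0 of a
    regular module are regular and closed under sums, intersections, images and preimages ([rs]). As
    tau preserves regular simples, the socle S of a regular module leaves room for only one simple
    in the socle of the quotient by S, up to multiplicity one; this makes indecomposable regular
    modules uniserial ([indec_chain]).

    The equivalence: in 0 -> P -> P' (+) R' -> R -> 0 the component P -> P' is nonzero, for
    otherwise the projection to P' would factor through R, and Hom(R, P') = 0. Defect -1 makes it
    injective, hence R' -> R is injective too; if X is its image, P' -> R / X has kernel P
    ([mono_parts], [split_submod]). Conversely ext(P', X) = 0 lifts P' -> R / X to R, and the
    sequence is glued from this lift and the inclusion of X ([glue_submod]).

    The count: the submodules counted are kernels of surjections P' (+) R' -> R ([hall_memP]). If R
    and R' are isomorphic, P -> P' is an isomorphism and the submodules are graphs ([hall_isom]). If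
    not, uniseriality forces the image of P' to generate R ([exact_generates]), and End R acts
    transitively on generating maps ([chain_transitive]). So up to Aut R the first component is
    fixed, the second has a prescribed image, and Aut R' acts simply transitively ([hall_nisom]).

    Transitivity is the deep point. It needs that P sees only one regular simple T inside R, its
    top, and that hom(P, T) <= dim End T. Both come from [cover_ex]: a module L of dimension dim P +
    delta has a pencil of maps P -> L, and for a suitable irreducible matrix m of size e the
    cokernel C of P^e -> L^e is local regular of dimension e delta with top T. As hom(P, C) = e =
    hom(P, T), nothing below the top of C is seen by P, and R is built from quotients of such a C
    together with parts treated by induction ([chain_only]). Then the submodule of R (+) R generated
    by a pair (g, g') is local, hence uniserial, hence the graph of an endomorphism carrying g to
    g'. *)

Section LinearAlgebra.
Variable k : fieldType.
Implicit Types U V W : vectType k.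

Lemma linfun_id U V (f : U -> V) : linear f -> linfun f =1 f.
Proof.
move=> lf; pose F : {linear U -> V} := HB.pack f (GRing.isLinear.Build k U V _ f lf).
exact: (lfunE F).
Qed.

(** Homomorphisms, cocycles and the like are given by a [Prop]; this turns such a predicate into a
    subspace, which has a dimension. A subspace of maximal dimension inside P is all of P, since a
    missing vector would enlarge it. *)
Lemma vspace_ex U (P : U -> Prop) :
  P 0 -> (forall c u v, P u -> P v -> P (c *: u + v)) ->
  {S : {vspace U} | forall u, u \in S <-> P u}.
Proof.
move=> P0 Pl; apply: cid.
pose good n := `[< exists S : {vspace U}, \dim S = n /\ forall u, u \in S -> P u >].
have ex : exists n, good n.
  exists 0%N; apply/asboolP; exists 0%VS; split; first exact: dimv0.
  by move=> u; rewrite memv0 => /eqP->.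
have bd n : good n -> (n <= dim U)%N.
  by move/asboolP=> [S [<- _]]; rewrite -dimvf; apply/dimvS/subvf.
case: (ex_maxnP ex bd) => m /asboolP[S [dS SP]] mx; exists S => u; split; first exact: SP.
move=> Pu; apply: contraT => uS.
have : good m.+1; last by move/mx; rewrite ltnn.
apply/asboolP; exists (S + <[u]>)%VS; split.
  rewrite dimv_disjoint_sum ?dS ?dim_vline.
    by case: eqP uS => [->|_]; rewrite ?mem0v ?addn1.
  apply/eqP; rewrite -subv0; apply/subvP=> v; rewrite memv_cap => /andP[vS /vlineP[c vc]].
  case: (eqVneq c 0) => [c0|c0]; first by rewrite vc c0 scale0r mem0v.
  case/negP: uS; have -> : u = c^-1 *: v by rewrite vc scalerA mulVf // scale1r.
  exact: memvZ.
move=> v /memv_addP[s sS [w /vlineP[c ->] ->]]; rewrite addrC; apply: Pl => //.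
exact: SP.
Qed.

Lemma rank_nullity U V (f : U -> V) (S K : {vspace U}) (I : {vspace V}) :
  linear f -> (forall u, u \in K <-> u \in S /\ f u = 0) ->
  (forall w, w \in I <-> exists2 u, u \in S & f u = w) ->
  \dim S = (\dim K + \dim I)%N.
Proof.
move=> lf KP IP; rewrite -(limg_ker_dim (linfun f) S); congr (_ + _)%N; congr (\dim _).
  apply/vspaceP=> u; rewrite memv_cap memv_ker linfun_id //; apply/andP/idP.
    by case=> uS /eqP fu; apply/KP.
  by case/KP=> -> ->.
apply/vspaceP=> w; apply/memv_imgP/idP => [[u uS ->]|/IP[u uS <-]].
  by apply/IP; exists u => //; rewrite linfun_id.
by exists u => //; rewrite linfun_id.
Qed.

Lemma dim_bij U V (f : U -> V) (S : {vspace U}) (I : {vspace V}) :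
  linear f -> (forall u, u \in S -> f u = 0 -> u = 0) ->
  (forall w, w \in I <-> exists2 u, u \in S & f u = w) -> \dim S = \dim I.
Proof.
move=> lf inj IP; rewrite (rank_nullity (K := 0%VS) lf _ IP) ?dimv0 // => u.
rewrite memv0; split=> [/eqP->|[uS /(inj _ uS)->]]; last exact: eqxx.
by split; [exact: mem0v | rewrite -linfun_id // linear0].
Qed.

Lemma dim_inj U V (f : U -> V) (S : {vspace U}) (I : {vspace V}) :
  linear f -> (forall u, u \in S -> f u = 0 -> u = 0) ->
  (forall u, u \in S -> f u \in I) -> (\dim S <= \dim I)%N.
Proof.
move=> lf inj IP; pose J := (linfun f @: S)%VS.
rewrite (@dim_bij _ _ f S J) //.
  by apply/dimvS/subvP=> w /memv_imgP[u uS ->]; rewrite linfun_id //; apply: IP.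
move=> w; split=> [/memv_imgP[u uS ->]|[u uS <-]]; first by exists u; rewrite ?linfun_id.
by rewrite -linfun_id // memv_img.
Qed.

Lemma dim_hom U V : dim 'Hom(U, V) = (dim U * dim V)%N. Proof. by []. Qed.

Lemma dim_ffun (I : finType) U : dim {ffun I -> U} = (#|I| * dim U)%N.
Proof. by []. Qed.

(** Nondegeneracy and equal dimensions make W' the full dual of W. Restricting functionals to S is
    onto, because functionals extend, and its kernel is S'. *)
Lemma dim_perp W W' (b : W -> W' -> k) (S : {vspace W}) (S' : {vspace W'}) :
  (forall h, linear (fun x => b x h : k^o)) -> (forall x, linear (b x : W' -> k^o)) ->
  (forall h, (forall x, b x h = 0) -> h = 0) -> dim W = dim W' ->
  (forall h, h \in S' <-> forall x, x \in S -> b x h = 0) ->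
  (\dim S' + \dim S)%N = dim W.
Proof.
move=> bl br bn dW SP.
pose L (h : W') : 'Hom(W, k^o) := linfun (fun x => b x h : k^o).
have LE h x : L h x = b x h by rewrite linfun_id.
have Ll : linear L.
  by move=> c u v; apply/lfunP=> x; rewrite add_lfunE scale_lfunE !LE br.
have Lf : (linfun L @: fullv = fullv)%VS.
  apply/eqP; rewrite eqEdim subvf limg_dim_eq; last first.
    apply/eqP; rewrite -subv0; apply/subvP=> h; rewrite memv_cap memv_ker linfun_id //.
    case/andP=> _ /eqP h0; rewrite memv0; apply/eqP/bn=> x.
    by have := LE h x; rewrite h0 zero_lfunE => <-.
  by rewrite !dimvf dim_hom muln1 dW leqnn.
pose rho (h : W') : 'Hom(subvs_of S, k^o) := (L h \o linfun vsval)%VF.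
have rl : linear rho.
  by move=> c u v; rewrite /rho Ll comp_lfunDl comp_lfunZl.
rewrite dW -[RHS]dimvf.
rewrite (rank_nullity (f := rho) (S := fullv) (K := S') (I := fullv) rl); first 1 last.
- move=> u; split=> [/SP h|[_ h]].
    split; first exact: memvf.
    apply/lfunP=> x; rewrite comp_lfunE lfunE /= LE zero_lfunE; apply: h; exact: subvsP.
  apply/SP=> x xS; have := congr1 (fun g : 'Hom(_, _) => g (vsproj S x)) h.
  by rewrite comp_lfunE lfunE /= LE zero_lfunE vsprojK.
- move=> w; split=> [_|_]; last exact: memvf.
  pose w' : 'Hom(W, k^o) := (w \o linfun (vsproj S))%VF.
  have : w' \in (linfun L @: fullv)%VS by rewrite Lf memvf.
  case/memv_imgP=> h _; rewrite linfun_id // => e; exists h; first exact: memvf.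
  by apply/lfunP=> x; rewrite comp_lfunE lfunE /= -e comp_lfunE lfunE /= vsvalK.
by congr (_ + _)%N; rewrite dimvf dim_hom muln1.
Qed.

Lemma dim_family (I : finType) U (B : I -> {vspace U}) (S : {vspace {ffun I -> U}}) :
  (forall x, x \in S <-> forall i, x i \in B i) -> \dim S = (\sum_i \dim (B i))%N.
Proof.
move=> SP; pose inj i (u : U) : {ffun I -> U} := [ffun j => if j == i then u else 0].
have injl i : linear (inj i).
  move=> c u v; apply/ffunP=> j; rewrite !ffunE; case: eqP => // _.
  by rewrite scaler0 addr0.
pose A i := (linfun (inj i) @: B i)%VS.
have AP i x : x \in A i -> forall j, j != i -> x j = 0.
  by case/memv_imgP=> u _ -> j ji; rewrite linfun_id // ffunE (negPf ji).
have -> : S = (\sum_i A i)%VS.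
  apply/vspaceP=> x; apply/idP/idP => [/SP xB|/memv_sumP[f fA ->]].
    apply/memv_sumP; exists (fun i => inj i (x i)) => [i _|].
      by rewrite -linfun_id // memv_img.
    apply/ffunP=> j; rewrite sum_ffunE (bigD1 j) //= big1 ?addr0 => [|i ij].
      by rewrite ffunE eqxx.
    by rewrite ffunE eq_sym (negPf ij).
  apply/SP=> j; rewrite sum_ffunE (bigD1 j) //= big1 ?addr0 => [|i ij]; last first.
    by apply: AP (fA i isT) _ _; rewrite eq_sym.
  case/memv_imgP: (fA j isT) => u uB ->.
  by rewrite linfun_id // ffunE eqxx.
have /directvP -> /= : directv (\sum_i A i).
  apply/directv_sum_independent => f fA f0 i _; apply/ffunP=> j; rewrite [RHS]ffunE.
  case: (eqVneq j i) => [->|ji]; last exact: AP (fA i isT) _ ji.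
  move/ffunP/(_ i): f0; rewrite sum_ffunE (bigD1 i) //= big1 ?addr0 => [->|l li].
    by rewrite ffunE.
  by apply: AP (fA l isT) _ _; rewrite eq_sym.
apply: eq_bigr => i _; rewrite limg_dim_eq //.
apply/eqP; rewrite -subv0; apply/subvP=> u; rewrite memv_cap memv_ker linfun_id //.
case/andP=> _ /eqP/ffunP/(_ i); rewrite !ffunE eqxx => ->; exact: mem0v.
Qed.

(** Such an f amounts to a map from the image of e to the image of e'; [F] composes such a map with
    e and the inclusion. *)
Lemma dim_block U V (e : 'End(U)) (e' : 'End(V)) (S : {vspace 'Hom(U, V)}) :
  (forall u, e (e u) = e u) -> (forall u, e' (e' u) = e' u) ->
  (forall f : 'Hom(U, V), f \in S <-> forall u, f u = e' (f (e u))) ->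
  \dim S = (\dim (limg e) * \dim (limg e'))%N.
Proof.
move=> eK eK' SP.
pose F (g : 'Hom(subvs_of (limg e), subvs_of (limg e'))) : 'Hom(U, V) :=
  (linfun vsval \o g \o linfun (vsproj (limg e)) \o e)%VF.
have FE g u : F g u = vsval (g (vsproj (limg e) (e u))).
  by rewrite !comp_lfunE !lfunE.
have im_id (W : vectType k) (p : 'End(W)) w : (forall w, p (p w) = p w) -> w \in limg p -> p w = w.
  by move=> pK /memv_imgP[v _ ->].
transitivity (\dim {:'Hom(subvs_of (limg e), subvs_of (limg e'))}).
  apply/esym; apply: (dim_bij (f := F)).
  - by move=> c g h; apply/lfunP=> u; rewrite add_lfunE scale_lfunE !FE add_lfunE scale_lfunE.
  - move=> g _ g0; apply/lfunP=> x; rewrite zero_lfunE; apply: subvs_inj.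
    have := FE g (vsval x); rewrite g0 zero_lfunE (im_id _ e) ?subvsP // vsvalK => <-.
    by rewrite linear0.
  move=> f; split=> [/SP fS|[g _ <-]]; last first.
    apply/SP=> u; rewrite !FE eK (im_id _ e') //; exact: subvsP.
  exists (linfun (vsproj (limg e')) \o f \o linfun vsval)%VF; first exact: memvf.
  apply/lfunP=> u; rewrite FE !comp_lfunE !lfunE /=.
  rewrite [vsval (vsproj _ (e u))]vsprojK ?memv_img ?memvf //.
  by rewrite vsprojK; [rewrite [RHS]fS [LHS]fS eK | rewrite fS memv_img ?memvf].
by rewrite dimvf dim_hom.
Qed.

(** * The trace pairing *)

Import VectorInternalTheory.

Definition lftrace U V (f : 'Hom(U, V)) (g : 'Hom(V, U)) : k :=
  \tr (f2mx f *m f2mx g).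

Lemma v2r_app U V (f : 'Hom(U, V)) u :
  v2r (f u) =
  v2r u *m f2mx f.
Proof. by rewrite unlock /= r2vK. Qed.

Lemma f2mxP U V (f : 'Hom(U, V)) (A : 'M_(dim U, dim V)) :
  (forall u, v2r (f u) = v2r u *m A) ->
  f2mx f = A.
Proof.
move=> h; apply/row_matrixP=> i; rewrite !rowE.
have := h (r2v (delta_mx 0 i)).
by rewrite v2r_app r2vK.
Qed.

Lemma f2mx_comp U V W (f : 'Hom(U, V)) (g : 'Hom(V, W)) :
  f2mx (g \o f)%VF =
  f2mx f *m f2mx g.
Proof. by apply: f2mxP => u; rewrite comp_lfunE !v2r_app mulmxA. Qed.

Lemma f2mx_linear U V c (f g : 'Hom(U, V)) :
  f2mx (c *: f + g) =
  c *: f2mx f + f2mx g.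
Proof.
apply: f2mxP => u; rewrite add_lfunE scale_lfunE.
transitivity (c *: v2r (f u) + v2r (g u)).
  by rewrite linearP.
by rewrite !v2r_app mulmxDr scalemxAr.
Qed.

Lemma lftraceDl U V c (f f' : 'Hom(U, V)) g :
  lftrace (c *: f + f') g = c * lftrace f g + lftrace f' g.
Proof. by rewrite /lftrace f2mx_linear mulmxDl -scalemxAl mxtraceD mxtraceZ. Qed.

Lemma lftraceDr U V c (f : 'Hom(U, V)) g g' :
  lftrace f (c *: g + g') = c * lftrace f g + lftrace f g'.
Proof. by rewrite /lftrace f2mx_linear mulmxDr -scalemxAr mxtraceD mxtraceZ. Qed.

Lemma lftrace_compl U V (p : 'End(V)) (f : 'Hom(U, V)) g :
  lftrace (p \o f)%VF g = lftrace f (g \o p)%VF.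
Proof. by rewrite /lftrace !f2mx_comp mulmxA. Qed.

Lemma lftrace_compr U V (p : 'End(U)) (f : 'Hom(U, V)) g :
  lftrace (f \o p)%VF g = lftrace f (p \o g)%VF.
Proof. by rewrite /lftrace !f2mx_comp -mulmxA mxtrace_mulC -mulmxA. Qed.

Lemma lftrace_nondeg U V (g : 'Hom(V, U)) :
  (forall f, lftrace f g = 0) -> g = 0.
Proof.
move=> h; apply/lfunP=> v; rewrite zero_lfunE; apply: v2r_inj.
rewrite v2r_app; suff -> : f2mx g = 0.
  by rewrite mulmx0 raddf0.
apply/matrixP=> j i; have := h (Hom (delta_mx i j)).
rewrite /lftrace /= /mxtrace (bigD1 i) //= big1 => [|l li]; rewrite !mxE.
  rewrite addr0 (bigD1 j) //= big1 => [|m mj]; rewrite !mxE ?eqxx ?mul1r ?addr0 //.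
  by rewrite (negPf mj) andbF mul0r.
by rewrite big1 // => m _; rewrite !mxE (negPf li) mul0r.
Qed.

End LinearAlgebra.

(** * Homomorphisms *)

Section HomSpaces.
Variables (k : fieldType) (Q : quiver).
Implicit Types L M N X Y Z : kQmodule k Q.

Lemma is_homP M N (f : 'Hom(M, N)) :
  is_hom f <-> (forall i u, f (idem M i u) = idem N i (f u)) /\
               (forall a u, f (arrow M a u) = arrow N a (f u)).
Proof.
split=> [/andP[/forallP h1 /forallP h2]|[h1 h2]].
  split=> x u; [move/eqP: (h1 x)|move/eqP: (h2 x)] => /(congr1 (fun g : 'Hom(_, _) => g u));
  by rewrite !comp_lfunE.
by apply/andP; split; apply/forallP=> x; apply/eqP/lfunP=> u; rewrite !comp_lfunE.
Qed.

Lemma hom_idem M N (f : 'Hom(M, N)) i u : is_hom f -> f (idem M i u) = idem N i (f u).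
Proof. by case/is_homP=> h _; apply: h. Qed.

Lemma hom_arrow M N (f : 'Hom(M, N)) a u : is_hom f -> f (arrow M a u) = arrow N a (f u).
Proof. by case/is_homP=> _ h; apply: h. Qed.

Lemma hom_linfun M N (f : M -> N) : linear f ->
  (forall i u, f (idem M i u) = idem N i (f u)) ->
  (forall a u, f (arrow M a u) = arrow N a (f u)) -> is_hom (linfun f).
Proof. by move=> lf h1 h2; apply/is_homP; split=> x u; rewrite !linfun_id. Qed.

Lemma hom_id M : is_hom (\1%VF : 'Hom(M, M)).
Proof. by apply/is_homP; split=> x u; rewrite !id_lfunE. Qed.

Lemma hom_comp L M N (f : 'Hom(L, M)) (g : 'Hom(M, N)) :
  is_hom f -> is_hom g -> is_hom (g \o f)%VF.
Proof.
move=> hf hg; apply/is_homP; split=> x u; rewrite !comp_lfunE.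
  by rewrite !hom_idem.
by rewrite !hom_arrow.
Qed.

Lemma hom_lin M N c (f g : 'Hom(M, N)) : is_hom f -> is_hom g -> is_hom (c *: f + g).
Proof.
move=> hf hg; apply/is_homP; split=> x u; rewrite !add_lfunE !scale_lfunE linearP.
  by rewrite !hom_idem.
by rewrite !hom_arrow.
Qed.

Lemma hom_0 M N : is_hom (0 : 'Hom(M, N)).
Proof. by apply/is_homP; split=> x u; rewrite !zero_lfunE linear0. Qed.

Definition homs M N : {vspace 'Hom(M, N)} :=
  sval (vspace_ex (hom_0 M N) (@hom_lin M N)).

Lemma mem_homs M N f : (f \in homs M N) = is_hom f.
Proof. by apply/idP/idP; rewrite (svalP (vspace_ex (hom_0 M N) (@hom_lin M N))). Qed.

Definition hom M N : nat := \dim (homs M N).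

Lemma hom_gt0 M N : (0 < hom M N)%N <-> exists2 f : 'Hom(M, N), is_hom f & f <> 0.
Proof.
rewrite lt0n dimv_eq0; split=> [h|[f fh f0]].
  exists (vpick (homs M N)); first by rewrite -mem_homs memv_pick.
  by apply/eqP; rewrite vpick0.
apply: contra_notN f0 => /eqP h; apply/eqP.
by rewrite -memv0 -h mem_homs.
Qed.

Lemma hom_eq0 M N : hom M N = 0%N <-> forall f : 'Hom(M, N), is_hom f -> f = 0.
Proof.
split=> [h f fh|h].
  by apply: contrapT => f0; have : (0 < hom M N)%N by [apply/hom_gt0; exists f]; rewrite h.
apply/eqP; rewrite -leqn0 leqNgt; apply/negP=> /hom_gt0[f fh f0].
by apply: f0; apply: h.
Qed.

End HomSpaces.

(** * Action of paths, and paths in an acyclic quiver *)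

Section PathAction.
Variables (k : fieldType) (Q : quiver) (N : kQmodule k Q).

Definition pact i (s : seq (arr Q)) (u : N) : N :=
  foldl (fun v a => arrow N a v) (idem N i u) s.

Lemma foldl_arrow_linear s c (u v : N) :
  foldl (fun v a => arrow N a v) (c *: u + v) s =
  c *: foldl (fun v a => arrow N a v) u s + foldl (fun v a => arrow N a v) v s.
Proof. by elim: s u v => //= a s IH u v; rewrite linearP IH. Qed.

Lemma pact_linear i s : linear (pact i s).
Proof. by move=> c u v; rewrite /pact linearP foldl_arrow_linear. Qed.

Lemma arrow_src a (u : N) : arrow N a (idem N (src a) u) = arrow N a u.
Proof. by rewrite -[RHS]arrow_app -[LHS]arrow_app idem_app eqxx. Qed.

Lemma arrow_tgt a (u : N) : idem N (tgt a) (arrow N a u) = arrow N a u.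
Proof. by rewrite -[in LHS]arrow_app idem_app eqxx arrow_app. Qed.

Lemma arrow_idem a i (u : N) : arrow N a (idem N i u) = if src a == i then arrow N a u else 0.
Proof. by rewrite -arrow_src idem_app; case: eqP => _; rewrite ?arrow_src ?linear0. Qed.

Lemma idem_arrow a i (u : N) : idem N i (arrow N a u) = if i == tgt a then arrow N a u else 0.
Proof. by rewrite -arrow_tgt idem_app; case: eqP => [->|_]; rewrite ?arrow_tgt. Qed.

Lemma pact_rcons i s a u : pact i (rcons s a) u = arrow N a (pact i s u).
Proof. by rewrite /pact foldl_rcons. Qed.

Lemma pact_cons a s u : pact (src a) (a :: s) u = pact (tgt a) s (arrow N a u).
Proof. by rewrite /pact /= arrow_src arrow_tgt. Qed.

Lemma pact_end i s u : is_qpath i s -> idem N (qend i s) (pact i s u) = pact i s u.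
Proof.
elim/last_ind: s => [|s a IH]; first by rewrite /pact /= /qend /= idem_app eqxx.
by move=> _; rewrite pact_rcons /qend map_rcons last_rcons arrow_tgt.
Qed.

End PathAction.

Section Acyclic.
Variable Q : quiver.
Hypothesis acQ : acyclic Q.

Lemma is_qpath_cat (i : vtx Q) s t :
  is_qpath i (s ++ t) = is_qpath i s && is_qpath (qend i s) t.
Proof. by elim: s i => //= a s IH i; rewrite IH andbA. Qed.

Lemma is_qpath_rcons (i : vtx Q) s a :
  is_qpath i (rcons s a) = is_qpath i s && (src a == qend i s).
Proof. by rewrite -cats1 is_qpath_cat /= andbT. Qed.

(** A repeated vertex would cut out a nonempty closed subpath, so the vertices on a path are
    distinct. Hence the length bound built into [qpath] loses no path. *)
Lemma qpath_size (i : vtx Q) s : is_qpath i s -> (size s < #|vtx Q|)%N.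
Proof.
move=> h; suff u : uniq (i :: map (@tgt Q) s).
  have := max_card (mem (i :: map (@tgt Q) s)).
  by rewrite (card_uniqP u) /= size_map.
elim: s i h => //= a s IH i /andP[/eqP ai h]; rewrite -/(uniq (_ :: _)).
have /= -> := IH _ h; rewrite andbT; apply/negP=> /(nthP i)[j].
rewrite /= size_map => js e.
have : take j.+1 (a :: s) = [::]; last by [].
apply: (acQ (i := i)).
  have : is_qpath i (a :: s) by rewrite /= ai eqxx.
  by rewrite -{1}(cat_take_drop j.+1 (a :: s)) is_qpath_cat => /andP[].
rewrite /qend map_take (last_nth i) size_takel ?size_map //.
by rewrite -[RHS]e -[LHS]/(nth i (take j.+1 (map (@tgt Q) (a :: s))) j) nth_take.
Qed.

End Acyclic.

(** * The Euler form and the translate *)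

(* Ext^1(M, N) is the cokernel of the map cobd from the vertexwise maps to the *)
(* arrowwise maps; its dual, computed with the trace pairing, is Hom(N, tau M). *)
Section Extensions.
Variables (k : fieldType) (Q : quiver).
Implicit Types M N : kQmodule k Q.

Definition vdim M i : nat := \dim (limg (idem M i)).

Lemma dimvecE M i : dimvec M i = (vdim M i)%:Z. Proof. by rewrite ffunE. Qed.

(** Maps between vertex spaces are encoded as maps M -> N extended by 0, so that all blocks lie in
    one vector space. *)
Definition in_block M N i j (f : 'Hom(M, N)) := forall u, f u = idem N j (f (idem M i u)).

Lemma in_block0 M N i j : in_block i j (0 : 'Hom(M, N)).
Proof. by move=> u; rewrite !zero_lfunE linear0. Qed.

Lemma in_block_lin M N i j c (f g : 'Hom(M, N)) :
  in_block i j f -> in_block i j g -> in_block i j (c *: f + g).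
Proof.
by move=> hf hg u; rewrite !add_lfunE !scale_lfunE linearP /= -hf -hg.
Qed.

Definition block M N i j : {vspace 'Hom(M, N)} :=
  sval (vspace_ex (@in_block0 M N i j) (@in_block_lin M N i j)).

Lemma blockP M N i j f : f \in block M N i j <-> in_block i j f.
Proof. exact: (svalP (vspace_ex (@in_block0 M N i j) (@in_block_lin M N i j))). Qed.

Lemma dim_block_mod M N i j : \dim (block M N i j) = (vdim M i * vdim N j)%N.
Proof.
by apply: dim_block => [u|u|f]; [rewrite idem_app eqxx|rewrite idem_app eqxx|exact: blockP].
Qed.

Section Complex.
Variables M N : kQmodule k Q.

Definition in_vmaps (x : {ffun vtx Q -> 'Hom(M, N)}) := forall i, in_block i i (x i).
Definition in_amaps (x : {ffun arr Q -> 'Hom(M, N)}) :=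
  forall a, in_block (src a) (tgt a) (x a).
Definition in_coamaps (h : {ffun arr Q -> 'Hom(N, M)}) :=
  forall a, in_block (tgt a) (src a) (h a).
Definition in_cocycles (h : {ffun arr Q -> 'Hom(N, M)}) :=
  in_coamaps h /\ forall u, \sum_a h a (arrow N a u) = \sum_a arrow M a (h a u).

Definition cobd (x : {ffun vtx Q -> 'Hom(M, N)}) : {ffun arr Q -> 'Hom(M, N)} :=
  [ffun a => ((arrow N a \o x (src a)) - (x (tgt a) \o arrow M a))%VF].

Lemma cobdE x a u : cobd x a u = arrow N a (x (src a) u) - x (tgt a) (arrow M a u).
Proof. by rewrite ffunE add_lfunE opp_lfunE !comp_lfunE. Qed.

Lemma cobd_linear : linear cobd.
Proof.
move=> c x y; apply/ffunP=> a; apply/lfunP=> u; rewrite cobdE !ffunE.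
rewrite !(add_lfunE, opp_lfunE, scale_lfunE, comp_lfunE) linearP /= scalerBr opprD.
by rewrite addrACA.
Qed.

Lemma cobd_amaps x : in_vmaps x -> in_amaps (cobd x).
Proof.
move=> hx a u; rewrite !cobdE linearB /= arrow_tgt arrow_src; congr (_ - _).
  by rewrite [in RHS]hx idem_app eqxx -hx.
by rewrite [in RHS]hx idem_app eqxx -hx.
Qed.

Lemma vmaps_ex : {S : {vspace {ffun vtx Q -> 'Hom(M, N)}} | forall x, x \in S <-> in_vmaps x}.
Proof.
apply: vspace_ex => [i|c x y hx hy i]; rewrite !ffunE; first exact: in_block0.
exact: in_block_lin.
Qed.

Lemma amaps_ex : {S : {vspace {ffun arr Q -> 'Hom(M, N)}} | forall x, x \in S <-> in_amaps x}.
Proof.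
apply: vspace_ex => [i|c x y hx hy i]; rewrite !ffunE; first exact: in_block0.
exact: in_block_lin.
Qed.

Lemma coamaps_ex :
  {S : {vspace {ffun arr Q -> 'Hom(N, M)}} | forall x, x \in S <-> in_coamaps x}.
Proof.
apply: vspace_ex => [i|c x y hx hy i]; rewrite !ffunE; first exact: in_block0.
exact: in_block_lin.
Qed.

Lemma cocycles_ex :
  {S : {vspace {ffun arr Q -> 'Hom(N, M)}} | forall x, x \in S <-> in_cocycles x}.
Proof.
apply: vspace_ex => [|c x y [hx1 hx2] [hy1 hy2]].
  split=> [i|u]; first by rewrite ffunE; exact: in_block0.
  by rewrite !big1 // => a _; rewrite ffunE zero_lfunE ?linear0.
split=> [i|u]; first by rewrite !ffunE; exact: in_block_lin.
transitivity (c *: (\sum_a x a (arrow N a u)) + \sum_a y a (arrow N a u)).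
  rewrite scaler_sumr -big_split; apply: eq_bigr => a _.
  by rewrite !ffunE add_lfunE scale_lfunE.
rewrite hx2 hy2 scaler_sumr -big_split; apply: eq_bigr => a _.
by rewrite !ffunE add_lfunE scale_lfunE linearP.
Qed.

Definition vmaps := sval vmaps_ex.
Definition amaps := sval amaps_ex.
Definition coamaps := sval coamaps_ex.
Definition cocycles := sval cocycles_ex.
Definition cobds : {vspace {ffun arr Q -> 'Hom(M, N)}} := (linfun cobd @: vmaps)%VS.

Lemma cobdsP x : x \in cobds <-> exists2 y, in_vmaps y & cobd y = x.
Proof.
split=> [/memv_imgP[y /(svalP vmaps_ex) hy ->]|[y hy <-]].
  by exists y => //; rewrite linfun_id //; exact: cobd_linear.
by rewrite -(linfun_id cobd_linear) memv_img //; apply/(svalP vmaps_ex).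
Qed.

Lemma dim_vmaps : \dim vmaps = (\sum_i vdim M i * vdim N i)%N.
Proof.
rewrite (@dim_family _ _ _ (fun i => block M N i i)); last first.
  by move=> x; rewrite (svalP vmaps_ex); split=> h i; have := h i; rewrite blockP.
by apply: eq_bigr => i _; rewrite dim_block_mod.
Qed.

Lemma dim_amaps : \dim amaps = (\sum_a vdim M (src a) * vdim N (tgt a))%N.
Proof.
rewrite (@dim_family _ _ _ (fun a => block M N (src a) (tgt a))); last first.
  by move=> x; rewrite (svalP amaps_ex); split=> h i; have := h i; rewrite blockP.
by apply: eq_bigr => i _; rewrite dim_block_mod.
Qed.

Lemma dim_coamaps : \dim coamaps = (\sum_a vdim M (src a) * vdim N (tgt a))%N.
Proof.
rewrite (@dim_family _ _ _ (fun a => block N M (tgt a) (src a))); last first.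
  by move=> x; rewrite (svalP coamaps_ex); split=> h i; have := h i; rewrite blockP.
by apply: eq_bigr => i _; rewrite dim_block_mod mulnC.
Qed.

(** The kernel of [cobd] is Hom(M, N): a homomorphism is the sum of its diagonal blocks. *)
Lemma dim_hom_cobds : (hom M N + \dim cobds)%N = \dim vmaps.
Proof.
have [K KP] : {K : {vspace {ffun vtx Q -> 'Hom(M, N)}} |
    forall x, x \in K <-> x \in vmaps /\ cobd x = 0}.
  have cobd0 : cobd 0 = 0 by rewrite -(linfun_id cobd_linear) linear0.
  apply: vspace_ex => [|c x y [hx1 hx2] [hy1 hy2]]; first by split; rewrite ?mem0v.
  by split; [rewrite memvD ?memvZ | rewrite cobd_linear hx2 hy2 scaler0 addr0].
rewrite (rank_nullity (f := cobd) (K := K) (I := cobds) cobd_linear KP); last first.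
  move=> w; rewrite cobdsP; split=> -[y hy <-]; exists y => //.
    by apply/(svalP vmaps_ex).
  by move/(svalP vmaps_ex): hy.
congr (_ + _)%N; apply/esym.
apply: (@dim_bij _ _ _ (fun x : {ffun vtx Q -> 'Hom(M, N)} => \sum_i x i)).
- move=> c x y; rewrite scaler_sumr -big_split; apply: eq_bigr => i _.
  by rewrite !ffunE.
- move=> x /KP[/(svalP vmaps_ex) hx _] x0; apply/ffunP=> i; rewrite ffunE.
  apply/lfunP=> u; rewrite zero_lfunE; move/lfunP/(_ (idem M i u)): x0.
  rewrite sum_lfunE zero_lfunE (bigD1 i) //= big1 ?addr0 => [|j ji].
    by move=> h; rewrite hx h linear0.
  by rewrite hx idem_app (negPf ji) !linear0.
move=> f; rewrite mem_homs; split=> [hf|[x /KP[/(svalP vmaps_ex) hx x0] <-]].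
  exists [ffun i => (f \o idem M i)%VF].
    apply/KP; split.
      apply/(svalP vmaps_ex)=> i u; rewrite ffunE !comp_lfunE idem_app eqxx.
      by rewrite -hom_idem // idem_app eqxx.
    apply/ffunP=> a; apply/lfunP=> u; rewrite cobdE !ffunE zero_lfunE !comp_lfunE.
    by rewrite arrow_tgt -hom_arrow // arrow_src subrr.
  apply/lfunP=> u; rewrite sum_lfunE -{2}(idem_sum_app u) linear_sum.
  by apply: eq_bigr => i _; rewrite ffunE comp_lfunE.
have xE i j u : idem N j (x i u) = if i == j then x i u else 0.
  by rewrite [x i u]hx idem_app eq_sym; case: eqP => [->|].
have xE' i j u : x i (idem M j u) = if i == j then x i u else 0.
  by rewrite hx idem_app; case: eqP => [->|]; rewrite ?linear0 // -hx.
apply/is_homP; split=> [j u|a u]; rewrite !sum_lfunE linear_sum /=.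
  by apply: eq_bigr => i _; rewrite xE xE'.
rewrite (bigD1 (tgt a)) //= big1 => [|i ia]; last first.
  by rewrite -arrow_tgt xE' (negPf ia).
rewrite (bigD1 (src a)) //= big1 => [|i ia]; last first.
  by rewrite -arrow_src xE (negPf ia) linear0.
rewrite !addr0; move/ffunP/(_ a)/lfunP/(_ u): x0; rewrite cobdE ffunE zero_lfunE.
by move/eqP; rewrite subr_eq0 => /eqP.
Qed.

Lemma cobds_amaps : (cobds <= amaps)%VS.
Proof.
by apply/subvP=> x /cobdsP[y hy <-]; apply/(svalP amaps_ex)/cobd_amaps.
Qed.

Definition apair (x : {ffun arr Q -> 'Hom(M, N)}) (h : {ffun arr Q -> 'Hom(N, M)}) : k :=
  \sum_a lftrace (x a) (h a).

(** The projection onto [coamaps]; pairing with a coboundary only sees this projection, by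
    [apair_cobd]. *)
Definition coproj (h : {ffun arr Q -> 'Hom(N, M)}) : {ffun arr Q -> 'Hom(N, M)} :=
  [ffun a => (idem M (src a) \o h a \o idem N (tgt a))%VF].

Lemma coproj_linear : linear coproj.
Proof.
move=> c x y; apply/ffunP=> a; apply/lfunP=> u; rewrite !ffunE.
by rewrite !(add_lfunE, scale_lfunE, comp_lfunE) !linearP.
Qed.

Lemma coproj_id h : in_coamaps h -> coproj h = h.
Proof.
by move=> hh; apply/ffunP=> a; apply/lfunP=> u; rewrite ffunE !comp_lfunE -hh.
Qed.

Lemma coproj_in h : in_coamaps (coproj h).
Proof. by move=> a u; rewrite ffunE !comp_lfunE !idem_app !eqxx. Qed.

(* A vertexwise family is the family of diagonal blocks of a linear map f. *)
Lemma apair_cobd (f : 'Hom(M, N)) h :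
  apair (cobd [ffun i => (idem N i \o f \o idem M i)%VF]) h =
  lftrace f (\sum_a ((coproj h a \o arrow N a) - (arrow M a \o coproj h a))%VF).
Proof.
have tr_sum (g : 'Hom(M, N)) (F : arr Q -> 'Hom(N, M)) :
    lftrace g (\sum_a F a) = \sum_a lftrace g (F a).
  elim/big_rec2: _ => [|a y1 y2 _ <-].
    by have := lftraceDr (-1) g 0 0; rewrite scaler0 addr0 mulN1r addNr.
  by rewrite -[F a]scale1r lftraceDr mul1r scale1r.
have tr_sub (g1 g2 : 'Hom(M, N)) h1 : lftrace (g1 - g2) h1 = lftrace g1 h1 - lftrace g2 h1.
  by rewrite addrC -scaleN1r lftraceDl mulN1r addrC.
have tr_subr (g1 : 'Hom(M, N)) h1 h2 : lftrace g1 (h1 - h2) = lftrace g1 h1 - lftrace g1 h2.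
  by rewrite addrC -scaleN1r lftraceDr mulN1r addrC.
rewrite tr_sum; apply: eq_bigr => a _; rewrite ffunE tr_sub tr_subr.
have aN : (arrow N a \o idem N (src a))%VF = arrow N a.
  by apply/lfunP=> u; rewrite comp_lfunE arrow_src.
have aN' : (idem N (tgt a) \o arrow N a)%VF = arrow N a.
  by apply/lfunP=> u; rewrite comp_lfunE arrow_tgt.
have aM : (arrow M a \o idem M (src a))%VF = arrow M a.
  by apply/lfunP=> u; rewrite comp_lfunE arrow_src.
have aM' : (idem M (tgt a) \o arrow M a)%VF = arrow M a.
  by apply/lfunP=> u; rewrite comp_lfunE arrow_tgt.
rewrite !ffunE; congr (_ - _).
  rewrite !comp_lfunA aN lftrace_compr lftrace_compl; congr (lftrace f _).
  by rewrite -!comp_lfunA aN'.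
rewrite -!comp_lfunA aM' lftrace_compl comp_lfunA lftrace_compr; congr (lftrace f _).
by rewrite !comp_lfunA aM.
Qed.

(** By [apair_cobd] the annihilator of the coboundaries is the preimage of the cocycles under
    [coproj]. The kernel of [coproj] cancels in the comparison of dimensions, as [amaps] and
    [coamaps] have the same dimension. *)
Lemma dim_cocycles : (\dim cocycles + \dim cobds)%N = \dim amaps.
Proof.
have bl h : linear (fun x => apair x h : k^o).
  move=> c x y; rewrite /apair scaler_sumr -big_split; apply: eq_bigr => a _.
  by rewrite !ffunE lftraceDl.
have br x : linear (apair x : _ -> k^o).
  move=> c h h'; rewrite /apair scaler_sumr -big_split; apply: eq_bigr => a _.
  by rewrite !ffunE lftraceDr.
have [S SP] : {S : {vspace {ffun arr Q -> 'Hom(N, M)}} |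
    forall h, h \in S <-> forall x, x \in cobds -> apair x h = 0}.
  apply: vspace_ex => [x _|c h h' hx hx' x xc].
    by rewrite -(linfun_id (br x)) linear0.
  by have := br x c h h'; rewrite /= => ->; rewrite hx // hx' // scaler0 addr0.
have S_coc h : h \in S <-> in_cocycles (coproj h).
  rewrite SP; split=> [hS|[_ h2] x /cobdsP[y hy <-]].
    split; first exact: coproj_in.
    have /lfunP h0 : \sum_a ((coproj h a \o arrow N a) - (arrow M a \o coproj h a))%VF = 0.
      apply: lftrace_nondeg => f; rewrite -apair_cobd; apply: hS; apply/cobdsP.
      eexists; last by []. by move=> i u; rewrite ffunE !comp_lfunE !idem_app !eqxx.
    move=> u; apply/eqP; rewrite -subr_eq0 -sumrB; apply/eqP.
    rewrite -[RHS](zero_lfunE _ u) -h0 sum_lfunE; apply: eq_bigr => a _.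
    by rewrite add_lfunE opp_lfunE !comp_lfunE.
  have -> : y = [ffun i => (idem N i \o (\sum_j y j) \o idem M i)%VF].
    apply/ffunP=> i; apply/lfunP=> u; rewrite ffunE !comp_lfunE sum_lfunE linear_sum.
    rewrite (bigD1 i) //= big1 ?addr0 => [|j ji]; first exact: hy.
    by rewrite hy idem_app eq_sym (negPf ji).
  rewrite apair_cobd; set z := (X in lftrace _ X); have -> : z = 0; last first.
    by have := lftraceDr (-1) (\sum_j y j) 0 0; rewrite scaler0 addr0 mulN1r addNr.
  apply/lfunP=> u; rewrite sum_lfunE zero_lfunE.
  transitivity (\sum_a coproj h a (arrow N a u) - \sum_a arrow M a (coproj h a u)).
    by rewrite -sumrB; apply: eq_bigr => a _; rewrite add_lfunE opp_lfunE !comp_lfunE.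
  by rewrite h2 subrr.
have dS : (\dim S + \dim cobds)%N = dim {ffun arr Q -> 'Hom(M, N)}.
  apply: (dim_perp bl br) SP => [h h0|].
    apply/ffunP=> a; rewrite ffunE; apply: lftrace_nondeg => f.
    have := h0 [ffun b => if b == a then f else 0]; rewrite /apair (bigD1 a) //= big1.
      by rewrite ffunE eqxx addr0.
    move=> b ba; rewrite ffunE (negPf ba).
    by have := lftraceDl (-1) 0 0 (h b); rewrite scaler0 addr0 mulN1r addNr.
  by rewrite !dim_ffun !dim_hom [(dim N * _)%N]mulnC.
have [Z ZP] : {Z : {vspace {ffun arr Q -> 'Hom(N, M)}} | forall h, h \in Z <-> coproj h = 0}.
  apply: vspace_ex => [|c h h' e e'].
    by rewrite -(linfun_id coproj_linear) linear0.
  by rewrite coproj_linear e e' scaler0 addr0.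
have coc0 : in_cocycles 0 by apply/(svalP cocycles_ex)/mem0v.
have e1 : \dim S = (\dim Z + \dim cocycles)%N.
  apply: (rank_nullity coproj_linear) => h.
    rewrite ZP; split=> [h0|[]//]; split=> //; apply/S_coc; rewrite h0; exact: coc0.
  rewrite (svalP cocycles_ex); split=> [hc|[h' /S_coc hh <-//]].
  by have e := coproj_id hc.1; exists h => //; apply/S_coc; rewrite e.
have e2 : \dim {:{ffun arr Q -> 'Hom(N, M)}} = (\dim Z + \dim coamaps)%N.
  apply: (rank_nullity coproj_linear) => h.
    by rewrite ZP; split=> [h0|[]//]; split=> //; exact: memvf.
  rewrite (svalP coamaps_ex); split=> [hc|[h' _ <-]]; last exact: coproj_in.
  by exists h; [exact: memvf | exact: coproj_id].
have e3 : \dim {:{ffun arr Q -> 'Hom(N, M)}} = dim {ffun arr Q -> 'Hom(M, N)}.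
  by rewrite dimvf !dim_ffun !dim_hom [(dim N * _)%N]mulnC.
by move: dim_amaps dim_coamaps; lia.
Qed.

End Complex.
End Extensions.

(** * Homomorphisms into the translate and the Euler formula *)

Section TranslateHom.
Variables (k : fieldType) (Q : quiver).
Hypothesis acQ : acyclic Q.
Variables M N : kQmodule k Q.
Local Notation W := {ffun qpath Q -> {ffun arr Q -> M}}.

Lemma qpath_mk (i : vtx Q) s : is_qpath i s ->
  exists p : qpath Q, pstart p = i /\ parrows p = s.
Proof. by move=> h; apply: qpath_ex => //; apply/ltnW/(qpath_size acQ h). Qed.

Lemma triv_subproof (i : vtx Q) : exists p : qpath Q, (pstart p == i) && (parrows p == [::]).
Proof. by have [p [p1 p2]] := @qpath_mk i [::] isT; exists p; rewrite p1 p2 !eqxx. Qed.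

Definition triv i : qpath Q := xchoose (triv_subproof i).

Lemma triv_start i : pstart (triv i) = i.
Proof. by case/andP: (xchooseP (triv_subproof i)) => /eqP. Qed.

Lemma triv_arrows i : parrows (triv i) = [::].
Proof. by case/andP: (xchooseP (triv_subproof i)) => _ /eqP. Qed.

Lemma triv_end i : pend (triv i) = i.
Proof. by rewrite /pend triv_start triv_arrows. Qed.

Lemma qpathP (p : qpath Q) : is_qpath (pstart p) (parrows p).
Proof. exact: (valP p). Qed.

Lemma qpath_inj (p q : qpath Q) : pstart p = pstart q -> parrows p = parrows q -> p = q.
Proof.
move=> e1 e2; apply: val_inj; rewrite [LHS]surjective_pairing [RHS]surjective_pairing.
by congr (_, _) => //; exact: val_inj.
Qed.

Lemma pval_path (U : vectType k) (f : {ffun qpath Q -> U}) i s p :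
  pstart p = i -> parrows p = s -> pval f i s = f p.
Proof. by move=> <- <-; exact: pvalE. Qed.

Definition tau_of_coc (h : {ffun arr Q -> 'Hom(N, M)}) (n : N) : W :=
  [ffun p => [ffun a => h a (pact (pstart p) (parrows p) n)]].

Lemma tau_of_coc_in h n : in_cocycles h -> tau_of_coc h n \in tau_space M.
Proof.
case=> h1 h2; apply/tau_spaceP; split=> [p a|q].
  rewrite !ffunE -[pact _ _ _]pact_end ?qpathP // -/(pend p).
  rewrite [LHS]h1 idem_app; case: (eqVneq (pend p) (tgt a)) => [->//|ne].
  by rewrite !linear0.
transitivity (\sum_a h a (arrow N a (pact (pstart q) (parrows q) n))); last first.
  by rewrite h2; apply: eq_bigr => a _; rewrite !ffunE.
apply: eq_bigr => a _.
case: (boolP (is_qpath (pstart q) (rcons (parrows q) a))) => [hp|hp].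
  have [p [p1 p2]] := qpath_mk hp; rewrite (pval_path _ p1 p2) !ffunE p1 p2.
  by rewrite pact_rcons.
rewrite pval0 ?(negPf hp) // ffunE.
rewrite -[pact _ _ _]pact_end ?qpathP // arrow_idem.
by move: hp; rewrite is_qpath_rcons qpathP /= => /negPf ->; rewrite linear0.
Qed.

Definition tau_hom_of (h : {ffun arr Q -> 'Hom(N, M)}) : 'Hom(N, tau M) :=
  linfun (fun n => vsproj (tau_space M) (tau_of_coc h n)).

Lemma tau_of_coc_linear h : linear (tau_of_coc h).
Proof.
by move=> c n n'; apply/ffunP=> p; apply/ffunP=> a; rewrite !ffunE pact_linear linearP.
Qed.

Lemma tau_hom_ofE h n : in_cocycles h -> vsval (tau_hom_of h n) = tau_of_coc h n.
Proof.
move=> hc; rewrite linfun_id ?vsprojK ?tau_of_coc_in //.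
by move=> c u v; rewrite tau_of_coc_linear linearP.
Qed.

Lemma tau_idem i (x : tau M) p a :
  vsval (idem (tau M) i x) p a = if pstart p == i then vsval x p a else 0.
Proof.
rewrite [idem _ _ _]res_lfunE vsprojK.
  by rewrite lfunE /= ffunE; case: eqP => // _; rewrite ffunE.
exact: submod_idem (tau_submod M) (subvsP x).
Qed.

Lemma tau_arrow b (x : tau M) p a :
  vsval (arrow (tau M) b x) p a =
  if pstart p == tgt b then pval (vsval x) (src b) (b :: parrows p) a else 0.
Proof.
rewrite [arrow _ _ _]res_lfunE vsprojK.
  by rewrite lfunE /= ffunE; case: eqP => // _; rewrite ffunE.
exact: submod_arrow (tau_submod M) (subvsP x).
Qed.

Lemma tau_hom_of_hom h : in_cocycles h -> is_hom (tau_hom_of h).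
Proof.
move=> hc; apply/is_homP; split=> [i n|b n]; apply: subvs_inj; apply/ffunP=> p;
  apply/ffunP=> a.
  rewrite tau_idem !tau_hom_ofE // !ffunE /pact idem_app; case: eqP => // _.
  rewrite -/(pact _ _ _) (_ : foldl _ 0 _ = 0) ?linear0 //.
  by elim: (parrows p) => //= c s; rewrite linear0.
rewrite tau_arrow !tau_hom_ofE // !ffunE; case: eqP => [pb|pb]; last first.
  rewrite /pact idem_arrow; case: eqP => // _.
  rewrite (_ : foldl _ 0 _ = 0) ?linear0 //.
  by elim: (parrows p) => //= c s; rewrite linear0.
have hp : is_qpath (src b) (b :: parrows p) by rewrite /= eqxx -pb qpathP.
have [q [q1 q2]] := qpath_mk hp; rewrite (pval_path _ q1 q2) !ffunE q1 q2 pb.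
by rewrite pact_cons.
Qed.

Definition coc_of_tau (g : 'Hom(N, tau M)) : {ffun arr Q -> 'Hom(N, M)} :=
  [ffun a => linfun (fun n => vsval (g n) (triv (tgt a)) a)].

Lemma coc_of_tauE g a n : coc_of_tau g a n = vsval (g n) (triv (tgt a)) a.
Proof.
by rewrite ffunE linfun_id // => c u v; rewrite linearP /= !ffunE.
Qed.

(** Moving one arrow at a time from the path to the argument reduces every value of g to values at
    trivial paths. *)
Lemma tau_hom_path (g : 'Hom(N, tau M)) n p a : is_hom g ->
  vsval (g n) p a = coc_of_tau g a (pact (pstart p) (parrows p) n).
Proof.
move=> hg; rewrite coc_of_tauE.
suff E s i (q r : qpath Q) m : parrows q = s -> pstart q = i -> parrows r = [::] ->
    pstart r = pend q -> vsval (g m) q = vsval (g (pact i s m)) r.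
  case: (eqVneq (pend p) (tgt a)) => [pa|pa].
    by rewrite (E (parrows p) (pstart p) p (triv (tgt a))) // ?triv_arrows // triv_start.
  have /tau_spaceP[h1 _] := subvsP (g n); rewrite h1 (negPf pa).
  by rewrite -[pact _ _ _]pact_end ?qpathP // hom_idem // tau_idem triv_start eq_sym (negPf pa).
elim: s i q m => [|b s IH] i q m qs qi rs rq; apply/ffunP=> c.
  have <- : q = r by apply: qpath_inj; rewrite ?qs ?rs // rq /pend qs.
  by rewrite -[pact i [::] m]/(idem N i m) hom_idem // tau_idem qi eqxx.
have := qpathP q; rewrite qi qs /= => /andP[/eqP bi hp].
have [q' [q1 q2]] := qpath_mk hp.
have := IH (tgt b) q' (arrow N b m) q2 q1 rs; rewrite -pact_cons bi => <-; last first.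
  by rewrite rq /pend q1 q2 qs qi.
by rewrite hom_arrow // tau_arrow q1 eqxx q2 bi (pval_path _ qi qs).
Qed.

Lemma coc_of_tau_in (g : 'Hom(N, tau M)) : is_hom g -> in_cocycles (coc_of_tau g).
Proof.
move=> hg; have blk a n : coc_of_tau g a n = idem M (src a) (coc_of_tau g a (idem N (tgt a) n)).
  rewrite !coc_of_tauE hom_idem // tau_idem triv_start eqxx.
  by have /tau_spaceP[h1 _] := subvsP (g n); rewrite [LHS]h1 triv_end eqxx.
split=> // n; rewrite -(idem_sum_app n).
under eq_bigr do rewrite !linear_sum.
under [RHS]eq_bigr do rewrite !linear_sum.
rewrite exchange_big [RHS]exchange_big; apply: eq_bigr => i _ /=.
have /tau_spaceP[_ /(_ (triv i))] := subvsP (g (idem N i n)).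
rewrite triv_start triv_arrows => e.
transitivity (\sum_a pval (vsval (g (idem N i n))) i [:: a] a).
  apply: eq_bigr => a _; rewrite arrow_idem eq_sym; case: (eqVneq i (src a)) => [ia|ia].
    have hp : is_qpath i [:: a] by rewrite /= ia eqxx.
    have [p [p1 p2]] := qpath_mk hp; rewrite (pval_path _ p1 p2) tau_hom_path // p1 p2.
    by rewrite ia /pact /= idem_app eqxx arrow_src.
  by rewrite linear0 pval0 ?ffunE //= eq_sym (negPf ia).
rewrite e; apply: eq_bigr => a _; rewrite tau_hom_path // triv_start triv_arrows.
by rewrite /pact /= idem_app eqxx.
Qed.

(** g corresponds to its values at trivial paths, and the relation defining tau M, read at a trivial
    path, is the cocycle condition. *)
Lemma hom_tauE : hom N (tau M) = \dim (cocycles M N).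
Proof.
apply: (@dim_bij _ _ _ coc_of_tau).
- move=> c g h; apply/ffunP=> a; apply/lfunP=> n.
  rewrite coc_of_tauE !ffunE !add_lfunE !scale_lfunE linearP /= !ffunE.
  by rewrite -!coc_of_tauE !ffunE.
- move=> g; rewrite mem_homs => hg g0; apply/lfunP=> n; apply: subvs_inj.
  by apply/ffunP=> p; apply/ffunP=> a; rewrite tau_hom_path // g0 !(ffunE, zero_lfunE).
move=> h; rewrite (svalP (cocycles_ex M N)); split=> [hc|[g]]; last first.
  by rewrite mem_homs => hg <-; exact: coc_of_tau_in.
exists (tau_hom_of h); first by rewrite mem_homs tau_hom_of_hom.
apply/ffunP=> a; apply/lfunP=> n; rewrite coc_of_tauE tau_hom_ofE // !ffunE.
by rewrite triv_start triv_arrows /pact /= hc.1 [RHS]hc.1 idem_app eqxx.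
Qed.

(** The complex of vertexwise and arrowwise maps has Euler characteristic <M, N>. Its kernel is
    Hom(M, N), and its cokernel Ext^1(M, N) has the dimension of Hom(N, tau M), which is the
    Auslander-Reiten formula. *)
Theorem euler_formula :
  (hom M N)%:Z - (hom N (tau M))%:Z = euler (dimvec M) (dimvec N).
Proof.
have e1 := dim_hom_cobds M N; have e2 := dim_cocycles M N.
rewrite hom_tauE; rewrite dim_vmaps in e1; rewrite dim_amaps in e2.
rewrite /euler.
rewrite (_ : \sum_i _ = (\sum_i vdim M i * vdim N i)%N%:Z); last first.
  by rewrite raddf_sum; apply: eq_bigr => i _; rewrite !dimvecE.
rewrite (_ : \sum_a _ = (\sum_a vdim M (src a) * vdim N (tgt a))%N%:Z); last first.
  by rewrite raddf_sum; apply: eq_bigr => i _; rewrite !dimvecE.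
lia.
Qed.

Lemma cobd_surj (x : {ffun arr Q -> 'Hom(M, N)}) :
  hom N (tau M) = 0%N -> in_amaps x -> exists2 y, in_vmaps y & cobd y = x.
Proof.
move=> h0 hx; apply/cobdsP.
have -> : cobds M N = amaps M N; last exact/(svalP (amaps_ex M N)).
apply/eqP; rewrite eqEdim cobds_amaps -(dim_cocycles M N) -hom_tauE h0 add0n.
exact: leqnn.
Qed.

End TranslateHom.

(** * Submodules and exact sequences *)

Section ModuleTheory.
Variables (k : fieldType) (Q : quiver).
Implicit Types E L M N X Y Z : kQmodule k Q.

Lemma lker0_inj (U V : vectType k) (f : 'Hom(U, V)) : lker f = 0%VS -> injective f.
Proof. by move=> h; apply/lker0P/eqP. Qed.

Lemma lker0_intro (U V : vectType k) (f : 'Hom(U, V)) :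
  (forall u, f u = 0 -> u = 0) -> lker f = 0%VS.
Proof.
move=> h; apply/eqP; rewrite -subv0; apply/subvP=> u; rewrite memv_ker => /eqP/h->.
exact: mem0v.
Qed.

Lemma limg_full (U V : vectType k) (f : 'Hom(U, V)) :
  (forall v, exists u, f u = v) -> limg f = fullv.
Proof.
move=> h; apply/vspaceP=> v; rewrite memvf; case: (h v) => u <-.
by rewrite memv_img ?memvf.
Qed.

Lemma limg_fullP (U V : vectType k) (f : 'Hom(U, V)) v :
  limg f = fullv -> exists u, f u = v.
Proof. by move=> h; have := memvf v; rewrite -h => /memv_imgP[u _ ->]; exists u. Qed.

Lemma is_submodP M (X : {vspace M}) :
  is_submod X <-> (forall i u, u \in X -> idem M i u \in X) /\
                  (forall a u, u \in X -> arrow M a u \in X).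
Proof.
split=> [sX|[h1 h2]].
  by split=> x u uX; [exact: submod_idem|exact: submod_arrow].
apply/andP; split; apply/forallP=> x; apply/subvP=> _ /memv_imgP[u uX ->].
  exact: h1.
exact: h2.
Qed.

Lemma submod_ker M N (f : 'Hom(M, N)) : is_hom f -> is_submod (lker f).
Proof.
move=> hf; apply/is_submodP; split=> x u; rewrite !memv_ker => /eqP fu.
  by rewrite hom_idem // fu linear0.
by rewrite hom_arrow // fu linear0.
Qed.

Lemma submod_img M N (f : 'Hom(M, N)) (X : {vspace M}) :
  is_hom f -> is_submod X -> is_submod (f @: X)%VS.
Proof.
move=> hf sX; apply/is_submodP; split=> x _ /memv_imgP[u uX ->].
  by rewrite -hom_idem // memv_img // submod_idem.
by rewrite -hom_arrow // memv_img // submod_arrow.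
Qed.

Lemma submod_preim M N (f : 'Hom(M, N)) (X : {vspace N}) :
  is_hom f -> is_submod X -> is_submod (f @^-1: X)%VS.
Proof.
move=> hf sX; apply/is_submodP; split=> x u; rewrite -!memv_preim => uX.
  by rewrite hom_idem // submod_idem.
by rewrite hom_arrow // submod_arrow.
Qed.

Lemma submod_full M : is_submod (fullv : {vspace M}).
Proof. by apply/is_submodP; split=> x u _; exact: memvf. Qed.

Lemma submod_zero M : is_submod (0%VS : {vspace M}).
Proof. by apply/is_submodP; split=> x u; rewrite !memv0 => /eqP->; rewrite linear0. Qed.

Lemma submod_add M (X Y : {vspace M}) : is_submod X -> is_submod Y -> is_submod (X + Y)%VS.
Proof.
move=> sX sY; apply/is_submodP; split=> x _ /memv_addP[u uX [v vY ->]].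
  by rewrite linearD memv_add ?submod_idem.
by rewrite linearD memv_add ?submod_arrow.
Qed.

Lemma submod_cap M (X Y : {vspace M}) :
  is_submod X -> is_submod Y -> is_submod (X :&: Y)%VS.
Proof.
move=> sX sY; apply/is_submodP; split=> x u; rewrite !memv_cap => /andP[uX uY].
  by rewrite !submod_idem.
by rewrite !submod_arrow.
Qed.

Definition sub_incl M (X : {vspace M}) (sX : is_submod X) : 'Hom(submod sX, M) :=
  linfun vsval.

Lemma sub_inclE M (X : {vspace M}) (sX : is_submod X) u : sub_incl sX u = vsval u.
Proof. by rewrite lfunE. Qed.

Lemma sub_incl_hom M (X : {vspace M}) (sX : is_submod X) : is_hom (sub_incl sX).
Proof.
apply/is_homP; split=> x u; rewrite !sub_inclE [X in vsval X]res_lfunE vsprojK //.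
  exact: submod_idem sX (subvsP u).
exact: submod_arrow sX (subvsP u).
Qed.

Lemma sub_incl_inj M (X : {vspace M}) (sX : is_submod X) : lker (sub_incl sX) = 0%VS.
Proof. by apply: lker0_intro => u; rewrite sub_inclE => h; apply: subvs_inj. Qed.

Lemma sub_incl_img M (X : {vspace M}) (sX : is_submod X) : limg (sub_incl sX) = X.
Proof.
apply/vspaceP=> u; apply/memv_imgP/idP => [[v _ ->]|uX].
  by rewrite sub_inclE subvsP.
by exists (vsproj X u); rewrite ?memvf // sub_inclE vsprojK.
Qed.

Lemma sub_ses M (X : {vspace M}) (sX : is_submod X) :
  short_exact (submod sX) M (quomod sX).
Proof.
exists (sub_incl sX), (quo_proj X : 'Hom(M, quomod sX)).
by split; rewrite ?sub_incl_hom ?quo_proj_hom ?sub_incl_inj ?lker_quo_proj ?limg_quo_proj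
  ?sub_incl_img.
Qed.

Lemma factor_mono N X Y (f : 'Hom(X, Y)) (h : 'Hom(N, Y)) :
  is_hom f -> lker f = 0%VS -> is_hom h -> (limg h <= limg f)%VS ->
  exists2 h' : 'Hom(N, X), is_hom h' & forall u, f (h' u) = h u.
Proof.
move=> hf fi hh le; have hE u : f ((f^-1 \o h)%VF u) = h u.
  rewrite comp_lfunE limg_lfunVK //; apply: (subvP le); exact: memv_img (memvf _).
exists (f^-1 \o h)%VF => //; apply/is_homP; split=> x u; apply: (lker0_inj fi).
  by rewrite (hom_idem _ _ hf) !hE (hom_idem _ _ hh).
by rewrite (hom_arrow _ _ hf) !hE (hom_arrow _ _ hh).
Qed.

Lemma factor_epi N Y Z (g : 'Hom(Y, Z)) (h : 'Hom(Y, N)) :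
  is_hom g -> limg g = fullv -> is_hom h -> (lker g <= lker h)%VS ->
  exists2 h' : 'Hom(Z, N), is_hom h' & forall u, h' (g u) = h u.
Proof.
move=> hg gs hh le; have hE u : (h \o g^-1)%VF (g u) = h u.
  rewrite comp_lfunE; apply/eqP; rewrite -subr_eq0 -linearB -memv_ker.
  apply: (subvP le); rewrite memv_ker linearB /= limg_lfunVK ?subrr //.
  exact: memv_img (memvf _).
exists (h \o g^-1)%VF => //; apply/is_homP; split=> x u.
  have [v <-] := limg_fullP u gs.
  by rewrite -(hom_idem _ _ hg) !hE (hom_idem _ _ hh).
have [v <-] := limg_fullP u gs.
by rewrite -(hom_arrow _ _ hg) !hE (hom_arrow _ _ hh).
Qed.

Lemma iso_intro M N (f : 'Hom(M, N)) :
  is_hom f -> lker f = 0%VS -> limg f = fullv -> is_iso f.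
Proof. by move=> h1 h2 h3; rewrite /is_iso h1 h2 h3 !eqxx. Qed.

Lemma iso_inv M N (f : 'Hom(M, N)) : is_iso f ->
  exists g : 'Hom(N, M), [/\ is_iso g, forall u, g (f u) = u & forall u, f (g u) = u].
Proof.
case/and3P=> hf /eqP fi /eqP fs.
have le : (lker f <= lker (\1%VF : 'End(M)))%VS by rewrite fi sub0v.
have [g hg gE'] := factor_epi hf fs (hom_id M) le.
have gE u : g (f u) = u by rewrite gE' id_lfunE.
have fE u : f (g u) = u by have [v <-] := limg_fullP u fs; rewrite gE.
exists g; split=> //; apply: iso_intro => //.
  by apply: lker0_intro => u gu; rewrite -(fE u) gu linear0.
by apply: limg_full => u; exists (f u).
Qed.

Lemma isom_sym M N : isom M N -> isom N M.
Proof. by case=> f /iso_inv[g [hg _ _]]; exists g. Qed.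

Lemma isom_trans L M N : isom L M -> isom M N -> isom L N.
Proof.
case=> f /and3P[hf /eqP fi /eqP fs] [g /and3P[hg /eqP gi /eqP gs]]; exists (g \o f)%VF.
apply: iso_intro; first exact: hom_comp.
  apply: lker0_intro => u; rewrite comp_lfunE => h.
  by apply: (lker0_inj fi); apply: (lker0_inj gi); rewrite h !linear0.
apply: limg_full => w; have [v <-] := limg_fullP w gs; have [u <-] := limg_fullP v fs.
by exists u; rewrite comp_lfunE.
Qed.

Lemma vdim_ses X Y Z i : short_exact X Y Z -> vdim Y i = (vdim X i + vdim Z i)%N.
Proof.
case=> f [g [hf hg fi fg gs]].
have memI M u : (u \in limg (idem M i)) = (idem M i u == u).
  apply/memv_imgP/eqP => [[v _ ->]|<-]; first by rewrite idem_app eqxx.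
  by exists u; rewrite ?memvf.
have e1 : vdim X i = \dim (limg (idem Y i) :&: lker g).
  apply: (dim_bij (f := f)) => [c u v|u _ h|w]; first by rewrite linearP.
    by apply: (lker0_inj fi); rewrite h linear0.
  rewrite memv_cap memI -fg; split=> [/andP[/eqP wi /memv_imgP[u _ wu]]|[u]].
    exists u => //; rewrite memI; apply/eqP/(lker0_inj fi).
    by rewrite hom_idem // -wu.
  by rewrite memI => /eqP ui <-; rewrite -hom_idem // ui eqxx memv_img ?memvf.
rewrite e1 {1}/vdim -(limg_ker_dim g (limg (idem Y i))); congr (_ + \dim _)%N; apply/vspaceP=> w.
rewrite memI; apply/memv_imgP/eqP => [[u + ->]|wi].
  by rewrite memI => /eqP ui; rewrite -hom_idem // ui.
have [v gv] := limg_fullP w gs; exists (idem Y i v); last by rewrite hom_idem // gv.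
by rewrite memI idem_app eqxx.
Qed.

Lemma dimvec_ses X Y Z : short_exact X Y Z -> dimvec Y = dimvec X + dimvec Z.
Proof. by move=> h; apply/ffunP=> i; rewrite [RHS]ffunE !dimvecE (vdim_ses i h). Qed.

Lemma dim_vdim M : \dim {:M} = (\sum_i vdim M i)%N.
Proof.
have -> : fullv = (\sum_i limg (idem M i))%VS.
  apply/vspaceP=> u; rewrite memvf; apply/esym/memv_sumP.
  exists (fun i => idem M i u) => [i _|]; first by rewrite memv_img ?memvf.
  by rewrite idem_sum_app.
have /directvP -> /= : directv (\sum_i limg (idem M i)) => //.
apply/directv_sum_independent => f fA f0 i _.
have fE j : idem M i (f j) = if i == j then f j else 0.
  have /memv_imgP[u _ ->] := fA j isT; rewrite idem_app; case: eqP => // -> //.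
have := congr1 (idem M i) f0; rewrite linear0 linear_sum /= (bigD1 i) //= fE eqxx.
by rewrite big1 ?addr0 // => j ji; rewrite fE eq_sym (negPf ji).
Qed.

Lemma is_zeroP M : is_zero M <-> forall u : M, u = 0.
Proof.
rewrite /is_zero; split=> [/eqP|h].
  by rewrite dimv_eq0 => /eqP h u; apply/eqP; rewrite -memv0 -h memvf.
apply/eqP; rewrite dimv_eq0; apply/eqP/vspaceP=> u; rewrite memvf (h u) mem0v //.
Qed.

Lemma hom_self0 M : hom M M = 0%N -> is_zero M.
Proof.
move/hom_eq0/(_ _ (hom_id M))/lfunP=> h; apply/is_zeroP=> u.
by have := h u; rewrite id_lfunE zero_lfunE.
Qed.

Lemma is_zero_dimvec M : is_zero M <-> dimvec M = 0.
Proof.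
rewrite /is_zero dim_vdim; split=> [/eqP|h].
  by rewrite sum_nat_eq0 => /forallP h; apply/ffunP=> i; rewrite dimvecE (eqP (h i)) ffunE.
rewrite big1 // => i _; move/ffunP/(_ i): h; rewrite dimvecE ffunE.
by move=> [].
Qed.

Lemma vdim_isom M N i : isom M N -> vdim M i = vdim N i.
Proof.
case=> f /and3P[hf /eqP fi /eqP fs].
have h : short_exact M N (@zero_mod k Q).
  exists f, 0; split=> //; first exact: hom_0.
    by rewrite fs; apply/esym/vspaceP=> u; rewrite memv_ker zero_lfunE eqxx memvf.
  by apply: limg_full => v; exists 0; rewrite linear0; apply/esym; exact: thinmx0.
rewrite (vdim_ses i h) [vdim (@zero_mod k Q) i](_ : _ = 0%N) ?addn0 //.
by apply/eqP; rewrite dimv_eq0; apply/eqP/vspaceP=> u; rewrite (thinmx0 u) !mem0v.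
Qed.

Lemma dimvec_isom M N : isom M N -> dimvec M = dimvec N.
Proof. by move=> h; apply/ffunP=> i; rewrite !dimvecE (vdim_isom i h). Qed.

Lemma hom_mono N X Y (f : 'Hom(X, Y)) : is_hom f -> lker f = 0%VS ->
  (hom N X <= hom N Y)%N.
Proof.
move=> hf fi; apply: (dim_inj (f := fun h : 'Hom(N, X) => (f \o h)%VF)) => [c u v|h _ h0|h].
- by apply/lfunP=> x; rewrite !(add_lfunE, scale_lfunE, comp_lfunE) linearP.
- apply/lfunP=> x; apply: (lker0_inj fi); rewrite zero_lfunE linear0.
  by move/lfunP/(_ x): h0; rewrite comp_lfunE zero_lfunE.
by rewrite !mem_homs => hh; exact: hom_comp.
Qed.

Lemma hom_epi N Y Z (g : 'Hom(Y, Z)) : is_hom g -> limg g = fullv ->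
  (hom Z N <= hom Y N)%N.
Proof.
move=> hg gs; apply: (dim_inj (f := fun h : 'Hom(Z, N) => (h \o g)%VF)) => [c u v|h _ h0|h].
- by apply/lfunP=> x; rewrite !(add_lfunE, scale_lfunE, comp_lfunE).
- apply/lfunP=> z; have [y <-] := limg_fullP z gs.
  by move/lfunP/(_ y): h0; rewrite comp_lfunE !zero_lfunE.
by rewrite !mem_homs => hh; exact: hom_comp.
Qed.

Lemma hom_isom_l M M' N : isom M M' -> hom M N = hom M' N.
Proof.
case=> f /[dup] /iso_inv[g [/and3P[hg /eqP gi /eqP gs] _ _]] /and3P[hf /eqP fi /eqP fs].
by apply/eqP; rewrite eqn_leq (hom_epi N hf fs) (hom_epi N hg gs).
Qed.

Lemma hom_isom_r M M' N : isom M M' -> hom N M = hom N M'.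
Proof.
case=> f /[dup] /iso_inv[g [/and3P[hg /eqP gi /eqP gs] _ _]] /and3P[hf /eqP fi /eqP fs].
by apply/eqP; rewrite eqn_leq (hom_mono N hf fi) (hom_mono N hg gi).
Qed.

(** Left exactness of Hom(N, -). The image I of Hom(N, Y) in Hom(N, Z) is kept explicit because it
    is determined later in particular cases, such as I = 0 in [socle_chain]. *)
Lemma hom_ses_r_gen N X Y Z (f : 'Hom(X, Y)) (g : 'Hom(Y, Z)) :
  is_hom f -> is_hom g -> lker f = 0%VS -> limg f = lker g ->
  exists2 I : {vspace 'Hom(N, Z)}, hom N Y = (hom N X + \dim I)%N &
    forall h, h \in I <-> exists2 h' : 'Hom(N, Y), is_hom h' & (g \o h')%VF = h.
Proof.
move=> hf hg fi fg.
have lg : linear (fun h : 'Hom(N, Y) => (g \o h)%VF).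
  by move=> c u v; apply/lfunP=> x; rewrite !(add_lfunE, scale_lfunE, comp_lfunE) linearP.
have lf : linear (fun h : 'Hom(N, X) => (f \o h)%VF).
  by move=> c u v; apply/lfunP=> x; rewrite !(add_lfunE, scale_lfunE, comp_lfunE) linearP.
pose K := (linfun (fun h : 'Hom(N, X) => (f \o h)%VF) @: homs N X)%VS.
pose I := (linfun (fun h : 'Hom(N, Y) => (g \o h)%VF) @: homs N Y)%VS.
exists I; last first.
  move=> h; split=> [/memv_imgP[h' + ->]|[h' hh' <-]].
    by rewrite mem_homs => hh; exists h' => //; rewrite linfun_id.
  by rewrite -[(_ \o _)%VF](linfun_id lg) memv_img ?mem_homs.
rewrite {1}/hom (rank_nullity (f := fun h : 'Hom(N, Y) => (g \o h)%VF) (K := K) (I := I) lg).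
- congr (_ + _)%N; rewrite /K limg_dim_eq //; apply/eqP; rewrite -subv0.
  apply/subvP=> h; rewrite memv_cap memv_ker linfun_id // => /andP[_ /eqP/lfunP h0].
  rewrite memv0; apply/eqP/lfunP=> x; apply: (lker0_inj fi).
  by have := h0 x; rewrite comp_lfunE !zero_lfunE linear0.
- move=> h; split=> [/memv_imgP[h' + ->]|[]].
    rewrite linfun_id // !mem_homs => hh; split; first exact: hom_comp.
    apply/lfunP=> x; rewrite !comp_lfunE zero_lfunE; apply/eqP; rewrite -memv_ker -fg.
    by rewrite memv_img ?memvf.
  rewrite mem_homs => hh /lfunP h0.
  have [|h' hh' e] := factor_mono hf fi hh.
    apply/subvP=> _ /memv_imgP[x _ ->]; rewrite fg memv_ker.
    by have := h0 x; rewrite comp_lfunE zero_lfunE => ->.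
  have -> : h = (f \o h')%VF by apply/lfunP=> x; rewrite comp_lfunE e.
  by rewrite -[(_ \o _)%VF](linfun_id lf) memv_img ?mem_homs.
move=> w; split=> [/memv_imgP[h' hh ->]|[h' hh <-]]; first by exists h'; rewrite ?linfun_id.
by rewrite -[(_ \o _)%VF](linfun_id lg) memv_img.
Qed.

Lemma hom_ses_r N X Y Z : short_exact X Y Z -> (hom N Y <= hom N X + hom N Z)%N.
Proof.
case=> f [g [hf hg fi fg gs]]; have [I -> IP] := hom_ses_r_gen N hf hg fi fg.
rewrite leq_add2l; apply/dimvS/subvP=> h /IP[h' hh' <-]; rewrite mem_homs.
exact: hom_comp.
Qed.

(** The contravariant counterpart; I consists of the maps on X that extend to Y. That the identity
    is not among them is how a nonsplit extension is used in [pp_ex]. *)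
Lemma hom_ses_l_gen N X Y Z (f : 'Hom(X, Y)) (g : 'Hom(Y, Z)) :
  is_hom f -> is_hom g -> limg g = fullv -> limg f = lker g ->
  exists2 I : {vspace 'Hom(X, N)}, hom Y N = (hom Z N + \dim I)%N &
    forall h, h \in I <-> exists2 h' : 'Hom(Y, N), is_hom h' & (h' \o f)%VF = h.
Proof.
move=> hf hg gs fg.
have lg : linear (fun h : 'Hom(Z, N) => (h \o g)%VF).
  by move=> c u v; apply/lfunP=> x; rewrite !(add_lfunE, scale_lfunE, comp_lfunE).
have lf : linear (fun h : 'Hom(Y, N) => (h \o f)%VF).
  by move=> c u v; apply/lfunP=> x; rewrite !(add_lfunE, scale_lfunE, comp_lfunE).
pose K := (linfun (fun h : 'Hom(Z, N) => (h \o g)%VF) @: homs Z N)%VS.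
pose I := (linfun (fun h : 'Hom(Y, N) => (h \o f)%VF) @: homs Y N)%VS.
exists I; last first.
  move=> h; split=> [/memv_imgP[h' + ->]|[h' hh' <-]].
    by rewrite mem_homs => hh; exists h' => //; rewrite linfun_id.
  by rewrite -[(_ \o _)%VF](linfun_id lf) memv_img ?mem_homs.
rewrite {1}/hom (rank_nullity (f := fun h : 'Hom(Y, N) => (h \o f)%VF) (K := K) (I := I) lf).
- congr (_ + _)%N; rewrite /K limg_dim_eq //; apply/eqP; rewrite -subv0.
  apply/subvP=> h; rewrite memv_cap memv_ker linfun_id // => /andP[_ /eqP/lfunP h0].
  rewrite memv0; apply/eqP/lfunP=> z; have [y <-] := limg_fullP z gs.
  by have := h0 y; rewrite comp_lfunE !zero_lfunE.
- move=> h; split=> [/memv_imgP[h' + ->]|[]].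
    rewrite linfun_id // !mem_homs => hh; split; first exact: hom_comp.
    apply/lfunP=> x; rewrite !comp_lfunE zero_lfunE.
    have : f x \in lker g by rewrite -fg memv_img ?memvf.
    by rewrite memv_ker => /eqP ->; rewrite linear0.
  rewrite mem_homs => hh /lfunP h0.
  have [|h' hh' e] := factor_epi hg gs hh.
    rewrite -fg; apply/subvP=> _ /memv_imgP[x _ ->]; rewrite memv_ker.
    by have := h0 x; rewrite comp_lfunE zero_lfunE => ->.
  have -> : h = (h' \o g)%VF by apply/lfunP=> x; rewrite comp_lfunE e.
  by rewrite -[(_ \o _)%VF](linfun_id lg) memv_img ?mem_homs.
move=> w; split=> [/memv_imgP[h' hh ->]|[h' hh <-]]; first by exists h'; rewrite ?linfun_id.
by rewrite -[(_ \o _)%VF](linfun_id lf) memv_img.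
Qed.

Lemma hom_ses_l N X Y Z : short_exact X Y Z -> (hom Y N <= hom X N + hom Z N)%N.
Proof.
case=> f [g [hf hg fi fg gs]]; have [I -> IP] := hom_ses_l_gen N hf hg gs fg.
rewrite addnC leq_add2r; apply/dimvS/subvP=> h /IP[h' hh' <-]; rewrite mem_homs.
exact: hom_comp.
Qed.

End ModuleTheory.

(** * Direct sums *)

Section DirectSums.
Variables (k : fieldType) (Q : quiver).
Implicit Types E L M N X Y Z : kQmodule k Q.

Definition dinl X Y : 'Hom(X, dsum X Y) := linfun (fun u : X => (u, 0) : dsum X Y).
Definition dinr X Y : 'Hom(Y, dsum X Y) := linfun (fun u : Y => (0, u) : dsum X Y).
Definition dfst X Y : 'Hom(dsum X Y, X) := linfun (fun u : dsum X Y => u.1).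
Definition dsnd X Y : 'Hom(dsum X Y, Y) := linfun (fun u : dsum X Y => u.2).

Lemma dinlE X Y u : dinl X Y u = (u, 0).
Proof.
rewrite linfun_id // => c v w.
by rewrite [RHS](_ : _ = (c *: v + w, c *: 0 + 0)) // scaler0 addr0.
Qed.

Lemma dinrE X Y u : dinr X Y u = (0, u).
Proof.
rewrite linfun_id // => c v w.
by rewrite [RHS](_ : _ = (c *: 0 + 0, c *: v + w)) // scaler0 addr0.
Qed.

Lemma dfstE X Y u : dfst X Y u = u.1. Proof. by rewrite linfun_id. Qed.
Lemma dsndE X Y u : dsnd X Y u = u.2. Proof. by rewrite linfun_id. Qed.

Lemma dsum_idemE X Y i (u : dsum X Y) : idem (dsum X Y) i u = (idem X i u.1, idem Y i u.2).
Proof. by rewrite [LHS]lfunE. Qed.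

Lemma dsum_arrowE' X Y a (u : dsum X Y) :
  arrow (dsum X Y) a u = (arrow X a u.1, arrow Y a u.2).
Proof. by rewrite [LHS]lfunE. Qed.

Lemma dinl_hom X Y : is_hom (dinl X Y).
Proof.
by apply/is_homP; split=> x u; rewrite !dinlE ?dsum_idemE ?dsum_arrowE' /= linear0.
Qed.

Lemma dinr_hom X Y : is_hom (dinr X Y).
Proof.
by apply/is_homP; split=> x u; rewrite !dinrE ?dsum_idemE ?dsum_arrowE' /= linear0.
Qed.

Lemma dfst_hom X Y : is_hom (dfst X Y).
Proof. by apply/is_homP; split=> x u; rewrite !dfstE ?dsum_idemE ?dsum_arrowE'. Qed.

Lemma dsnd_hom X Y : is_hom (dsnd X Y).
Proof. by apply/is_homP; split=> x u; rewrite !dsndE ?dsum_idemE ?dsum_arrowE'. Qed.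

Lemma dinl_inj X Y : lker (dinl X Y) = 0%VS.
Proof. by apply: lker0_intro => u; rewrite dinlE => -[]. Qed.

Lemma dinr_inj X Y : lker (dinr X Y) = 0%VS.
Proof. by apply: lker0_intro => u; rewrite dinrE => -[]. Qed.

Lemma dfst_surj X Y : limg (dfst X Y) = fullv.
Proof. by apply: limg_full => u; exists (u, 0); rewrite dfstE. Qed.

Lemma dsnd_surj X Y : limg (dsnd X Y) = fullv.
Proof. by apply: limg_full => u; exists (0, u); rewrite dsndE. Qed.

Lemma dinl_img X Y : limg (dinl X Y) = lker (dsnd X Y).
Proof.
apply/vspaceP=> -[u v]; rewrite memv_ker dsndE /=; apply/memv_imgP/eqP => [[w _]|->].
  by rewrite dinlE => -[].
by exists u; rewrite ?memvf ?dinlE.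
Qed.

Lemma dsum_ses X Y : short_exact X (dsum X Y) Y.
Proof.
exists (dinl X Y), (dsnd X Y); split; rewrite ?dinl_hom ?dsnd_hom //.
- exact: dinl_inj.
- exact: dinl_img.
exact: dsnd_surj.
Qed.

Lemma hom_dsum_l N X Y : hom (dsum X Y) N = (hom X N + hom Y N)%N.
Proof.
have [I -> IP] := hom_ses_l_gen N (dinl_hom X Y) (dsnd_hom X Y) (dsnd_surj X Y) (dinl_img X Y).
rewrite addnC; congr (_ + _)%N; congr (\dim _); apply/vspaceP=> h; rewrite mem_homs.
apply/idP/idP => [/IP[h' hh' <-]|hh]; first exact: hom_comp (dinl_hom X Y) hh'.
apply/IP; exists (h \o dfst X Y)%VF; first exact: hom_comp (dfst_hom X Y) hh.
by apply/lfunP=> u; rewrite !comp_lfunE dinlE dfstE.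
Qed.

Lemma hom_dsum_r N X Y : hom N (dsum X Y) = (hom N X + hom N Y)%N.
Proof.
have [I -> IP] := hom_ses_r_gen N (dinl_hom X Y) (dsnd_hom X Y) (dinl_inj X Y) (dinl_img X Y).
congr (_ + _)%N; congr (\dim _); apply/vspaceP=> h; rewrite mem_homs.
apply/idP/idP => [/IP[h' hh' <-]|hh]; first exact: hom_comp hh' (dsnd_hom X Y).
apply/IP; exists (dinr X Y \o h)%VF; first exact: hom_comp hh (dinr_hom X Y).
by apply/lfunP=> u; rewrite !comp_lfunE dinrE dsndE.
Qed.

Lemma dsum_map L X Y (f : 'Hom(X, L)) (g : 'Hom(Y, L)) : is_hom f -> is_hom g ->
  exists2 h : 'Hom(dsum X Y, L), is_hom h & forall u, h u = f u.1 + g u.2.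
Proof.
move=> hf hg; exists ((f \o dfst X Y) + (g \o dsnd X Y))%VF; last first.
  by move=> u; rewrite add_lfunE !comp_lfunE dfstE dsndE.
rewrite -[X in is_hom (X + _)]scale1r; apply: hom_lin; apply: hom_comp => //.
  exact: dfst_hom.
exact: dsnd_hom.
Qed.

Lemma dsum_pair L X Y (f : 'Hom(L, X)) (g : 'Hom(L, Y)) : is_hom f -> is_hom g ->
  exists2 h : 'Hom(L, dsum X Y), is_hom h & forall u, h u = (f u, g u).
Proof.
move=> hf hg; exists ((dinl X Y \o f) + (dinr X Y \o g))%VF; last first.
  move=> u; rewrite add_lfunE !comp_lfunE dinlE dinrE.
  by rewrite [LHS](_ : _ = (f u + 0, 0 + g u)) // addr0 add0r.
rewrite -[X in is_hom (X + _)]scale1r; apply: hom_lin; apply: hom_comp => //.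
  exact: dinl_hom.
exact: dinr_hom.
Qed.

Lemma dsum_zero_r X Y : is_zero Y -> isom (dsum X Y) X.
Proof.
move/is_zeroP=> h; exists (dfst X Y); apply: iso_intro; first exact: dfst_hom.
  apply: lker0_intro => -[u v]; rewrite dfstE /= => ->; congr pair; exact: h.
exact: dfst_surj.
Qed.

Lemma dsum_zero_l X Y : is_zero X -> isom (dsum X Y) Y.
Proof.
move/is_zeroP=> h; exists (dsnd X Y); apply: iso_intro; first exact: dsnd_hom.
  apply: lker0_intro => -[u v]; rewrite dsndE /= => ->; congr pair; exact: h.
exact: dsnd_surj.
Qed.

Lemma ses_split X Y Z (f : 'Hom(X, Y)) (g : 'Hom(Y, Z)) (s : 'Hom(Z, Y)) :
  is_hom f -> is_hom s -> lker f = 0%VS -> limg f = lker g ->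
  (forall z, g (s z) = z) -> isom (dsum X Z) Y.
Proof.
move=> hf hs fi fg gs; have [h hh hE] := dsum_map hf hs; exists h.
have gf x : g (f x) = 0.
  by apply/eqP; rewrite -memv_ker -fg memv_img ?memvf.
apply: iso_intro => //.
  apply: lker0_intro => -[x z]; rewrite hE /= => e.
  have z0 : z = 0 by have := congr1 g e; rewrite linearD /= gf add0r gs linear0.
  by move: e; rewrite z0 linear0 addr0 => e; congr pair; apply: (lker0_inj fi); rewrite e linear0.
apply: limg_full => y; have : y - s (g y) \in lker g by rewrite memv_ker linearB /= gs subrr.
rewrite -fg => /memv_imgP[x _ e]; exists (x, g y); rewrite hE /= -e.
by rewrite subrK.
Qed.

End DirectSums.

(** * Lifting, splitting and extensions *)

Section Lifting.
Variables (k : fieldType) (Q : quiver).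
Hypothesis acQ : acyclic Q.
Implicit Types E L M N X Y Z : kQmodule k Q.

(** A vertexwise lift [s0] exists by linear algebra. Its failure to commute with the arrows takes
    values in N, so it is the coboundary of some y because Ext^1(M, N) = 0; subtracting i y from
    [s0] gives a homomorphism. *)
Lemma ext0_lift M N E Z (i : 'Hom(N, E)) (p : 'Hom(E, Z)) (f : 'Hom(M, Z)) :
  hom N (tau M) = 0%N -> is_hom i -> is_hom p -> lker i = 0%VS -> limg i = lker p ->
  limg p = fullv -> is_hom f ->
  exists2 s : 'Hom(M, E), is_hom s & forall u, p (s u) = f u.
Proof.
move=> e0 hi hp ii ip ps hf.
pose s0 : 'Hom(M, E) := (\sum_j (idem E j \o p^-1 \o f \o idem M j))%VF.
have s0E u : s0 u = \sum_j idem E j (p^-1%VF (f (idem M j u))).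
  by rewrite sum_lfunE; apply: eq_bigr => j _; rewrite !comp_lfunE.
have pV z : p (p^-1%VF z) = z by rewrite limg_lfunVK // ps memvf.
have ps0 u : p (s0 u) = f u.
  rewrite s0E linear_sum -{2}(idem_sum_app u) linear_sum; apply: eq_bigr => j _ /=.
  by rewrite hom_idem // pV -hom_idem // idem_app eqxx.
have s0i j u : s0 (idem M j u) = idem E j (s0 u).
  rewrite !s0E linear_sum; apply: eq_bigr => l _ /=; rewrite !idem_app eq_sym.
  by case: (eqVneq j l) => [->//|_]; rewrite !linear0.
clearbody s0.
pose x : {ffun arr Q -> 'Hom(M, N)} :=
  [ffun a => (i^-1 \o ((arrow E a \o s0) - (s0 \o arrow M a)))%VF].
have xE a u : i (x a u) = arrow E a (s0 u) - s0 (arrow M a u).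
  rewrite ffunE comp_lfunE limg_lfunVK add_lfunE opp_lfunE !comp_lfunE //.
  by rewrite ip memv_ker linearB /= (hom_arrow _ _ hp) !ps0 (hom_arrow _ _ hf) subrr.
have hx : in_amaps x.
  move=> a u; apply: (lker0_inj ii); rewrite hom_idem // !xE linearB /= s0i.
  by rewrite !arrow_src -s0i !arrow_tgt.
have [y hy yx] := cobd_surj acQ e0 hx.
have yE a u : arrow N a (y (src a) u) - y (tgt a) (arrow M a u) = x a u.
  by rewrite -yx cobdE.
have yi l j u : idem N l (y j u) = if l == j then y j u else 0.
  by rewrite [y j u]hy idem_app; case: eqP => [->|].
have yi' l j u : y j (idem M l u) = if l == j then y j u else 0.
  by rewrite hy idem_app [j == l]eq_sym; case: eqP => _; rewrite ?linear0 // -hy.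
exists (s0 - (i \o (\sum_j y j)))%VF; last first.
  move=> u; rewrite add_lfunE opp_lfunE comp_lfunE linearB /= ps0.
  have : i ((\sum_j y j) u) \in lker p by rewrite -ip memv_img ?memvf.
  by rewrite memv_ker => /eqP->; rewrite subr0.
apply/is_homP; split=> [j u|a u]; rewrite !(add_lfunE, opp_lfunE, comp_lfunE) linearB /=.
  rewrite s0i -(hom_idem _ _ hi) !sum_lfunE; congr (_ - i _); rewrite linear_sum.
  by apply: eq_bigr => l _ /=; rewrite yi yi'.
rewrite -(hom_arrow _ _ hi) !sum_lfunE (bigD1 (tgt a)) //= big1 ?addr0 => [|l la]; last first.
  by rewrite -arrow_tgt yi' eq_sym (negPf la).
rewrite linear_sum /= (bigD1 (src a)) //= big1 ?addr0 => [|l la]; last first.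
  by rewrite -arrow_src yi eq_sym (negPf la) linear0.
have := congr1 i (yE a u); rewrite xE linearB /= => e.
rewrite -[arrow E a _](subrK (s0 (arrow M a u))) -e [RHS]addrC !addrA addNr add0r.
by rewrite addrC.
Qed.

Lemma ext0_split X Y Z : hom X (tau Z) = 0%N -> short_exact X Y Z -> isom (dsum X Z) Y.
Proof.
move=> e0 [f [g [hf hg fi fg gs]]].
have [s hs sE] := ext0_lift e0 hf hg fi fg gs (hom_id Z).
by apply: (ses_split hf hs fi fg) => z; rewrite sE id_lfunE.
Qed.

Section ExtensionModule.
Variables (M N : kQmodule k Q) (x : {ffun arr Q -> 'Hom(M, N)}).
Hypothesis hx : in_amaps x.
Local Notation T := (N * M)%type.

(** The arrows of the extension of M by N with class x: those of the direct sum, with x as the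
    additional component from M to N. *)
Definition ext_arrow_fun a (u : T) : T := (arrow N a u.1 + x a u.2, arrow M a u.2).

Lemma ext_arrow_linear a : linear (ext_arrow_fun a).
Proof.
move=> c u v; rewrite /ext_arrow_fun /= !linearP /=.
rewrite [RHS](_ : _ = (c *: (arrow N a u.1 + x a u.2) + (arrow N a v.1 + x a v.2),
  c *: arrow M a u.2 + arrow M a v.2)) //.
by rewrite scalerDr addrACA.
Qed.

Definition ext_arrow a : 'End(T) := linfun (ext_arrow_fun a).
Definition ext_idem i : 'End(T) := idem (dsum N M) i.

Lemma ext_arrowE a u : ext_arrow a u = ext_arrow_fun a u.
Proof. by rewrite linfun_id //; exact: ext_arrow_linear. Qed.

Lemma ext_arrow_ax a : ext_arrow a = (ext_idem (tgt a) \o ext_arrow a \o ext_idem (src a))%VF.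
Proof.
apply/lfunP=> u; rewrite !comp_lfunE !ext_arrowE ![ext_idem _ _](@dsum_idemE k Q N M).
by rewrite /ext_arrow_fun /= linearD /= -hx !arrow_src !arrow_tgt.
Qed.

Definition ext_mod : kQmodule k Q :=
  @KQModule k Q T ext_idem ext_arrow (@idemM k Q (dsum N M)) (@idem_sum k Q (dsum N M))
    ext_arrow_ax.

Definition ext_in : 'Hom(N, ext_mod) := dinl N M.
Definition ext_out : 'Hom(ext_mod, M) := dsnd N M.

Lemma ext_in_hom : is_hom ext_in.
Proof.
apply/is_homP; split=> [j u|a u].
  exact: (hom_idem j u (dinl_hom N M)).
rewrite [arrow ext_mod _ _]ext_arrowE /ext_in !dinlE /ext_arrow_fun /=.
by rewrite !linear0 addr0.
Qed.

Lemma ext_out_hom : is_hom ext_out.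
Proof.
apply/is_homP; split=> [j u|a u].
  by rewrite /ext_out !dsndE [idem ext_mod j u](@dsum_idemE k Q N M).
by rewrite [X in ext_out X]ext_arrowE /ext_out !dsndE.
Qed.

(** Restricting r to the complement 0 x M, which is not a submodule, gives a linear map whose
    diagonal blocks have coboundary x. *)
Lemma ext_retract (r : 'Hom(ext_mod, N)) : is_hom r -> (forall u, r (ext_in u) = u) ->
  exists2 y, in_vmaps y & cobd y = x.
Proof.
move=> hr rE; have [t tE] : exists t : 'Hom(M, N), forall m, t m = r (0, m).
  by exists (r \o dinr N M)%VF => m; rewrite comp_lfunE dinrE.
have ti j m : t (idem M j m) = idem N j (t m).
  rewrite !tE -(hom_idem _ _ hr); congr (r _).
  by rewrite [RHS](@dsum_idemE k Q N M) /= linear0.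
exists [ffun j => (t \o idem M j)%VF].
  move=> j m; rewrite ffunE !comp_lfunE idem_app eqxx ti.
  by rewrite idem_app eqxx.
apply/ffunP=> a; apply/lfunP=> m; rewrite cobdE !ffunE !comp_lfunE.
rewrite ti arrow_src arrow_tgt !tE -(hom_arrow _ _ hr).
rewrite [arrow ext_mod a _]ext_arrowE /ext_arrow_fun /= linear0 add0r.
have -> : (x a m, arrow M a m) = ext_in (x a m) + (0, arrow M a m) :> ext_mod.
  by rewrite [ext_in _]dinlE [RHS](_ : _ = (x a m + 0, 0 + arrow M a m)) // addr0 add0r.
by rewrite linearD /= rE addrK.
Qed.

End ExtensionModule.

Lemma nonsplit_ext M N : (0 < hom N (tau M))%N ->
  exists E (f : 'Hom(N, E)) (g : 'Hom(E, M)),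
    [/\ is_hom f, is_hom g, lker f = 0%VS, limg f = lker g & limg g = fullv] /\
    forall r : 'Hom(E, N), is_hom r -> ~ (forall u, r (f u) = u).
Proof.
move=> h; have : ~~ (amaps M N <= cobds M N)%VS.
  apply: contraL h => /dimvS; rewrite -(dim_cocycles M N) -(hom_tauE acQ); lia.
case/subvPn=> x /(svalP (amaps_ex M N)) hx xc.
exists (ext_mod hx), (ext_in hx), (ext_out hx); split.
  by split; [exact: ext_in_hom|exact: ext_out_hom|exact: dinl_inj|exact: dinl_img
    |exact: dsnd_surj].
move=> r hr rE; case/negP: xc; apply/cobdsP; exact: ext_retract hr rE.
Qed.

End Lifting.

(** * Preprojective modules and torsion modules *)

Section TranslateFunctor.
Variables (k : fieldType) (Q : quiver).
Implicit Types E L M N X Y Z : kQmodule k Q.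

Definition tau_fun M N (f : 'Hom(M, N)) (x : {ffun qpath Q -> {ffun arr Q -> M}}) :
  {ffun qpath Q -> {ffun arr Q -> N}} := [ffun p => [ffun a => f (x p a)]].

Lemma tau_fun_linear M N (f : 'Hom(M, N)) : linear (tau_fun f).
Proof.
by move=> c x y; apply/ffunP=> p; apply/ffunP=> a; rewrite !ffunE linearP.
Qed.

Lemma tau_fun_pval M N (f : 'Hom(M, N)) x i s a :
  pval (tau_fun f x) i s a = f (pval x i s a).
Proof.
by rewrite !pval_coord linear_sum; apply: eq_bigr => p _; rewrite !ffunE.
Qed.

Lemma tau_fun_in M N (f : 'Hom(M, N)) x : is_hom f ->
  x \in tau_space M -> tau_fun f x \in tau_space N.
Proof.
move=> hf /tau_spaceP[h1 h2]; apply/tau_spaceP; split=> [p a|q].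
  rewrite !ffunE h1; case: eqP => // _; last by rewrite linear0.
  by rewrite hom_idem // idem_app eqxx.
under eq_bigr do rewrite tau_fun_pval.
rewrite -linear_sum h2 linear_sum; apply: eq_bigr => a _ /=.
by rewrite !ffunE hom_arrow.
Qed.

Definition tau_map M N (f : 'Hom(M, N)) : 'Hom(tau M, tau N) :=
  linfun (fun x : tau M => vsproj (tau_space N) (tau_fun f (vsval x))).

Lemma tau_mapE M N (f : 'Hom(M, N)) x : is_hom f ->
  vsval (tau_map f x) = tau_fun f (vsval x).
Proof.
move=> hf; rewrite linfun_id ?vsprojK //; first exact: tau_fun_in (subvsP x).
by move=> c u v; rewrite linearP tau_fun_linear linearP.
Qed.

Lemma tau_map_hom M N (f : 'Hom(M, N)) : is_hom f -> is_hom (tau_map f).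
Proof.
move=> hf; apply/is_homP; split=> [i x|b x]; apply: subvs_inj; apply/ffunP=> p;
  apply/ffunP=> a.
  rewrite tau_mapE // !ffunE !tau_idem tau_mapE // !ffunE.
  by case: eqP => // _; rewrite linear0.
rewrite tau_mapE // !ffunE !tau_arrow tau_mapE // tau_fun_pval.
by case: eqP => // _; rewrite linear0.
Qed.

Lemma tau_map_inj M N (f : 'Hom(M, N)) : is_hom f -> lker f = 0%VS -> lker (tau_map f) = 0%VS.
Proof.
move=> hf fi; apply: lker0_intro => x /(congr1 vsval); rewrite tau_mapE // linear0 => h.
apply: subvs_inj; rewrite linear0; apply/ffunP=> p; apply/ffunP=> a.
apply: (lker0_inj fi); move/ffunP/(_ p)/ffunP/(_ a): h.
by rewrite !ffunE linear0.
Qed.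

(** The translate is a space of families with values in the module. A family killed by g has all
    values in the image of f, and their unique preimages satisfy the defining relations because f is
    injective. *)
Lemma tau_map_exact X Y Z (f : 'Hom(X, Y)) (g : 'Hom(Y, Z)) :
  is_hom f -> is_hom g -> lker f = 0%VS -> limg f = lker g ->
  (lker (tau_map g) <= limg (tau_map f))%VS.
Proof.
move=> hf hg fi fg; apply/subvP=> y; rewrite memv_ker => /eqP/(congr1 vsval).
rewrite tau_mapE // linear0 => h.
have yE p a : exists x : X, f x == vsval y p a.
  have : vsval y p a \in limg f.
    rewrite fg memv_ker; move/ffunP/(_ p)/ffunP/(_ a): h.
    by rewrite !ffunE => ->.
  by case/memv_imgP=> x _ ->; exists x.
pose z : {ffun qpath Q -> {ffun arr Q -> X}} := [ffun p => [ffun a => xchoose (yE p a)]].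
have zE p a : f (z p a) = vsval y p a by rewrite !ffunE; apply/eqP/(xchooseP (yE p a)).
clearbody z.
have zf : tau_fun f z = vsval y by apply/ffunP=> p; apply/ffunP=> a; rewrite !ffunE zE.
have /tau_spaceP[h1 h2] := subvsP y.
have zt : z \in tau_space X.
  apply/tau_spaceP; split=> [p a|q]; apply: (lker0_inj fi).
    rewrite zE h1; case: eqP => _; last by rewrite linear0.
    by rewrite hom_idem // zE.
  have := h2 q; rewrite -zf; under eq_bigr do rewrite tau_fun_pval.
  rewrite -linear_sum /= => ->; rewrite linear_sum; apply: eq_bigr => a _ /=.
  by rewrite !ffunE hom_arrow // ffunE.
apply/memv_imgP; exists (vsproj (tau_space X) z); first exact: memvf.
by apply: subvs_inj; rewrite tau_mapE // vsprojK.
Qed.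

End TranslateFunctor.

(* [pp M] says that M is a direct sum of indecomposable preprojective modules, *)
(* [tor M] that no nonzero quotient of M is.                                  *)
Section TorsionPair.
Variables (k : fieldType) (Q : quiver).
Implicit Types E L M N X Y Z : kQmodule k Q.

Definition pp M := exists n, is_zero (iter n (@tau k Q) M).
Definition tor M := forall N, pp N -> hom M N = 0%N.

Lemma pp_tau M : pp (tau M) <-> pp M.
Proof.
split=> [[n h]|[n h]]; first by exists n.+1; rewrite iterSr.
(* For n = 0 the module M is zero, hence so is tau M, whose elements are families with values in
   M. *)
case: n h => [|n] h; last by exists n; rewrite -iterSr.
exists 0%N; apply/is_zeroP=> /= x; apply: subvs_inj; apply/ffunP=> p; apply/ffunP=> a.
move/is_zeroP: h => /= h; rewrite (h (vsval x p a)); apply/esym; exact: h.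
Qed.

Lemma zero_inj M N (f : 'Hom(M, N)) : lker f = 0%VS -> is_zero N -> is_zero M.
Proof.
move=> fi /is_zeroP h; apply/is_zeroP=> u; apply: (lker0_inj fi).
by rewrite (h (f u)) (h (f 0)).
Qed.

Lemma pp_mono M N (f : 'Hom(M, N)) : is_hom f -> lker f = 0%VS -> pp N -> pp M.
Proof.
move=> hf fi [n h]; exists n.
elim: n M N f hf fi h => [|n IH] M N f hf fi; first exact: (@zero_inj M N f).
rewrite !iterSr; apply: IH (tau_map_hom hf) (tau_map_inj hf fi).
Qed.

Lemma pp_sub M (X : {vspace M}) (sX : is_submod X) : pp M -> pp (submod sX).
Proof. exact: pp_mono (sub_incl_hom sX) (sub_incl_inj sX). Qed.

Lemma pp_isom M N : isom M N -> pp N -> pp M.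
Proof. by case=> f /and3P[hf /eqP fi _]; exact: pp_mono hf fi. Qed.

(** Induction on the exponent killing Z: the kernel of tau Y -> tau Z embeds into tau X, which is in
    [pp]. Surjectivity is lost under tau, so the statement asks for exactness at X and Y only. *)
Lemma pp_ext X Y Z (f : 'Hom(X, Y)) (g : 'Hom(Y, Z)) :
  is_hom f -> is_hom g -> lker f = 0%VS -> limg f = lker g -> pp X -> pp Z -> pp Y.
Proof.
move=> hf hg fi fg pX [n]; elim: n X Y Z f g hf hg fi fg pX => [|n IH] X Y Z f g hf hg fi fg pX.
  move/is_zeroP=> /= h; apply: pp_isom pX; apply: isom_sym; exists f; apply: iso_intro => //.
  by rewrite fg; apply/vspaceP=> u; rewrite memv_ker (h (g u)) eqxx memvf.
rewrite iterSr => hz; apply/pp_tau.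
have hg' := tau_map_hom hg.
have sK := submod_ker hg'.
apply: (IH (submod sK) (tau Y) (tau Z) (sub_incl sK) (tau_map g)) => //.
- exact: sub_incl_hom.
- exact: sub_incl_inj.
- exact: sub_incl_img.
have [|h hh hE] := factor_mono (tau_map_hom hf) (tau_map_inj hf fi) (sub_incl_hom sK).
  by rewrite sub_incl_img; exact: tau_map_exact.
apply: (pp_mono hh _ (iffRL (pp_tau X) pX)).
apply: lker0_intro => u hu; apply: (lker0_inj (sub_incl_inj sK)).
by rewrite -hE hu !linear0.
Qed.

Lemma pp_zero M : is_zero M -> pp M. Proof. by exists 0%N. Qed.

Lemma pp_tau' M : pp M -> pp (tau M). Proof. by move/pp_tau. Qed.

Lemma tor_epi M N (f : 'Hom(M, N)) : is_hom f -> limg f = fullv -> tor M -> tor N.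
Proof.
move=> hf fs tM L pL; apply/eqP; rewrite -leqn0 -(tM L pL).
exact: hom_epi hf fs.
Qed.

Lemma tor_ses X Y Z : short_exact X Y Z -> tor X -> tor Z -> tor Y.
Proof.
move=> h tX tZ L pL; apply/eqP; rewrite -leqn0.
by apply: leq_trans (hom_ses_l L h) _; rewrite tX // tZ.
Qed.

Lemma tor_isom M N : isom M N -> tor M -> tor N.
Proof. by case=> f /and3P[hf _ /eqP fs]; exact: tor_epi hf fs. Qed.

Hypothesis acQ : acyclic Q.

Lemma ext_pp_tor M N : pp M -> tor N -> hom N (tau M) = 0%N.
Proof. by move=> pM tN; apply: tN; apply/pp_tau. Qed.

(* The torsion submodule, the smallest one with a preprojective quotient.     *)
Lemma torsion_ses M : exists (X : {vspace M}) (sX : is_submod X),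
  tor (submod sX) /\ pp (quomod sX).
Proof.
pose good n := `[< exists (X : {vspace M}) (sX : is_submod X),
  \dim X = n /\ pp (quomod sX) >].
have ex : exists n, good n.
  exists (\dim {:M}); apply/asboolP; exists fullv, (submod_full M); split=> //.
  apply: pp_zero; apply/is_zeroP=> u.
  have [v <-] := limg_fullP u (limg_quo_proj fullv).
  by apply/eqP; rewrite quo_proj0 memvf.
case: (ex_minnP ex) => m /asboolP[X [sX [dX pX]]] mn; exists X, sX; split=> // N pN.
(* [g] is the kernel of h as a submodule of M. M / g is an extension of M / X by the image of h,
   which lies in N; so it is in [pp], and minimality of X forces g = X, that is h = 0. *)
apply/hom_eq0 => h hh; pose g := (sub_incl sX @: lker h)%VS.
have sg : is_submod g by apply: submod_img (sub_incl_hom sX) (submod_ker hh).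
have gX : (g <= X)%VS by rewrite -[X in (_ <= X)%VS](sub_incl_img sX) limgS ?subvf.
have dg : \dim g = \dim (lker h).
  apply: limg_dim_eq; apply/eqP; rewrite -subv0 -(sub_incl_inj sX); exact: capvSr.
have pg : pp (quomod sg).
  have [|q hq qE] := @factor_epi k Q (quomod sX) M (quomod sg) (quo_proj g) (quo_proj X)
    (quo_proj_hom sg) (limg_quo_proj g) (quo_proj_hom sX).
    by rewrite !lker_quo_proj.
  have sK := submod_ker hq.
  apply: (pp_ext (sub_incl_hom sK) hq (sub_incl_inj sK) (sub_incl_img sK)) pX.
  pose r : 'Hom(submod sX, quomod sg) := ((quo_proj g : 'Hom(M, quomod sg)) \o sub_incl sX)%VF.
  have hr : is_hom r by apply: hom_comp (sub_incl_hom sX) (quo_proj_hom sg).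
  have rE u : r u = quo_proj g (vsval u) by rewrite comp_lfunE sub_inclE.
  have rI : limg r = lker q.
    apply/vspaceP=> w; rewrite memv_ker; apply/memv_imgP/eqP => [[u _ ->]|].
      by rewrite rE qE; apply/eqP; rewrite quo_proj0 subvsP.
    have [v <-] := limg_fullP w (limg_quo_proj g); rewrite qE => /eqP.
    rewrite quo_proj0 => vX; exists (vsproj X v); first exact: memvf.
    by rewrite rE vsprojK.
  have rK : lker r = lker h.
    apply/vspaceP=> u; rewrite !memv_ker rE quo_proj0; apply/memv_imgP/eqP.
      by case=> v; rewrite memv_ker sub_inclE => /eqP hv /subvs_inj ->.
    by move=> hu; exists u; rewrite ?memv_ker ?hu ?sub_inclE.
  have [|t ht tE] := factor_mono (sub_incl_hom sK) (sub_incl_inj sK) hr.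
    by rewrite sub_incl_img rI.
  have ts : limg t = fullv.
    apply: limg_full => w; have : vsval w \in limg r by rewrite rI subvsP.
    case/memv_imgP=> u _ e; exists u; apply: subvs_inj.
    by rewrite -sub_inclE tE e.
  have tk : lker t = lker h.
    rewrite -rK; apply/vspaceP=> u; rewrite !memv_ker -tE sub_inclE.
    apply/eqP/eqP => [->|e]; first by rewrite linear0.
    by apply: subvs_inj; rewrite e linear0.
  have [|v hv vE] := factor_epi ht ts hh; first by rewrite tk.
  apply: pp_mono hv _ pN; apply: lker0_intro => w; have [u <-] := limg_fullP w ts.
  by rewrite vE => /eqP; rewrite -memv_ker -tk memv_ker => /eqP.
have : (m <= \dim g)%N by apply: mn; apply/asboolP; exists g, sg.
rewrite dg => le; apply/lfunP=> u; rewrite zero_lfunE; apply/eqP; rewrite -memv_ker.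
suff -> : lker h = fullv by exact: memvf.
by apply/eqP; rewrite eqEdim subvf dimvf /=; move: le; rewrite -dX.
Qed.

(** Ext^1 from a preprojective to a torsion module is dual to maps from the torsion module to
    another preprojective, so it vanishes and the torsion sequence splits. *)
Lemma torsion_split M : exists A B, [/\ tor A, pp B & isom (dsum A B) M].
Proof.
have [X [sX [tX pX]]] := torsion_ses M.
exists (submod sX), (quomod sX); split=> //; apply: ext0_split (sub_ses sX) => //.
exact: ext_pp_tor.
Qed.

Lemma indec_tor M : indecomposable M -> ~ pp M -> tor M.
Proof.
move=> [_ indM] npM; have [A [B [tA pB iM]]] := torsion_split M.
case: (indM A B (isom_sym iM)) => z.
  by case: npM; apply: pp_isom (isom_sym iM) _; apply: pp_isom (dsum_zero_l B z) pB.
by apply: tor_isom iM _; apply: tor_isom (isom_sym (dsum_zero_r A z)) tA.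
Qed.

End TorsionPair.

(** * Projective modules and the defect *)

Section Projectives.
Variables (k : fieldType) (Q : quiver).
Hypothesis acQ : acyclic Q.
Implicit Types E L M N X Y Z : kQmodule k Q.

Section ProjectiveAtVertex.
Variable i : vtx Q.

(** The paths starting at i are the basis of the projective module kQ e_i, which is [proj] below. *)
Definition pathfrom := {p : qpath Q | pstart p == i}.
Local Notation F := {ffun pathfrom -> k^o}.
Definition pf_arrows (p : pathfrom) := parrows (val p).
Definition pf_end (p : pathfrom) := pend (val p).

Lemma pf_start (p : pathfrom) : pstart (val p) = i.
Proof. exact/eqP/(valP p). Qed.

Lemma pf_path (p : pathfrom) : is_qpath i (pf_arrows p).
Proof. by rewrite -(pf_start p); exact: qpathP. Qed.

Lemma pf_inj (p q : pathfrom) : pf_arrows p = pf_arrows q -> p = q.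
Proof. by move=> h; apply: val_inj; apply: qpath_inj => //; rewrite !pf_start. Qed.

Lemma pf_endE (p : pathfrom) : pf_end p = qend i (pf_arrows p).
Proof. by rewrite /pf_end /pend pf_start. Qed.

Lemma pf_mk s : is_qpath i s -> exists p : pathfrom, pf_arrows p = s.
Proof.
move=> h; have [p [p1 p2]] := qpath_mk acQ h.
have hp : pstart p == i by rewrite p1.
by exists (exist _ p hp).
Qed.

Definition proj_idem_fun j (f : F) : F := [ffun p => if pf_end p == j then f p else 0].
Definition proj_arrow_fun a (f : F) : F :=
  [ffun p => \sum_(q : pathfrom | rcons (pf_arrows q) a == pf_arrows p) f q].

Lemma proj_idem_linear j : linear (proj_idem_fun j).
Proof.
move=> c f g; apply/ffunP=> p; rewrite !ffunE; case: eqP => _ //.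
by rewrite scaler0 addr0.
Qed.

Lemma proj_arrow_linear a : linear (proj_arrow_fun a).
Proof.
move=> c f g; apply/ffunP=> p; rewrite !ffunE scaler_sumr -big_split.
by apply: eq_bigr => q _; rewrite !ffunE.
Qed.

Definition proj_idem j : 'End(F) := linfun (proj_idem_fun j).
Definition proj_arrow a : 'End(F) := linfun (proj_arrow_fun a).

Lemma proj_idemE j f p : proj_idem j f p = if pf_end p == j then f p else 0.
Proof. by rewrite linfun_id ?ffunE //; exact: proj_idem_linear. Qed.

Lemma proj_arrowE a f p :
  proj_arrow a f p = \sum_(q : pathfrom | rcons (pf_arrows q) a == pf_arrows p) f q.
Proof. by rewrite linfun_id ?ffunE //; exact: proj_arrow_linear. Qed.

Lemma proj_idemM j l :
  (proj_idem j \o proj_idem l)%VF = if j == l then proj_idem j else 0.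
Proof.
apply/lfunP=> f; apply/ffunP=> p; rewrite comp_lfunE !proj_idemE.
case: (eqVneq j l) => [->|jl]; first by rewrite proj_idemE; case: eqP.
rewrite zero_lfunE ffunE; case: (eqVneq (pf_end p) j) => // ->.
by rewrite (negPf jl).
Qed.

Lemma proj_idem_sum : \sum_j proj_idem j = \1%VF.
Proof.
apply/lfunP=> f; rewrite sum_lfunE id_lfunE; apply/ffunP=> p.
rewrite sum_ffunE (bigD1 (pf_end p)) //= big1 => [|j jp].
  by rewrite addr0 proj_idemE eqxx.
by rewrite proj_idemE eq_sym (negPf jp).
Qed.

Lemma proj_arrow_ax a :
  proj_arrow a = (proj_idem (tgt a) \o proj_arrow a \o proj_idem (src a))%VF.
Proof.
apply/lfunP=> f; apply/ffunP=> p; rewrite !comp_lfunE proj_idemE !proj_arrowE.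
have E q : rcons (pf_arrows q) a == pf_arrows p -> pf_end p = tgt a /\ pf_end q = src a.
  move=> /eqP e; rewrite !pf_endE -e /qend map_rcons last_rcons; split=> //.
  by have := pf_path p; rewrite -e is_qpath_rcons => /andP[_ /eqP].
case: eqP => [_|ne].
  by apply: eq_bigr => q /E[_ e]; rewrite proj_idemE e eqxx.
by rewrite big1 // => q /E[/ne].
Qed.

Definition proj : kQmodule k Q := KQModule proj_idemM proj_idem_sum proj_arrow_ax.

Lemma pf_triv_subproof : exists p : pathfrom, pf_arrows p == [::].
Proof. by have [p e] := @pf_mk [::] isT; exists p; rewrite e. Qed.

Definition pf_triv := xchoose pf_triv_subproof.

Lemma pf_triv_arrows : pf_arrows pf_triv = [::].
Proof. exact/eqP/(xchooseP pf_triv_subproof). Qed.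

Definition pf_delta (p : pathfrom) : proj := [ffun q => if q == p then 1 else 0].

Lemma pf_deltaE (f : proj) : f = \sum_p f p *: pf_delta p.
Proof.
apply/ffunP=> q; rewrite sum_ffunE (bigD1 q) //= big1 ?addr0 => [|p pq].
  by rewrite !ffunE eqxx [_ *: _]mulr1.
by rewrite !ffunE eq_sym (negPf pq) scaler0.
Qed.

Lemma pf_delta_arrow p q a : pf_arrows p = rcons (pf_arrows q) a ->
  arrow proj a (pf_delta q) = pf_delta p.
Proof.
move=> e; apply/ffunP=> r; rewrite [LHS]proj_arrowE ffunE.
case: (eqVneq r p) => [->|rp].
  rewrite (big_pred1 q) ?ffunE ?eqxx // => s /=; rewrite e eqseq_rcons eqxx andbT.
  by apply/eqP/eqP => [/pf_inj|->].
apply: big1 => s /eqP e'; rewrite ffunE; case: eqP => // sq.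
by case/eqP: rp; apply: pf_inj; rewrite e -e' sq.
Qed.

Lemma pf_delta_triv : idem proj i (pf_delta pf_triv) = pf_delta pf_triv.
Proof.
apply/ffunP=> q; rewrite [LHS]proj_idemE !ffunE; case: eqP => // ne; case: eqP => // e.
by case: ne; rewrite e pf_endE pf_triv_arrows.
Qed.

Lemma pf_delta_pact p : pf_delta p = pact i (pf_arrows p) (pf_delta pf_triv).
Proof.
move: {2}(pf_arrows p) (erefl (pf_arrows p)) => s.
elim/last_ind: s p => [|s a IH] p e.
  rewrite e -[RHS]/(idem proj i (pf_delta pf_triv)) pf_delta_triv; congr pf_delta.
  by apply: pf_inj; rewrite e pf_triv_arrows.
have hs : is_qpath i s by have := pf_path p; rewrite e is_qpath_rcons => /andP[].
have [q qs] := pf_mk hs; rewrite e pact_rcons -[X in pact i X _]qs -IH //.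
by rewrite (@pf_delta_arrow p) // e qs.
Qed.

Section Universal.
Variables (M : kQmodule k Q) (m : M).

Definition proj_to_fun (f : proj) : M := \sum_p f p *: pact i (pf_arrows p) m.

Lemma proj_to_linear : linear proj_to_fun.
Proof.
move=> c f g; rewrite /proj_to_fun scaler_sumr -big_split; apply: eq_bigr => p _.
by rewrite !ffunE scalerDl scalerA.
Qed.

Lemma proj_to_hom : is_hom (linfun proj_to_fun).
Proof.
apply: hom_linfun => [|j f|a f]; first exact: proj_to_linear.
  rewrite /proj_to_fun linear_sum; apply: eq_bigr => p _ /=.
  rewrite proj_idemE linearZ /= -[in RHS](pact_end _ (pf_path p)) idem_app -pf_endE eq_sym.
  case: eqP => [->|_]; last by rewrite scale0r scaler0.
  by rewrite pf_endE pact_end ?pf_path.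
rewrite /proj_to_fun linear_sum /=.
under eq_bigr do rewrite proj_arrowE scaler_suml.
rewrite (exchange_big_dep predT) //=; apply: eq_bigr => q _.
rewrite linearZ /= -scaler_sumr; congr (_ *: _); rewrite -pact_rcons.
case: (boolP (is_qpath i (rcons (pf_arrows q) a))) => [h|h].
  have [p e] := pf_mk h; rewrite (big_pred1 p) ?e // => r /=.
  by rewrite -e; apply/eqP/eqP => [/pf_inj|->].
rewrite big_pred0 => [|r]; last first.
  by apply: contraNF h => /eqP->; exact: pf_path.
rewrite pact_rcons -(pact_end _ (pf_path q)) arrow_idem.
by move: h; rewrite is_qpath_rcons pf_path /= => /negPf->.
Qed.

Lemma proj_to_triv : idem M i m = m -> linfun proj_to_fun (pf_delta pf_triv) = m.
Proof.
move=> im; rewrite linfun_id; last exact: proj_to_linear.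
rewrite /proj_to_fun (bigD1 pf_triv) //= big1 ?addr0 => [|p pt].
  by rewrite ffunE eqxx scale1r pf_triv_arrows.
by rewrite ffunE (negPf pt) scale0r.
Qed.

End Universal.

Lemma hom_pact M N (g : 'Hom(M, N)) j s u : is_hom g -> g (pact j s u) = pact j s (g u).
Proof.
move=> hg; elim/last_ind: s => [|s a IH]; first exact: hom_idem.
by rewrite !pact_rcons hom_arrow // IH.
Qed.

Lemma hom_proj M : hom proj M = vdim M i.
Proof.
apply: (dim_bij (f := fun g : 'Hom(proj, M) => g (pf_delta pf_triv))) => [c g h|g|m].
- by rewrite add_lfunE scale_lfunE.
- rewrite mem_homs => hg g0; apply/lfunP=> f; rewrite zero_lfunE (pf_deltaE f) linear_sum.
  apply: big1 => p _; rewrite linearZ /= pf_delta_pact (hom_pact (M := proj)) // g0.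
  by rewrite -(linfun_id (@pact_linear k Q M i _)) linear0 scaler0.
split=> [/memv_imgP[u _ ->]|[g + <-]].
  exists (linfun (proj_to_fun (idem M i u))); first by rewrite mem_homs proj_to_hom.
  by rewrite proj_to_triv // idem_app eqxx.
rewrite mem_homs => hg; rewrite -pf_delta_triv hom_idem //.
by rewrite memv_img ?memvf.
Qed.

Lemma proj_lift E M (p : 'Hom(E, M)) (f : 'Hom(proj, M)) :
  is_hom p -> limg p = fullv -> is_hom f ->
  exists2 s : 'Hom(proj, E), is_hom s & forall u, p (s u) = f u.
Proof.
move=> hp ps hf; have [e pe] := limg_fullP (f (pf_delta pf_triv)) ps.
exists (linfun (proj_to_fun (idem E i e))); first exact: proj_to_hom.
move=> u; rewrite (pf_deltaE u) !linear_sum; apply: eq_bigr => q _ /=.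
rewrite !linearZ /= pf_delta_pact.
rewrite (hom_pact (M := proj) (g := f)) // (hom_pact (M := proj) (N := E)); last exact: proj_to_hom.
rewrite hom_pact //.
rewrite proj_to_triv ?idem_app ?eqxx // hom_idem // pe -hom_idem //.
by rewrite pf_delta_triv.
Qed.

(** A section s of an extension g by N exists by [proj_lift]; then 1 - s g has image in N and is a
    retraction, so no extension is nonsplit. *)
Lemma proj_ext0 N : hom N (tau proj) = 0%N.
Proof.
apply/eqP; rewrite -leqn0 leqNgt; apply/negP=> h.
have [E [f [g [[hf hg fi fg gs] nr]]]] := nonsplit_ext acQ h.
have [s hs sE] := proj_lift hg gs (hom_id proj).
have ht : is_hom (\1 - (s \o g))%VF.
  by rewrite addrC -scaleN1r; apply: hom_lin (hom_comp hg hs) (hom_id E).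
have [|r hr rE] := factor_mono hf fi ht.
  apply/subvP=> _ /memv_imgP[u _ ->]; rewrite fg memv_ker add_lfunE opp_lfunE comp_lfunE.
  by rewrite linearB /= sE !id_lfunE subrr.
apply: (nr r hr) => u; apply: (lker0_inj fi); rewrite rE add_lfunE opp_lfunE comp_lfunE.
rewrite id_lfunE (_ : g (f u) = 0) ?linear0 ?addr0 //.
by apply/eqP; rewrite -memv_ker -fg memv_img ?memvf.
Qed.

(** Taking N to be the translate itself in [proj_ext0] kills the identity of the translate; so tau
    annihilates projectives. *)
Lemma proj_pp : pp proj.
Proof.
exists 1%N; exact: hom_self0 (proj_ext0 (tau proj)).
Qed.

End ProjectiveAtVertex.

Lemma euler_proj i M : euler (dimvec (proj i)) (dimvec M) = dimvec M i.
Proof. by rewrite -(euler_formula acQ) hom_proj proj_ext0 subr0 dimvecE. Qed.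

Lemma vdim_tau M i :
  (vdim (tau M) i)%:Z = (hom M (proj i))%:Z - euler (dimvec M) (dimvec (proj i)).
Proof. by rewrite -(euler_formula acQ) -(hom_proj i (tau M)) opprB addrC subrK. Qed.

End Projectives.

(** * Bilinearity and nondegeneracy of the Euler form *)

Section EulerForm.
Variable Q : quiver.
Implicit Types x y z : {ffun vtx Q -> int}.

Lemma eulerDl x y z : euler (x + y) z = euler x z + euler y z.
Proof.
rewrite /euler; under eq_bigr do rewrite ffunE mulrDl.
under [X in _ - X]eq_bigr do rewrite ffunE mulrDl.
by rewrite !big_split opprD addrACA.
Qed.

Lemma eulerDr x y z : euler z (x + y) = euler z x + euler z y.
Proof.
rewrite /euler; under eq_bigr do rewrite ffunE mulrDr.
under [X in _ - X]eq_bigr do rewrite ffunE mulrDr.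
by rewrite !big_split opprD addrACA.
Qed.

Lemma euler0l y : euler 0 y = 0.
Proof. by have := eulerDl 0 0 y; rewrite addr0; lia. Qed.

Lemma euler0r y : euler y 0 = 0.
Proof. by have := eulerDr 0 0 y; rewrite addr0; lia. Qed.

Lemma eulerNl x y : euler (- x) y = - euler x y.
Proof. by have := eulerDl x (- x) y; rewrite subrr euler0l; lia. Qed.

Lemma eulerNr x y : euler x (- y) = - euler x y.
Proof. by have := eulerDr y (- y) x; rewrite subrr euler0r; lia. Qed.

Lemma eulerBl x y z : euler (x - y) z = euler x z - euler y z.
Proof. by rewrite eulerDl eulerNl. Qed.

Lemma eulerBr x y z : euler z (x - y) = euler z x - euler z y.
Proof. by rewrite eulerDr eulerNr. Qed.

Lemma euler_sumr (I : Type) (r : seq I) (P : pred I) (F : I -> {ffun vtx Q -> int}) x :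
  euler x (\sum_(i <- r | P i) F i) = \sum_(i <- r | P i) euler x (F i).
Proof.
by elim/big_rec2: _ => [|i y1 y2 _ <-]; rewrite ?euler0r ?eulerDr.
Qed.

Lemma euler_suml (I : Type) (r : seq I) (P : pred I) (F : I -> {ffun vtx Q -> int}) x :
  euler (\sum_(i <- r | P i) F i) x = \sum_(i <- r | P i) euler (F i) x.
Proof.
by elim/big_rec2: _ => [|i y1 y2 _ <-]; rewrite ?euler0l ?eulerDl.
Qed.

Definition vscale (t : int) x : {ffun vtx Q -> int} := [ffun i => t * x i].

Lemma eulerZl t x y : euler (vscale t x) y = t * euler x y.
Proof.
rewrite /euler mulrBr !mulr_sumr; congr (_ - _); apply: eq_bigr => i _;
by rewrite ffunE mulrA.
Qed.

Lemma eulerZr t x y : euler y (vscale t x) = t * euler y x.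
Proof.
rewrite /euler mulrBr !mulr_sumr; congr (_ - _); apply: eq_bigr => i _;
by rewrite ffunE; ring.
Qed.

Definition ebase (i : vtx Q) : {ffun vtx Q -> int} := [ffun j => (j == i)%:R].

Lemma ebase_sum x : x = \sum_i vscale (x i) (ebase i).
Proof.
apply/ffunP=> j; rewrite sum_ffunE (bigD1 j) //= big1 ?addr0 => [|i ij].
  by rewrite !ffunE eqxx mulr1.
by rewrite !ffunE eq_sym (negPf ij) mulr0.
Qed.

(** Otherwise arrows could be followed backwards inside P forever, giving paths longer than
    [qpath_size] allows. *)
Lemma acyclic_min (P : vtx Q -> Prop) : acyclic Q -> (exists i, P i) ->
  exists2 i, P i & forall a, tgt a = i -> ~ P (src a).
Proof.
move=> acQ [i0 Pi0]; apply: contrapT => nex.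
have step i : P i -> exists2 a, tgt a = i & P (src a).
  move=> Pi; apply: contrapT => n; apply: nex; exists i => // a ai Pa.
  by apply: n; exists a.
suff : exists i s, [/\ P i, is_qpath i s & size s = #|vtx Q|].
  by case=> i [s [_ /(qpath_size acQ) h e]]; rewrite e ltnn in h.
elim: #|vtx Q| => [|n [i [s [Pi hs ss]]]]; first by exists i0, [::].
have [a ai Pa] := step i Pi; exists (src a), (a :: s).
by rewrite /= eqxx ai hs ss.
Qed.

(** At a minimal vertex i of the support of z, no arrow ending at i starts in the support, so <z,
    e_i> = z_i. *)
Lemma euler_left_nondeg z : acyclic Q -> (forall i, euler z (ebase i) = 0) -> z = 0.
Proof.
move=> acQ h; apply/ffunP=> i0; rewrite [RHS]ffunE; apply: contrapT => z0.
have [i zi min] := @acyclic_min (fun i => z i <> 0) acQ (ex_intro _ i0 z0).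
apply: zi; have := h i; rewrite /euler (bigD1 i) //= big1 => [|j ji].
  rewrite ffunE eqxx mulr1 addr0 big1 ?subr0 // => a _; rewrite ffunE.
  case: eqP => [ai|_]; last by rewrite mulr0.
  by rewrite mulr1; apply: contrapT => /(min a ai).
by rewrite ffunE (negPf ji) mulr0.
Qed.

End EulerForm.

(* The properties of the Tits form of an extended Dynkin quiver in use.       *)
Definition affine (Q : quiver) (d : {ffun vtx Q -> int}) :=
  [/\ forall i, 0 < d i,
      forall y, euler d y = - euler y d,
      forall x : {ffun vtx Q -> int}, 0 <= euler x x &
      forall x : {ffun vtx Q -> int}, euler x x = 0 -> exists t, x = vscale t d].

Lemma functional_ex (k : fieldType) (U : vectType k) (w : U) :
  w != 0 -> exists l : 'Hom(U, k^o), l w != 0.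
Proof.
move=> w0; pose p := projv <[w]>%VS.
have pw u : exists c, p u == c *: w.
  by have := memv_proj <[w]>%VS u => /vlineP[c ->]; exists c.
pose l u : k^o := xchoose (pw u).
have lE u : p u = l u *: w by apply/eqP/(xchooseP (pw u)).
have ll : linear l.
  move=> c u v; apply/eqP; rewrite -subr_eq0; apply/eqP.
  have : (l (c *: u + v) - (c *: l u + l v)) *: w = 0.
    by rewrite scalerBl scalerDl -scalerA -!lE linearP subrr.
  by move/eqP; rewrite scaler_eq0 (negPf w0) orbF => /eqP.
exists (linfun l); rewrite linfun_id //; apply: contraNneq w0 => e.
by have := lE w; rewrite e scale0r projv_id ?memv_line // => ->.
Qed.

(** * The translate on dimension vectors and the defect of preprojectives *)

Section Numerics.
Variables (k : fieldType) (Q : quiver).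
Hypothesis acQ : acyclic Q.
Implicit Types E L M N X Y Z : kQmodule k Q.

Section SimpleModule.
Variable i : vtx Q.

Definition simple_idem (j : vtx Q) : 'End(k^o) := if j == i then \1%VF else 0.

Lemma simple_idemM j l :
  (simple_idem j \o simple_idem l)%VF = if j == l then simple_idem j else 0.
Proof.
rewrite /simple_idem; case: (eqVneq j l) => [<-|jl].
  by case: eqP => _; rewrite ?comp_lfun1l ?comp_lfun0l.
case: (eqVneq j i) => [ji|_]; last by rewrite comp_lfun0l.
by rewrite -ji eq_sym (negPf jl) comp_lfun0r.
Qed.

Lemma simple_idem_sum : \sum_j simple_idem j = \1%VF.
Proof.
rewrite (bigD1 i) //= big1 ?addr0 => [|j ji]; rewrite /simple_idem ?eqxx //.
by rewrite (negPf ji).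
Qed.

Lemma simple_arrow_ax (a : arr Q) :
  (0 : 'End(k^o)) = (simple_idem (tgt a) \o 0 \o simple_idem (src a))%VF.
Proof. by rewrite comp_lfun0r comp_lfun0l. Qed.

Definition simple : kQmodule k Q :=
  @KQModule k Q k^o simple_idem (fun=> 0) simple_idemM simple_idem_sum simple_arrow_ax.

Lemma dimvec_simple : dimvec simple = ebase i.
Proof.
apply/ffunP=> j; rewrite dimvecE ffunE /vdim [idem _ _]/(simple_idem j) /simple_idem.
case: eqP => _; last by rewrite lim0g dimv0.
by rewrite lim1g dimvf.
Qed.

End SimpleModule.

Lemma module_ex (x : {ffun vtx Q -> int}) : (forall i, 0 <= x i) ->
  exists M, dimvec M = x.
Proof.
have [n] := ubnP (absz (\sum_i x i)); elim: n x => // n IH x le x0.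
case: (pselect (exists i, 0 < x i)) => [[i xi]|nx].
  have [||M dM] := IH (x - ebase i).
  - move: le; rewrite (bigD1 i) //= => le.
    rewrite (bigD1 i) //= !ffunE eqxx (eq_bigr x) => [|j ji]; last first.
      by rewrite !ffunE (negPf ji) subr0.
    have : 0 <= \sum_(j | j != i) x j by apply: sumr_ge0.
    by move: (x i) xi (\sum_(j | _) _) le; lia.
  - move=> j; rewrite !ffunE; case: eqP => [->|_]; last by rewrite subr0.
    by rewrite subr_ge0.
  exists (dsum (simple i) M); rewrite (dimvec_ses (dsum_ses _ _)) dimvec_simple dM.
  by rewrite addrC subrK.
exists zero_mod; apply/ffunP=> i; rewrite dimvecE.
have -> : x i = 0.
  apply/eqP; rewrite eq_le x0 andbT leNgt; apply/negP=> xi; apply: nx; by exists i.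
by rewrite /vdim lim0g dimv0.
Qed.

Lemma euler_proj_base (y : {ffun vtx Q -> int}) i :
  euler (dimvec (proj k i)) y = y i.
Proof.
rewrite {1}(ebase_sum y) euler_sumr (bigD1 i) //= big1 => [|j ji];
  rewrite eulerZr -dimvec_simple (euler_proj acQ) dimvec_simple ffunE.
  by rewrite eqxx mulr1 addr0.
by rewrite eq_sym (negPf ji) mulr0.
Qed.

Lemma euler_right_nondeg (w : {ffun vtx Q -> int}) : (forall z, euler z w = 0) -> w = 0.
Proof. by move=> h; apply/ffunP=> i; rewrite ffunE -(euler_proj_base w i). Qed.

(** By [euler_proj_base] the dimension vectors of the projectives are dual to the unit vectors under
    the Euler form. *)
Lemma proj_span (y : {ffun vtx Q -> int}) :
  y = \sum_i vscale (euler y (ebase i)) (dimvec (proj k i)).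
Proof.
apply/eqP; rewrite -subr_eq0; apply/eqP/(euler_left_nondeg acQ) => j.
rewrite eulerBl euler_suml (bigD1 j) //= big1 => [|i ij];
  rewrite eulerZl euler_proj_base ffunE.
  by rewrite eqxx mulr1 addr0 subrr.
by rewrite (negPf ij) mulr0.
Qed.

(** On dimension vectors tau acts as the Coxeter transformation. Projectives span by [proj_span],
    and for them [vdim_tau] has no Hom term. *)
Lemma euler_tau M : (forall i, hom M (proj k i) = 0%N) ->
  forall y, euler (dimvec M) y = - euler y (dimvec (tau M)).
Proof.
move=> h y; rewrite (proj_span y) euler_sumr euler_suml -sumrN; apply: eq_bigr => i _.
rewrite eulerZl eulerZr euler_proj_base dimvecE (vdim_tau acQ) h.
by rewrite sub0r mulrN opprK.
Qed.

(** Add the Euler formulas for (M, N) and (N, tau M): the right-hand sides cancel by [euler_tau], as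
    do the two occurrences of hom(N, tau M). *)
Lemma hom_tau M N : (forall i, hom M (proj k i) = 0%N) ->
  hom M N = hom (tau M) (tau N).
Proof.
move=> h; have := euler_formula acQ M N; have := euler_formula acQ N (tau M).
by rewrite (euler_tau h); lia.
Qed.

Lemma tor_proj M i : tor M -> hom M (proj k i) = 0%N.
Proof. by apply; exact: proj_pp. Qed.

(** At a minimal vertex i of the support all arrows into i act as 0, so every functional on e_i M is
    a homomorphism to the simple module at i. *)
Lemma hom_simple M : ~ is_zero M -> exists i, (0 < hom M (simple i))%N.
Proof.
move=> nz; have : exists i, vdim M i <> 0%N.
  apply: contrapT => n; apply: nz; rewrite /is_zero dim_vdim big1 // => i _.
  by apply: contrapT => ni; apply: n; exists i.
move/(@acyclic_min _ (fun i => vdim M i <> 0%N) acQ) => [i /eqP vi min].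
have : limg (idem M i) != 0%VS by rewrite -dimv_eq0.
rewrite -vpick0 => w0; have [l lw] := functional_ex w0.
set w := vpick _ in w0 lw; have iw : idem M i w = w.
  by have /memv_imgP[u _ e] := memv_pick (limg (idem M i)); rewrite /w e idem_app eqxx.
clearbody w.
exists i; apply/hom_gt0; exists (l \o idem M i : 'Hom(M, simple i))%VF; last first.
  by move/lfunP/(_ w); rewrite comp_lfunE zero_lfunE iw; apply/eqP.
apply/is_homP; split=> [j u|a u]; rewrite !comp_lfunE.
  rewrite idem_app [idem (simple i) j]/(simple_idem i j) /simple_idem eq_sym.
  by case: eqP => _; rewrite ?id_lfunE ?zero_lfunE ?linear0.
rewrite [arrow (simple i) a]/(0 : 'End(k^o)) zero_lfunE idem_arrow.
case: eqP => [ia|_]; last by rewrite linear0.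
have := min a (esym ia) => /contrapT/eqP; rewrite dimv_eq0 => /eqP e.
rewrite -arrow_src; have : idem M (src a) u \in limg (idem M (src a)).
  by rewrite memv_img ?memvf.
by rewrite e memv0 => /eqP->; rewrite !linear0.
Qed.

Lemma iter_tau_mono n M N (f : 'Hom(M, N)) : is_hom f -> lker f = 0%VS ->
  is_zero (iter n (@tau k Q) N) -> is_zero (iter n (@tau k Q) M).
Proof.
elim: n M N f => [|n IH] M N f hf fi; first exact: (@zero_inj k Q M N f).
rewrite !iterSr; apply: IH (tau_map_hom hf) (tau_map_inj hf fi).
Qed.

(** The image I of a nonzero map to a projective satisfies Ext^1(I, -) = 0, since tau I embeds into
    the translate of the projective, which is 0. So I splits off; it plays the part of a projective
    summand. *)
Lemma split_proj M i : (0 < hom M (proj k i))%N ->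
  exists K I, [/\ ~ is_zero I, forall N, hom N (tau I) = 0%N & isom (dsum K I) M].
Proof.
case/hom_gt0=> f hf f0; have sI := submod_img hf (submod_full M).
have sK := submod_ker hf; exists (submod sK), (submod sI).
have e0 N : hom N (tau (submod sI)) = 0%N.
  apply/eqP; rewrite -leqn0 -(proj_ext0 acQ i N).
  exact: hom_mono (tau_map_hom (sub_incl_hom sI)) (tau_map_inj (sub_incl_hom sI) (sub_incl_inj sI)).
split=> //.
  move/is_zeroP=> z; apply: f0; apply/lfunP=> u; rewrite zero_lfunE.
  have fu : f u \in limg f by rewrite memv_img ?memvf.
  by rewrite -(vsprojK fu) (z (vsproj (limg f) (f u))) linear0.
apply: ext0_split (e0 _) _ => //.
have [|g hg gE] := factor_mono (sub_incl_hom sI) (sub_incl_inj sI) hf.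
  by rewrite sub_incl_img.
exists (sub_incl sK), g; split=> //; first exact: sub_incl_hom.
- exact: sub_incl_inj.
- rewrite sub_incl_img; apply/vspaceP=> u; rewrite !memv_ker -gE.
  apply/eqP/eqP => [h|->]; last by rewrite linear0.
  by apply: (lker0_inj (sub_incl_inj sI)); rewrite h linear0.
apply: limg_full => w; have /memv_imgP[u _ e] := subvsP w; exists u.
by apply: subvs_inj; rewrite -sub_inclE gE e.
Qed.

Variable d : {ffun vtx Q -> int}.
Hypothesis aff : affine d.

Definition def M : int := euler d (dimvec M).

Lemma def_ses X Y Z : short_exact X Y Z -> def Y = def X + def Z.
Proof. by move=> h; rewrite /def (dimvec_ses h) eulerDr. Qed.

Lemma def_isom M N : isom M N -> def M = def N.
Proof. by move=> h; rewrite /def (dimvec_isom h). Qed.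

Lemma def_zero M : is_zero M -> def M = 0.
Proof. by move/is_zero_dimvec=> h; rewrite /def h euler0r. Qed.

(** The defect is -<M, d>, which equals minus the sum of d_i hom(M, S_i) because Ext^1(M, -) = 0;
    some term is positive by [hom_simple]. *)
Lemma def_ext0 M : ~ is_zero M -> (forall N, hom N (tau M) = 0%N) -> def M < 0.
Proof.
case: aff => dpos dsym _ _ nz e0; rewrite /def dsym oppr_lt0 (ebase_sum d) euler_sumr.
have E i : euler (dimvec M) (vscale (d i) (ebase i)) = d i * (hom M (simple i))%:Z.
  by rewrite eulerZr -dimvec_simple -(euler_formula acQ) e0 subr0.
rewrite (eq_bigr _ (fun j _ => E j)).
have [i hi] := hom_simple nz; rewrite (bigD1 i) //= ltr_pwDl ?mulr_gt0 //.
apply: sumr_ge0 => j _; exact: (mulr_ge0 (ltW (dpos j)) (le0z_nat _)).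
Qed.

(** Outer induction on the exponent, inner on the dimension. If M maps nontrivially to a projective,
    [split_proj] splits off a summand covered by [def_ext0]; otherwise tau preserves the defect and
    lowers the exponent. *)
Lemma pp_def_lt0 M : pp M -> ~ is_zero M -> def M < 0.
Proof.
case=> n; elim: n M => [|n IHn] M; first by [].
have [m] := ubnP (\dim {:M}); elim: m M => // m IHm M le z nz.
case: (pselect (exists i, (0 < hom M (proj k i))%N)) => [[i hi]|nh].
  have [K [I [nzI e0 iM]]] := split_proj hi.
  rewrite -(def_isom iM) (def_ses (dsum_ses K I)).
  have dI := def_ext0 nzI e0; case: (pselect (is_zero K)) => [zK|nzK].
    by rewrite (def_zero zK) add0r.
  suff dK : def K < 0 by lia.
  case: (iM) => g /and3P[hg /eqP gi _].
  have hK := hom_comp (dinl_hom K I) hg.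
  have iK : lker (g \o dinl K I)%VF = 0%VS.
    apply: lker0_intro => u; rewrite comp_lfunE => h.
    by apply: (lker0_inj (dinl_inj K I)); apply: (lker0_inj gi); rewrite h !linear0.
  apply: IHm => //; last exact: iter_tau_mono hK iK z.
  rewrite ltnS in le; apply: leq_trans le.
  have -> : \dim {:M} = (\dim {:K} + \dim {:I})%N.
    rewrite !dim_vdim -big_split; apply: eq_bigr => j _ /=.
    rewrite -(vdim_ses j (dsum_ses K I)); exact/esym/vdim_isom.
  by rewrite -[X in (X < _)%N]addn0 ltn_add2l lt0n; apply/eqP.
have h0 i : hom M (proj k i) = 0%N.
  by apply/eqP; rewrite -leqn0 leqNgt; apply/negP=> hi; apply: nh; exists i.
case: aff => _ dsym _ _.
have -> : def M = def (tau M) by rewrite /def dsym (euler_tau h0) opprK.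
apply: IHn; first by rewrite -iterSr.
move/is_zero_dimvec=> t0; apply: nz; apply/is_zero_dimvec/(euler_left_nondeg acQ) => i.
by rewrite (euler_tau h0) t0 euler0r oppr0.
Qed.

Lemma pp_def_le0 M : pp M -> def M <= 0.
Proof.
move=> pM; case: (pselect (is_zero M)) => [z|nz]; first by rewrite def_zero.
exact/ltW/pp_def_lt0.
Qed.

End Numerics.

(** * Duality *)

Section Duality.
Variable k : fieldType.

Section OneQuiver.
Variable Q : quiver.
Implicit Types L M N X Y Z : kQmodule k Q.

Lemma euler_op (x y : {ffun vtx Q -> int}) : @euler (op_quiver Q) x y = @euler Q y x.
Proof.
rewrite /euler; congr (_ - _); apply: eq_bigr => i _; exact: mulrC.
Qed.

Lemma dual_idemE M i (h : dual M) u : (idem (dual M) i h : 'Hom(M, k^o)) u = h (idem M i u).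
Proof. by rewrite [idem (dual M) i h]lfunE /= /dual_fun comp_lfunE. Qed.

Lemma dual_arrowE' M a (h : dual M) u :
  (arrow (dual M) a h : 'Hom(M, k^o)) u = h (arrow M a u).
Proof. by rewrite [arrow (dual M) a h]lfunE /= /dual_fun comp_lfunE. Qed.

Lemma vdim_dual M i : vdim (dual M) i = vdim M i.
Proof.
rewrite /vdim (@dim_block k M k^o (idem M i) \1%VF).
- by rewrite lim1g dimvf muln1.
- by move=> u; rewrite idem_app eqxx.
- by move=> u; rewrite !id_lfunE.
move=> h; split=> [/memv_imgP[g _ ->] u|hE].
  by rewrite id_lfunE [LHS]dual_idemE [RHS]dual_idemE idem_app eqxx.
apply/memv_imgP; exists h; first exact: memvf.
by apply/lfunP=> u; rewrite [RHS]dual_idemE hE id_lfunE.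
Qed.

Lemma dimvec_dual M : dimvec (dual M) = dimvec M :> {ffun vtx Q -> int}.
Proof. by apply/ffunP=> i; rewrite [LHS]dimvecE dimvecE vdim_dual. Qed.

Lemma is_zero_dual M : is_zero (dual M) <-> is_zero M.
Proof. by rewrite !is_zero_dimvec dimvec_dual. Qed.

Definition dual_map M N (f : 'Hom(M, N)) : 'Hom(dual N, dual M) :=
  linfun (fun h : 'Hom(N, k^o) => (h \o f)%VF : 'Hom(M, k^o)).

Lemma dual_mapE M N (f : 'Hom(M, N)) (h : dual N) u :
  (dual_map f h : 'Hom(M, k^o)) u = (h : 'Hom(N, k^o)) (f u).
Proof.
rewrite [dual_map f h](_ : _ = (h \o f)%VF) ?comp_lfunE //.
rewrite [LHS]linfun_id // => c x y.
by apply/lfunP=> v; rewrite !(add_lfunE, scale_lfunE, comp_lfunE).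
Qed.

Lemma functional_sep (U : vectType k) (u v : U) :
  (forall h : 'Hom(U, k^o), h u = h v) -> u = v.
Proof.
move=> h; apply/eqP; rewrite -subr_eq0; apply: contraT => /functional_ex[l].
by rewrite linearB /= h subrr eqxx.
Qed.

Lemma dual_map_inj M N (f g : 'Hom(M, N)) : dual_map f = dual_map g -> f = g.
Proof.
move=> e; apply/lfunP=> u; apply: functional_sep => h.
by rewrite -(dual_mapE f) -(dual_mapE g) e.
Qed.

Lemma dual_map_linear M N : linear (@dual_map M N).
Proof.
move=> c f g; apply/lfunP=> h; apply/lfunP=> u.
rewrite add_lfunE scale_lfunE [RHS]add_lfunE scale_lfunE !dual_mapE add_lfunE scale_lfunE.
by rewrite linearP.
Qed.

Lemma dual_map_surj M N (F : 'Hom(dual N, dual M)) : exists f : 'Hom(M, N), dual_map f = F.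
Proof.
have full : limg (linfun (@dual_map M N)) = fullv.
  apply/eqP; rewrite eqEdim subvf limg_dim_eq; last first.
    apply/eqP; rewrite -subv0; apply/subvP=> f; rewrite memv_cap memv_ker linfun_id //.
      case/andP=> _ /eqP f0; rewrite memv0; apply/eqP/dual_map_inj; rewrite f0.
      by rewrite -(linfun_id (@dual_map_linear M N)) linear0.
    exact: dual_map_linear.
  by rewrite !dimvf !dim_hom !muln1 mulnC leqnn.
have [f <-] := limg_fullP F full; exists f.
by rewrite linfun_id //; exact: dual_map_linear.
Qed.

Lemma dual_map_hom M N (f : 'Hom(M, N)) : is_hom (dual_map f) <-> is_hom f.
Proof.
rewrite !is_homP; split=> -[h1 h2]; split=> [i u|a u].
- apply: functional_sep => h; have /lfunP/(_ u) := h1 i h.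
  by rewrite dual_mapE [LHS]dual_idemE [RHS]dual_idemE dual_mapE.
- apply: functional_sep => h; have /lfunP/(_ u) := h2 a h.
  by rewrite dual_mapE [LHS]dual_arrowE' [RHS]dual_arrowE' dual_mapE.
- by apply/lfunP=> v; rewrite dual_mapE [LHS]dual_idemE [RHS]dual_idemE dual_mapE h1.
by apply/lfunP=> v; rewrite dual_mapE [LHS]dual_arrowE' [RHS]dual_arrowE' dual_mapE h2.
Qed.

Lemma hom_dual M N : hom (dual N) (dual M) = hom M N.
Proof.
apply/esym/(dim_bij (@dual_map_linear M N)) => [f _ f0|F].
  by apply: dual_map_inj; rewrite f0 -(linfun_id (@dual_map_linear M N)) linear0.
rewrite mem_homs; split=> [hF|[f]].
  by have [f e] := dual_map_surj F; exists f => //; rewrite mem_homs -dual_map_hom e.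
by rewrite mem_homs -dual_map_hom => hf <-.
Qed.

Lemma dual_surj_inj M N (f : 'Hom(M, N)) : limg (dual_map f) = fullv -> lker f = 0%VS.
Proof.
move=> fs; apply: lker0_intro => u fu; apply: functional_sep => h.
have [g e] := limg_fullP (h : dual M) fs; rewrite linear0 -[h]e dual_mapE fu.
by rewrite linear0.
Qed.

Lemma acyclic_op : acyclic Q -> acyclic (op_quiver Q).
Proof.
move=> acQ i s hs es.
have E (j : vtx Q) (t : seq (arr Q)) : @is_qpath (op_quiver Q) j t ->
    @is_qpath Q (@qend (op_quiver Q) j t) (rev t) /\
    @qend Q (@qend (op_quiver Q) j t) (rev t) = j.
  elim: t j => [|a t IH] j //= /andP[/eqP aj ht]; have [h1 h2] := IH _ ht.
  rewrite rev_cons is_qpath_rcons [@qend (op_quiver Q) j (a :: t)]/(@qend (op_quiver Q) (src a) t).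
  rewrite h1 h2 eqxx; split=> //.
  by rewrite /qend map_rcons last_rcons.
have [h1 h2] := E i s hs; rewrite es in h1 h2.
by have := acQ _ _ h1 h2 => /(congr1 rev); rewrite revK.
Qed.

Lemma affine_op (d : {ffun vtx Q -> int}) : affine d -> @affine (op_quiver Q) d.
Proof.
case=> h1 h2 h3 h4; split=> // [y|x|x]; rewrite !euler_op //; first by rewrite h2 opprK.
exact: h4.
Qed.

Lemma def_dual (d : {ffun vtx Q -> int}) M : affine d -> @def k (op_quiver Q) d (dual M) = - def d M.
Proof. by case=> _ h _ _; rewrite /def dimvec_dual euler_op h opprK. Qed.

End OneQuiver.

Lemma predual (Q : quiver) (N : kQmodule k (op_quiver Q)) :
  exists M : kQmodule k Q, isom (dual M) N.
Proof.
(* Once Q is an explicit record, the opposite of its opposite is Q by conversion, so the dual of N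
   is a module over Q. Evaluation identifies N with its double dual. *)
case: Q N => V A s t N; pose M : kQmodule k (Quiver s t) := dual N.
exists M; apply: isom_sym.
pose ev (u : N) : dual M := linfun (fun h : 'Hom(N, k^o) => h u).
have evE u (h : 'Hom(N, k^o)) : (ev u : 'Hom('Hom(N, k^o), k^o)) h = h u.
  by rewrite linfun_id // => c x y; rewrite add_lfunE scale_lfunE.
have evl : linear ev.
  move=> c u v; apply/lfunP=> h; rewrite evE add_lfunE scale_lfunE !evE.
  by rewrite linearP.
have inj : lker (linfun ev) = 0%VS.
  apply: lker0_intro => u; rewrite linfun_id // => /lfunP e; apply: functional_sep => h.
  by have := e h; rewrite evE zero_lfunE linear0.
exists (linfun ev); apply: iso_intro => //.
  apply: hom_linfun => // [i u|a u]; apply/lfunP=> h.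
    by rewrite evE [RHS]dual_idemE [RHS]evE dual_idemE.
  by rewrite evE [RHS]dual_arrowE' [RHS]evE dual_arrowE'.
apply/eqP; rewrite eqEdim subvf limg_dim_eq; last by rewrite inj capv0.
by rewrite !dimvf !dim_hom !muln1 leqnn.
Qed.

End Duality.

(** * The inverse translate and the defect of torsion modules *)

Section TorsionDefect.
Variables (k : fieldType) (Q : quiver).
Hypothesis acQ : acyclic Q.
Variable d : {ffun vtx Q -> int}.
Hypothesis aff : affine d.
Implicit Types L M N X Y Z : kQmodule k Q.

Let acQ' := acyclic_op acQ.
Let aff' := affine_op aff.

(** X is the inverse translate of N, so this is the other form of the Auslander-Reiten formula,
    obtained by comparing the Euler formulas over Q and over its opposite. *)
Lemma hom_tau_dual M N X : isom (dual X) (tau (dual N)) -> hom N (tau M) = hom X M.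
Proof.
move=> iX; have := euler_formula acQ M N; have := euler_formula acQ' (dual N) (dual M).
rewrite !dimvec_dual euler_op hom_dual -(hom_isom_r _ iX) hom_dual; lia.
Qed.

(** Otherwise a nonzero module with vanishing Ext, hence of negative defect, splits off the dual of
    B. Its predual is a submodule of B of positive defect, contrary to [pp_def_lt0]. *)
Lemma pp_dual_proj B i : pp B -> hom (dual B) (proj k (Q := op_quiver Q) i) = 0%N.
Proof.
move=> pB; apply/eqP; rewrite -leqn0 leqNgt; apply/negP=> h.
have [K [I [nzI e0 iB]]] := split_proj acQ' h.
have dI := def_ext0 acQ' aff' nzI e0.
have [J iJ] := predual I.
have [g hg gs] : exists2 g : 'Hom(dual B, dual J), is_hom g & limg g = fullv.
  case: (isom_sym iB) => u /and3P[hu _ /eqP us]; case: (isom_sym iJ) => v /and3P[hv _ /eqP vs].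
  exists (v \o (dsnd K I \o u))%VF.
    exact: hom_comp (hom_comp hu (dsnd_hom K I)) hv.
  apply: limg_full => w; have [x <-] := limg_fullP w vs.
  have [y <-] := limg_fullP x (dsnd_surj K I); have [z <-] := limg_fullP y us.
  by exists z; rewrite !comp_lfunE.
have [f ef] := dual_map_surj g; rewrite -ef in hg gs.
have pJ : pp J by apply: pp_mono ((dual_map_hom f).1 hg) (dual_surj_inj gs) pB.
have nzJ : ~ is_zero J.
  move/is_zero_dual/is_zero_dimvec; rewrite (dimvec_isom iJ) => /is_zero_dimvec.
  exact: nzI.
have := pp_def_lt0 acQ aff pJ nzJ; have := @def_isom k (op_quiver Q) d _ _ iJ; rewrite def_dual //.
by move: dI; rewrite /=; lia.
Qed.

(** C is the inverse translate of B. Since tau C receives as many maps as B from any module, it has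
    no torsion summand, so it is in [pp] and so is C. *)
Lemma tau_inv_ex B : pp B -> exists2 C, pp C & forall X, hom X (tau C) = hom X B.
Proof.
move=> pB; have [C iC] := predual (tau (dual B)).
have e X : hom X (tau C) = hom X B.
  have h := hom_tau acQ' (dual X) (fun i => pp_dual_proj i pB).
  rewrite -(hom_dual X B) h -(hom_isom_l _ iC).
  have := euler_formula acQ C X; have := euler_formula acQ' (dual X) (dual C).
  by rewrite !dimvec_dual euler_op hom_dual; lia.
exists C => //; apply/pp_tau; have [A [B' [tA pB' iM]]] := torsion_split acQ (tau C).
suff zA : is_zero A.
  by apply: pp_isom (isom_sym iM) _; apply: pp_isom (dsum_zero_l B' zA) pB'.
case: iM => g /and3P[hg /eqP gi _].
have := e A; rewrite (tA B pB) => /hom_eq0/(_ (g \o dinl A B')%VF (hom_comp (dinl_hom A B') hg)).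
move/lfunP=> h; apply/is_zeroP=> u; apply: (lker0_inj (dinl_inj A B')).
by apply: (lker0_inj gi); rewrite !linear0; have := h u; rewrite comp_lfunE zero_lfunE.
Qed.

(** With C the inverse translate of B, hom(tau M, B) = hom(tau M, tau C) = hom(M, C) = 0. *)
Lemma tor_tau M : tor M -> tor (tau M).
Proof.
move=> tM B pB; have [C pC e] := tau_inv_ex pB.
by rewrite -e -(hom_tau acQ _ (fun i => tor_proj acQ i tM)) tM.
Qed.

Lemma tor_euler_tau M : tor M -> forall y, euler (dimvec M) y = - euler y (dimvec (tau M)).
Proof. by move=> tM; apply: (euler_tau acQ (fun i => tor_proj acQ i tM)). Qed.

Lemma tor_hom_tau M N : tor M -> hom M N = hom (tau M) (tau N).
Proof. by move=> tM; apply: (hom_tau acQ N (fun i => tor_proj acQ i tM)). Qed.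

(* If y_n is the dimension vector of tau^n M then (y_n, z) = <z, y_n - y_(n+1)>. The *)
(* classes of the y_n modulo d are bounded, so some y_n' - y_n is a multiple t d, *)
(* and t >= 0 because all y_n are nonnegative; the sum Y of the y_i over this period  *)
(* then satisfies 2 q(Y) = t def(Y).                                          *)
Lemma tor_def_ge0 M : tor M -> 0 <= def d M.
Proof.
case: aff => dpos dsym q0 qd tM; rewrite leNgt; apply/negP=> neg.
pose T n := iter n (@tau k Q) M; pose y n := dimvec (T n).
have tT n : tor (T n) by elim: n => // n IH; apply: tor_tau.
have yE n z : euler (y n) z = - euler z (y n.+1) by apply: tor_euler_tau.
have ydef n : euler d (y n) = def d M.
  by elim: n => // n IH; rewrite -IH [in RHS]dsym yE opprK.
have yq n : euler (y n) (y n) = euler (y 0%N) (y 0%N).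
  by elim: n => // n IH; rewrite -IH [RHS]yE [X in - X]yE opprK.
have sym n z : euler (y n) z + euler z (y n) = euler z (y n - y n.+1).
  by rewrite eulerBr yE addrC.
have y0 n i : 0 <= y n i by rewrite dimvecE.
pose c : int := euler (y 0%N) (y 0%N) + 1.
have ee (i : vtx Q) : euler (ebase i) (ebase i) = 1 :> int.
  rewrite /euler (bigD1 i) //= big1 => [|j ji]; last by rewrite !ffunE (negPf ji) mul0r.
  rewrite !ffunE eqxx big1 => [|a _]; first by [].
  rewrite !ffunE; case: eqP => [si|_]; last by rewrite mul0r.
  case: eqP => [ti|_]; last by rewrite mulr0.
  by have := @acQ i [:: a]; rewrite /= si eqxx /qend /= ti => /(_ isT erefl).
(* q is nonnegative at y_n + e_i and y_n - e_i, while q(y_n) is constant and q(e_i) = 1. *)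
have bnd n i : - c <= euler (y n) (ebase i) + euler (ebase i) (y n) <= c.
  have := q0 (y n + ebase i); have := q0 (y n - ebase i).
  rewrite !(eulerDl, eulerDr, eulerNl, eulerNr) ee yq /c; lia.
pose B := (absz c).*2.+1.
pose sf n i : int := euler (y n) (ebase i) + euler (ebase i) (y n) + c.
have iB n i : (absz (sf n i) < B)%N by have := bnd n i; rewrite /B /sf; lia.
pose cl n : {ffun vtx Q -> 'I_B} := [ffun i => Ordinal (iB n i)].
have clP m m' : cl m = cl m' -> forall i, absz (sf m i) = absz (sf m' i).
  by move=> e i; move/ffunP/(_ i): e; rewrite !ffunE => /(congr1 val).
clearbody cl.
have [n [N [N0 clE]]] : exists n N : nat, (0 < N)%N /\ cl n = cl (n + N)%N.
  pose F (i : 'I_(#|{ffun vtx Q -> 'I_B}|.+1)) := cl i.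
  have : ~~ injectiveb F.
    apply/negP=> /injectiveP/leq_card.
    by rewrite card_ord ltnn.
  case/injectivePn=> i [j ij e].
  case: (ltngtP i j) => [lt|lt|/val_inj e']; last by rewrite e' eqxx in ij.
    by exists i, (j - i)%N; rewrite subn_gt0 subnKC; [split | exact: ltnW].
  by exists j, (i - j)%N; rewrite subn_gt0 subnKC; [split | exact: ltnW].
(* Equal classes make the difference z orthogonal to all e_i for the symmetrized form, hence q(z) =
   0. *)
have [t tE] : exists t, y (n + N)%N - y n = vscale t d.
  apply: qd; set z := _ - _.
  have z0 i : euler z (ebase i) + euler (ebase i) z = 0.
    have e := clP _ _ clE i.
    by have := bnd n i; have := bnd (n + N)%N i; move: e; rewrite /sf eulerBl eulerBr; lia.
  have : euler z z + euler z z = 0.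
    rewrite {1 4}(ebase_sum z) euler_suml euler_sumr -big_split big1 // => i _.
    by rewrite /= eulerZl eulerZr -mulrDr addrC z0 mulr0.
  lia.
have yN j : y (n + j * N)%N = y n + vscale (t * j%:Z) d.
  suff E m : y (m + n + N)%N = y (m + n)%N + vscale t d.
    elim: j => [|j IH].
      by rewrite mul0n addn0; apply/ffunP=> i; rewrite !ffunE mulr0 mul0r addr0.
    have -> : (n + j.+1 * N = j * N + n + N)%N by rewrite mulSn; lia.
    rewrite E addnC IH; apply/ffunP=> i; rewrite !ffunE; lia.
  elim: m => [|m IH]; first by rewrite add0n -tE addrC subrK.
  apply/eqP; rewrite -subr_eq0; apply/eqP/(@euler_right_nondeg k _ acQ) => z.
  have e1 : euler z (y (m.+1 + n + N)%N) = - euler (y (m + n + N)%N) z.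
    by rewrite !addSn yE opprK.
  have e2 : euler z (y (m.+1 + n)%N) = - euler (y (m + n)%N) z.
    by rewrite !addSn yE opprK.
  rewrite eulerBr eulerDr eulerZr e1 e2 IH eulerDl eulerZl dsym; ring.
have t0 : 0 <= t.
  have [i _] : exists i : vtx Q, true.
    apply: contrapT => nv; suff : def d M = 0 by move: neg; lia.
    rewrite /def /euler !big1 ?subrr // => [a _|i _]; case: nv; last by exists i.
    by exists (src a).
  rewrite leNgt; apply/negP=> tn; pose j := (absz (y n i)).+1.
  have := y0 (n + j * N)%N i; rewrite yN ffunE [vscale _ _ i]ffunE /j.
  move: (dpos i) (y0 n i); move: (y n i) (d i) => yi di d0 yi0.
  have a1 : t * (`|yi|.+1)%:Z <= - (`|yi|.+1)%:Z by rewrite -mulN1r ler_wpM2r //; lia.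
  have a2 : - (`|yi|.+1)%:Z * di <= - (`|yi|.+1)%:Z by rewrite mulNr lerN2 ler_peMr //; lia.
  have a3 : t * (`|yi|.+1)%:Z * di <= - (`|yi|.+1)%:Z * di by rewrite ler_wpM2r // ltW.
  by move: (t * _ * di) a3 => v a3; move: (- _ * di) a2 a3 => w a2 a3; lia.
pose Y := \sum_(n <= l < n + N) y l.
have Ysym z : euler Y z + euler z Y = - t * euler z d.
  rewrite /Y euler_suml euler_sumr -big_split /=.
  under eq_bigr do rewrite sym.
  rewrite -euler_sumr; have -> : \sum_(n <= l < n + N) (y l - y l.+1) = - vscale t d.
    rewrite -tE opprB -[RHS]opprB -(telescope_sumr y) ?leq_addr // -sumrN.
    by apply: eq_bigr => l _; rewrite opprB.
  by rewrite eulerNr eulerZr mulNr.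
have Ydef : euler d Y = def d M *+ N.
  rewrite /Y euler_sumr (eq_bigr (fun=> def d M)) => [|l _]; last exact: ydef.
  by rewrite sumr_const_nat addnC addnK.
have Yq := Ysym Y; have YY := q0 Y.
have Yd : euler Y d = - (def d M *+ N) by rewrite -Ydef dsym opprK.
have Yneg : def d M *+ N < 0 by rewrite pmulrn_llt0.
(* Twice q(Y) is t >= 0 times a negative number. So q(Y) = 0, Y is a multiple of d and has defect 0,
   contrary to [Ydef]. *)
have q0Y : euler Y Y = 0.
  move: Yq; rewrite Yd; move: (def d M *+ N) Yneg (euler Y Y) YY => u hu v hv e.
  have tu : t * u <= 0 by rewrite mulr_ge0_le0 // ltW.
  by move: e; rewrite mulrNN; move: (t * u) tu => w; lia.
have [s sE] := qd Y q0Y.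
have : euler d Y = 0.
  rewrite sE eulerZr; have := dsym d; lia.
by rewrite Ydef; lia.
Qed.

End TorsionDefect.

(** * Regular modules *)

Section RegularModules.
Variables (k : fieldType) (Q : quiver).
Hypothesis acQ : acyclic Q.
Variable d : {ffun vtx Q -> int}.
Hypothesis aff : affine d.
Implicit Types L M N R T X Y Z : kQmodule k Q.

Let acQ' := acyclic_op acQ.
Let aff' := affine_op aff.

(** The condition dual to [tor]: a module whose dual is in [pp] is a direct sum of preinjective
    ones. *)
Definition cotor M := forall C : kQmodule k Q, pp (dual C) -> hom C M = 0%N.

Lemma cotorP M : tor (dual M) <-> cotor M.
Proof.
split=> h => [C pC|N pN]; first by rewrite -hom_dual h.
have [C iC] := predual N; rewrite -(hom_isom_r _ iC) hom_dual h //.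
exact: pp_isom iC pN.
Qed.

(* Neither preprojective nor preinjective summands. *)
Definition reg M := tor M /\ cotor M.

Lemma cotor_mono M N (f : 'Hom(M, N)) : is_hom f -> lker f = 0%VS -> cotor N -> cotor M.
Proof.
by move=> hf fi h C pC; apply/eqP; rewrite -leqn0 -(h C pC) (hom_mono _ hf fi).
Qed.

Lemma cotor_def_le0 M : cotor M -> def d M <= 0.
Proof.
move/cotorP=> /(tor_def_ge0 acQ' aff'); rewrite def_dual //; lia.
Qed.

Lemma reg_def M : reg M -> def d M = 0.
Proof. by case=> /(tor_def_ge0 acQ aff) h1 /cotor_def_le0 h2; lia. Qed.

Lemma reg_isom M N : isom M N -> reg M -> reg N.
Proof.
move=> i [t c]; split; first exact: tor_isom i t.
by case: (isom_sym i) => f /and3P[hf /eqP fi _]; exact: cotor_mono hf fi c.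
Qed.

Lemma reg_ses X Y Z : short_exact X Y Z -> reg X -> reg Z -> reg Y.
Proof.
move=> h [tX cX] [tZ cZ]; split; first exact: tor_ses h tX tZ.
move=> C pC; apply/eqP; rewrite -leqn0; apply: leq_trans (hom_ses_r C h) _.
by rewrite cX // cZ.
Qed.

(** Split X into a torsion part A and a preprojective part B. A inherits [cotor], so it is regular
    of defect 0; hence def X = def B, which is negative unless B = 0. *)
Lemma sub_reg M X (f : 'Hom(X, M)) : is_hom f -> lker f = 0%VS -> reg M ->
  def d X <= 0 /\ (def d X = 0 -> reg X).
Proof.
move=> hf fi [_ cM]; have cX := cotor_mono hf fi cM.
have [A [B [tA pB iX]]] := torsion_split acQ X.
have rA : reg A.
  split=> //; case: (iX) => g /and3P[hg /eqP gi _].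
  apply: (cotor_mono (hom_comp (dinl_hom A B) hg)) cX.
  apply: lker0_intro => u; rewrite comp_lfunE => h.
  by apply: (lker0_inj (dinl_inj A B)); apply: (lker0_inj gi); rewrite h !linear0.
have e : def d X = def d B.
  by rewrite -(def_isom d iX) (def_ses d (dsum_ses A B)) (reg_def rA) add0r.
split; first by rewrite e pp_def_le0.
rewrite e => B0; have zB : is_zero B.
  by apply: contrapT => nz; have := pp_def_lt0 acQ aff pB nz; rewrite B0.
apply: reg_isom iX _; exact: reg_isom (isom_sym (dsum_zero_r A zB)) rA.
Qed.

Lemma dual_lker0 M N (f : 'Hom(M, N)) : lker (dual_map f) = 0%VS -> limg f = fullv.
Proof.
move=> fi; apply/vspaceP=> v; rewrite memvf; apply: contraT => vf.
have : quo_proj (limg f) v != 0 by rewrite quo_proj0.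
case/functional_ex=> l lv; case/negP: lv.
have : (l \o quo_proj (limg f))%VF = 0 :> dual N.
  apply: (lker0_inj fi); rewrite linear0; apply/lfunP=> u.
  rewrite dual_mapE comp_lfunE zero_lfunE.
  by have /eqP-> : quo_proj (limg f) (f u) == 0 by [rewrite quo_proj0 memv_img ?memvf];
    rewrite linear0.
by move/lfunP/(_ v); rewrite comp_lfunE zero_lfunE => ->.
Qed.

(** Split the dual of Z. The predual of its torsion part A is a quotient of Z, hence torsion, and
    the two inequalities of [tor_def_ge0] give def A = 0. The preprojective part then has defect 0
    and vanishes. *)
Lemma tor_def0_reg Z : tor Z -> def d Z = 0 -> reg Z.
Proof.
move=> tZ Z0; split=> //; apply/cotorP.
have [A [B [tA pB iZ]]] := torsion_split acQ' (dual Z).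
have [C iC] := predual A.
have tC : tor C.
  case: (iZ) => u /and3P[hu /eqP ui _]; case: (iC) => v /and3P[hv /eqP vi _].
  pose w := (u \o (dinl A B \o v))%VF.
  have hw : is_hom w by exact: hom_comp (hom_comp hv (dinl_hom A B)) hu.
  have [f ef] := @dual_map_surj k Q Z C w; rewrite -ef in hw.
  apply: tor_epi ((dual_map_hom f).1 hw) _ tZ; apply: dual_lker0; rewrite ef.
  apply: lker0_intro => x; rewrite !comp_lfunE => h; apply: (lker0_inj vi).
  by apply: (lker0_inj (dinl_inj A B)); apply: (lker0_inj ui); rewrite h !linear0.
have A0 : @def k (op_quiver Q) d A = 0.
  have := tor_def_ge0 acQ aff tC; have := tor_def_ge0 acQ' aff' tA.
  by have := @def_isom k (op_quiver Q) d _ _ iC; rewrite def_dual //; lia.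
have B0 : @def k (op_quiver Q) d B = 0.
  have := @def_isom k (op_quiver Q) d _ _ iZ; rewrite (@def_ses k (op_quiver Q) d _ _ _ (dsum_ses A B)) A0.
  by rewrite def_dual // Z0; lia.
have zB : is_zero B.
  by apply: contrapT => nz; have := pp_def_lt0 acQ' aff' pB nz; rewrite B0.
apply: tor_isom iZ _; exact: tor_isom (isom_sym (dsum_zero_r A zB)) tA.
Qed.

Lemma quo_reg M Z (g : 'Hom(M, Z)) : is_hom g -> limg g = fullv -> reg M ->
  0 <= def d Z /\ (def d Z = 0 -> reg Z).
Proof.
move=> hg gs [tM _]; have tZ := tor_epi hg gs tM.
by split; [exact: tor_def_ge0 | exact: tor_def0_reg].
Qed.

Lemma reg_tau M : reg M -> reg (tau M).
Proof.
move=> [tM cM]; split; first exact: tor_tau aff _ tM.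
move=> C pC; have [X iX] := predual (tau (dual C)).
rewrite (hom_tau_dual acQ M iX); apply: cM; apply: pp_isom iX _.
exact: pp_tau'.
Qed.

Lemma reg_tau_inv Y : reg Y -> exists X,
  [/\ reg X, forall M, hom Y (tau M) = hom X M &
      forall y, euler y (dimvec Y) = - euler (dimvec X) y].
Proof.
move=> [tY /cotorP cY]; have [X iX] := predual (tau (dual Y)).
exists X; split=> [|M|y]; last 2 first.
- by rewrite (hom_tau_dual acQ M iX).
- have := tor_euler_tau acQ' cY y.
  by rewrite -(dimvec_isom iX) !dimvec_dual !euler_op.
split.
  move=> B pB; have := euler_formula acQ' (dual Y) (dual B).
  have := euler_formula acQ B Y.
  rewrite -(hom_isom_r _ iX) !dimvec_dual euler_op !hom_dual (ext_pp_tor pB tY); lia.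
apply/cotorP; apply: tor_isom (isom_sym iX) _.
exact: tor_tau aff' _ cY.
Qed.

(** The defect is read off the subspaces e_i X, so that it is a function of the subspace alone and
    lattice identities become dimension counts; [sdefE] relates it to [submod]. *)
Definition sdef M (X : {vspace M}) : int :=
  euler d [ffun i => (\dim (idem M i @: X))%:Z].

Lemma sdefE M (X : {vspace M}) (sX : is_submod X) : sdef X = def d (submod sX).
Proof.
congr (euler d _); apply/ffunP=> i; rewrite dimvecE ffunE; congr Posz; apply/esym.
apply: (dim_bij (f := vsval)) => [//|u _ h|w]; first by apply: subvs_inj; rewrite h linear0.
have E (v : submod sX) : vsval (idem (submod sX) i v) = idem M i (vsval v).
  by have := hom_idem i v (sub_incl_hom sX); rewrite !sub_inclE.
split=> [/memv_imgP[u uX ->]|[u /memv_imgP[v _ ->] <-]].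
  exists (idem (submod sX) i (vsproj X u)); first by rewrite memv_img ?memvf.
  by rewrite E vsprojK.
by rewrite E memv_img // subvsP.
Qed.

Lemma sdef_img M N (f : 'Hom(M, N)) (X : {vspace M}) : is_hom f -> is_submod X ->
  sdef X = sdef (X :&: lker f)%VS + sdef (f @: X)%VS.
Proof.
move=> hf sX; rewrite /sdef -eulerDr; congr (euler d _); apply/ffunP=> i; rewrite !ffunE.
rewrite -PoszD; congr Posz; rewrite -(limg_ker_dim f (idem M i @: X)).
congr (_ + _)%N; congr (\dim _).
  apply/vspaceP=> w; rewrite memv_cap memv_ker; apply/andP/memv_imgP.
    case=> /memv_imgP[u uX ->] /eqP h; exists (idem M i u); last by rewrite idem_app eqxx.
    by rewrite memv_cap memv_ker h eqxx andbT submod_idem.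
  case=> u; rewrite memv_cap memv_ker => /andP[uX /eqP fu] ->.
  by rewrite memv_img // hom_idem // fu linear0 eqxx.
rewrite -!limg_comp; apply: eq_in_limg => u uX /=.
by rewrite !comp_lfunE hom_idem.
Qed.

Lemma sdef_add M (X Y : {vspace M}) : is_submod X -> is_submod Y ->
  sdef (X + Y)%VS + sdef (X :&: Y)%VS = sdef X + sdef Y.
Proof.
move=> sX sY; rewrite /sdef -!eulerDr; congr (euler d _); apply/ffunP=> i; rewrite !ffunE.
rewrite -!PoszD limgD.
have -> : (idem M i @: (X :&: Y) = idem M i @: X :&: idem M i @: Y)%VS.
  apply/vspaceP=> w; rewrite memv_cap; apply/memv_imgP/andP.
    by case=> u; rewrite memv_cap => /andP[uX uY] ->; rewrite !memv_img.
  case=> /memv_imgP[u uX ->] /memv_imgP[v vY e]; exists (idem M i u).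
    by rewrite memv_cap submod_idem //= e submod_idem.
  by rewrite idem_app eqxx.
by rewrite dimv_sum_cap.
Qed.

Lemma sdef0 M : sdef (0%VS : {vspace M}) = 0.
Proof.
rewrite /sdef (_ : [ffun _ => _] = 0) ?euler0r //; apply/ffunP=> i.
by rewrite !ffunE limg0 dimv0.
Qed.

Lemma sdef_full M : sdef (fullv : {vspace M}) = def d M.
Proof. by congr (euler d _); apply/ffunP=> i; rewrite !ffunE. Qed.

(** Inside a regular module these are the regular submodules, by [reg_submod] and [reg_def]. *)
Definition rs M (X : {vspace M}) : bool := is_submod X && (sdef X == 0).

Lemma rs_sub M (X : {vspace M}) : rs X -> is_submod X. Proof. by case/andP. Qed.
Lemma rs_def M (X : {vspace M}) : rs X -> sdef X = 0. Proof. by case/andP=> _ /eqP. Qed.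

Lemma rs0 M : rs (0%VS : {vspace M}).
Proof. by rewrite /rs submod_zero sdef0 eqxx. Qed.

Lemma sdef_le0 M (X : {vspace M}) : reg M -> is_submod X -> sdef X <= 0.
Proof.
move=> rM sX; rewrite (sdefE sX).
by have [] := sub_reg (sub_incl_hom sX) (sub_incl_inj sX) rM.
Qed.

Lemma rs_full M : reg M -> rs (fullv : {vspace M}).
Proof. by move=> rM; rewrite /rs submod_full sdef_full reg_def. Qed.

Lemma reg_submod M (X : {vspace M}) (sX : is_submod X) : reg M -> rs X -> reg (submod sX).
Proof.
move=> rM /rs_def; rewrite (sdefE sX).
by have [] := sub_reg (sub_incl_hom sX) (sub_incl_inj sX) rM.
Qed.

Lemma reg_quomod M (X : {vspace M}) (sX : is_submod X) : reg M -> rs X -> reg (quomod sX).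
Proof.
move=> rM /rs_def; rewrite (sdefE sX) => X0.
have [_] := quo_reg (quo_proj_hom sX) (limg_quo_proj X) rM; apply.
by have := def_ses d (sub_ses sX); rewrite X0 (reg_def rM) add0r.
Qed.

(** By [sdef_add] the defects of sum and intersection add up to 0, and neither is positive. The same
    argument gives [rs_cap] and, with [sdef_img], [rs_img_ker]. *)
Lemma rs_add M (X Y : {vspace M}) : reg M -> rs X -> rs Y -> rs (X + Y)%VS.
Proof.
move=> rM rX rY; have sX := rs_sub rX; have sY := rs_sub rY.
rewrite /rs submod_add //=; have := sdef_add sX sY; rewrite (rs_def rX) (rs_def rY).
have := sdef_le0 rM (submod_add sX sY); have := sdef_le0 rM (submod_cap sX sY); lia.
Qed.

Lemma rs_cap M (X Y : {vspace M}) : reg M -> rs X -> rs Y -> rs (X :&: Y)%VS.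
Proof.
move=> rM rX rY; have sX := rs_sub rX; have sY := rs_sub rY.
rewrite /rs submod_cap //=; have := sdef_add sX sY; rewrite (rs_def rX) (rs_def rY).
have := sdef_le0 rM (submod_add sX sY); have := sdef_le0 rM (submod_cap sX sY); lia.
Qed.

Lemma rs_img_ker M N (f : 'Hom(M, N)) (X : {vspace M}) :
  reg M -> reg N -> is_hom f -> rs X -> rs (f @: X)%VS /\ rs (X :&: lker f)%VS.
Proof.
move=> rM rN hf rX; have sX := rs_sub rX; have := sdef_img hf sX; rewrite (rs_def rX).
have sI := submod_img hf sX; have sK := submod_cap sX (submod_ker hf).
have := sdef_le0 rN sI; have := sdef_le0 rM sK; rewrite /rs sI sK /= => h1 h2 h3.
by split; lia.
Qed.

Lemma rs_img M N (f : 'Hom(M, N)) (X : {vspace M}) :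
  reg M -> reg N -> is_hom f -> rs X -> rs (f @: X)%VS.
Proof. by move=> rM rN hf rX; have [] := rs_img_ker rM rN hf rX. Qed.

Lemma rs_ker M N (f : 'Hom(M, N)) : reg M -> reg N -> is_hom f -> rs (lker f).
Proof.
by move=> rM rN hf; have [_] := rs_img_ker rM rN hf (rs_full rM); rewrite capfv.
Qed.

Lemma rs_preim M N (f : 'Hom(M, N)) (Y : {vspace N}) :
  reg M -> reg N -> is_hom f -> rs Y -> rs (f @^-1: Y)%VS.
Proof.
move=> rM rN hf rY; have sY := rs_sub rY; have sP := submod_preim hf sY.
rewrite /rs sP (sdef_img hf sP) /=.
have -> : (f @^-1: Y :&: lker f = lker f)%VS.
  apply/capv_idPr/subvP=> u; rewrite memv_ker -memv_preim => /eqP->; exact: mem0v.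
have -> : (f @: (f @^-1: Y) = Y :&: limg f)%VS.
  by rewrite -lpreim_cap_limg lpreimK // capvSr.
rewrite (rs_def (rs_ker rM rN hf)) add0r; apply/eqP/rs_def/rs_cap => //.
exact: rs_img (rs_full rM).
Qed.

Definition rsimple T := [/\ reg T, ~ is_zero T &
  forall X : {vspace T}, rs X -> X = 0%VS \/ X = fullv].

Lemma rsimple_inj T N (f : 'Hom(T, N)) : rsimple T -> reg N -> is_hom f -> f <> 0 ->
  lker f = 0%VS.
Proof.
move=> [rT _ sT] rN hf f0; case: (sT _ (rs_ker rT rN hf)) => // e; case: f0.
by apply/lfunP=> u; rewrite zero_lfunE; apply/eqP; rewrite -memv_ker e memvf.
Qed.

Lemma rsimple_surj T N (f : 'Hom(N, T)) : rsimple T -> reg N -> is_hom f -> f <> 0 ->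
  limg f = fullv.
Proof.
move=> [rT _ sT] rN hf f0; case: (sT _ (rs_img rN rT hf (rs_full rN))) => // e; case: f0.
by apply/lfunP=> u; rewrite zero_lfunE; apply/eqP; rewrite -memv0 -e memv_img ?memvf.
Qed.

Lemma rsimple_isom T T' : rsimple T -> rsimple T' -> (0 < hom T T')%N -> isom T T'.
Proof.
move=> sT sT' /hom_gt0[f hf f0]; exists f; have [rT _ _] := sT; have [rT' _ _] := sT'.
by apply: iso_intro => //; [exact: rsimple_inj rT' _ _ | exact: rsimple_surj rT _ _].
Qed.

Lemma zero_full M : is_zero M <-> (fullv : {vspace M}) = 0%VS.
Proof.
by rewrite /is_zero; split=> [/eqP|->]; rewrite ?dimv0 // dimv_eq0 => /eqP.
Qed.

Lemma hom_self M : ~ is_zero M -> (0 < hom M M)%N.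
Proof. by move=> nz; rewrite lt0n; apply/eqP=> /hom_self0. Qed.

Lemma isom_zero M N : isom M N -> is_zero M -> is_zero N.
Proof. by move=> i; rewrite !is_zero_dimvec (dimvec_isom i). Qed.

(** For a nonzero regular submodule Y of tau T, the inverse translate X of Y maps onto T, as hom(X,
    T) = hom(Y, tau T). Then dim Y is dim tau T plus the dimension of the translate of the kernel,
    so Y is all of tau T. *)
Lemma tau_rsimple T : rsimple T -> rsimple (tau T).
Proof.
move=> [rT nz sT]; have rtT := reg_tau rT; split=> //.
  move=> z; apply: nz; apply/is_zero_dimvec/(euler_left_nondeg acQ) => i.
  rewrite (tor_euler_tau acQ rT.1) ((is_zero_dimvec (tau T)).1 z) euler0r.
  exact: oppr0.
move=> Y rY; have sY := rs_sub rY; case: (eqVneq Y 0%VS) => [->|Y0]; [by left|right].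
have rYm := reg_submod sY rtT rY.
have [X [rX eX dX]] := reg_tau_inv rYm.
have : (0 < hom X T)%N.
  rewrite -eX; apply/hom_gt0; exists (sub_incl sY); first exact: sub_incl_hom.
  move=> e; case/eqP: Y0; rewrite -(sub_incl_img sY) e; exact: lim0g.
case/hom_gt0=> f hf f0; have fs := rsimple_surj (And3 rT nz sT) rX hf f0.
have sK := submod_ker hf; have rK := reg_submod sK rX (rs_ker rX rT hf).
have sesK : short_exact (submod sK) X T.
  by exists (sub_incl sK), f; split; rewrite ?sub_incl_hom ?sub_incl_inj ?sub_incl_img.
have e : dimvec (tau (submod sK)) + dimvec (tau T) = dimvec (submod sY).
  apply/eqP; rewrite -subr_eq0; apply/eqP/(@euler_right_nondeg k _ acQ) => z.
  have := tor_euler_tau acQ rK.1 z; have := tor_euler_tau acQ rT.1 z; have := dX z.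
  rewrite (dimvec_ses sesK) eulerDl eulerBr eulerDr; lia.
apply/eqP; rewrite eqEdim subvf /=.
have -> : \dim Y = \dim {:submod sY} by rewrite dimvf.
rewrite (dim_vdim (tau T)) (dim_vdim (submod sY)); apply: leq_sum => i _; move/ffunP/(_ i): e.
by rewrite [X in X = _]ffunE !dimvecE; lia.
Qed.

End RegularModules.

(** * Uniserial modules *)

Lemma double_not_le m n : (0 < m)%N -> (m + m <= n)%N -> (n <= m)%N -> False.
Proof. lia. Qed.

Section Uniserial.
Variables (k : fieldType) (Q : quiver).
Hypothesis acQ : acyclic Q.
Variable d : {ffun vtx Q -> int}.
Hypothesis aff : affine d.
Implicit Types L M N R T : kQmodule k Q.
Local Notation rs := (rs d).
Local Notation rsimple := (rsimple d).

Definition chain M := forall X Y : {vspace M}, rs X -> rs Y -> (X <= Y)%VS || (Y <= X)%VS.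

Definition atom M (S : {vspace M}) := [/\ rs S, S != 0%VS &
  forall Z : {vspace M}, rs Z -> (Z <= S)%VS -> Z = 0%VS \/ Z = S].
Definition coatom M (S : {vspace M}) := [/\ rs S, S != fullv &
  forall Z : {vspace M}, rs Z -> (S <= Z)%VS -> Z = S \/ Z = fullv].

Lemma atom_ex M (X : {vspace M}) : rs X -> X != 0%VS -> exists2 S, atom S & (S <= X)%VS.
Proof.
move=> rX X0; pose good n := `[< exists S : {vspace M},
  [/\ rs S, S != 0%VS, (S <= X)%VS & \dim S = n] >].
have ex : exists n, good n by exists (\dim X); apply/asboolP; exists X; split.
case: (ex_minnP ex) => m /asboolP[S [rS S0 SX dS]] mn; exists S => //; split=> // Z rZ ZS.
case: (eqVneq Z 0%VS) => [->|Z0]; [by left|right].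
apply/eqP; rewrite eqEdim ZS dS; apply: mn; apply/asboolP; exists Z; split=> //.
exact: subv_trans ZS SX.
Qed.

Lemma coatom_ex M (X : {vspace M}) : rs X -> X != fullv ->
  exists2 S, coatom S & (X <= S)%VS.
Proof.
move=> rX X0; pose good n := `[< exists S : {vspace M},
  [/\ rs S, S != fullv, (X <= S)%VS & \dim S = n] >].
have ex : exists n, good n by exists (\dim X); apply/asboolP; exists X; split.
have bd n : good n -> (n <= \dim {:M})%N.
  by move/asboolP=> [S [_ _ _ <-]]; apply/dimvS/subvf.
case: (ex_maxnP ex bd) => m /asboolP[S [rS S0 SX dS]] mx; exists S => //; split=> // Z rZ ZS.
case: (eqVneq Z fullv) => [->|Z0]; [by right|left].
apply/esym/eqP; rewrite eqEdim ZS dS; apply: mx; apply/asboolP; exists Z; split=> //.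
exact: subv_trans SX ZS.
Qed.

Lemma atom_rsimple M (S : {vspace M}) (sS : is_submod S) : reg M -> atom S ->
  rsimple (submod sS).
Proof.
move=> rM [rS S0 mS]; have rSm := reg_submod acQ aff sS rM rS; split=> //.
  move/zero_full=> e; case/eqP: S0; rewrite -(sub_incl_img sS) e; exact: limg0.
move=> X rX; have rI := rs_img acQ aff rSm rM (sub_incl_hom sS) rX.
have iS : lker (sub_incl sS) == 0%VS by rewrite sub_incl_inj.
case: (mS _ rI); first by rewrite -[X in (_ <= X)%VS](sub_incl_img sS) limgS ?subvf.
  move=> e; left; apply/eqP; rewrite -(eq_limg_ker0 _ _ iS) limg0; exact/eqP.
move=> e; right; apply/eqP; rewrite -(eq_limg_ker0 _ _ iS) sub_incl_img; exact/eqP.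
Qed.

Lemma coatom_rsimple M (S : {vspace M}) (sS : is_submod S) : reg M -> coatom S ->
  rsimple (quomod sS).
Proof.
move=> rM [rS S0 mS]; have rSm := reg_quomod acQ aff sS rM rS.
have hq := quo_proj_hom sS; have qs := limg_quo_proj S; split=> //.
  move/is_zeroP=> z; case/eqP: S0; apply/vspaceP=> u; rewrite memvf -quo_proj0.
  by apply/eqP; exact: z.
move=> X rX; have rP := rs_preim acQ aff rM rSm hq rX.
have XE : X = (quo_proj S @: (quo_proj S @^-1: X))%VS by rewrite lpreimK // qs subvf.
case: (mS _ rP).
- apply/subvP=> u uS; rewrite -memv_preim.
  by have /eqP-> : quo_proj S u == 0 by [rewrite quo_proj0]; exact: mem0v.
- move=> e; left; rewrite XE e; apply/eqP; rewrite -subv0.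
  apply/subvP=> _ /memv_imgP[u uS ->].
  by have /eqP-> : quo_proj S u == 0 by [rewrite quo_proj0]; exact: mem0v.
by move=> e; right; rewrite XE e qs.
Qed.

(** The cokernel of Hom(N, Y) -> Hom(N, Z) embeds into Ext^1(N, X); this piece of the long exact
    sequence is read off from Euler formulas. *)
Lemma hom_quo_le N (X Y Z : kQmodule k Q) : short_exact X Y Z ->
  (hom N Z + hom N X <= hom N Y + hom X (tau N))%N.
Proof.
move=> h; have := euler_formula acQ N X; have := euler_formula acQ N Y.
have := euler_formula acQ N Z; rewrite (dimvec_ses h) eulerDr.
case: h => f [g [hf hg fi fg gs]]; have := hom_epi (tau N) hg gs; lia.
Qed.

Lemma hom_sub_le N (X Y Z : kQmodule k Q) : short_exact X Y Z ->
  (hom X N + hom Z N <= hom Y N + hom N (tau Z))%N.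
Proof.
move=> h; have := euler_formula acQ X N; have := euler_formula acQ Y N.
have := euler_formula acQ Z N; rewrite (dimvec_ses h) eulerDl.
case: h => f [g [hf hg fi fg gs]].
have := hom_mono N (tau_map_hom hf) (tau_map_inj hf fi); lia.
Qed.

(* The quotient by the socle again has a simple socle, because                *)
(* Hom(T, R / S) embeds into Ext^1(T, S) = D Hom(S, tau T).                   *)
Lemma socle_chain R (S : {vspace R}) : reg R -> rs S -> S != 0%VS ->
  (forall Z : {vspace R}, rs Z -> Z != 0%VS -> (S <= Z)%VS) -> chain R.
Proof.
have [n] := ubnP (\dim {:R}); elim: n R S => // n IH R S le rR rS S0 mS.
have sS := rs_sub rS; have rq := reg_quomod acQ aff sS rR rS.
have aS : atom S.
  split=> // Z rZ ZS; case: (eqVneq Z 0%VS) => [->|Z0]; [by left|right].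
  by apply/eqP; rewrite eqEsubv ZS mS.
have simS := atom_rsimple sS rR aS.
have hq := quo_proj_hom sS; have qs := limg_quo_proj S.
suff cq : chain (quomod sS).
  move=> X Y rX rY; case: (eqVneq X 0%VS) => [->|X0]; first by rewrite sub0v.
  case: (eqVneq Y 0%VS) => [->|Y0]; first by rewrite sub0v orbT.
  have SX := mS _ rX X0; have SY := mS _ rY Y0.
  have E (A B : {vspace R}) : (S <= B)%VS -> (quo_proj S @: A <= quo_proj S @: B)%VS -> (A <= B)%VS.
    move=> SB AB; apply/subvP=> u uA; have /(subvP AB)/memv_imgP[v vB e] := memv_img (quo_proj S) uA.
    have : u - v \in S by rewrite -quo_proj0 linearB /= e subrr.
    by move/(subvP SB) => h; rewrite -(subrK v u) memvD.
  have := cq _ _ (rs_img acQ aff rR rq hq rX) (rs_img acQ aff rR rq hq rY).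
  by case/orP=> /E-> //; rewrite orbT.
case: (pselect (is_zero (quomod sS))) => [/zero_full z|nz].
  move=> X Y _ _; have : (X <= fullv)%VS by exact: subvf.
  by rewrite z subv0 => /eqP->; rewrite sub0v.
have [|A aA _] := @atom_ex (quomod sS) fullv (rs_full acQ aff rq).
  by apply/eqP=> e; apply: nz; apply/zero_full.
have dS : (0 < \dim S)%N by rewrite lt0n dimv_eq0.
apply: (IH (quomod sS) A) => //.
- have := dim_vdim R; have := dim_vdim (submod sS); have := dim_vdim (quomod sS).
  have -> : (\sum_i vdim R i = \sum_i vdim (submod sS) i + \sum_i vdim (quomod sS) i)%N.
    by rewrite -big_split; apply: eq_bigr => i _; exact: vdim_ses (sub_ses sS).
  have -> : \dim {:submod sS} = \dim S by rewrite dimvf.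
  by move: le dS; lia.
- by case: aA.
- by case: aA.
move=> Z rZ Z0; have [B aB BZ] := atom_ex rZ Z0.
suff -> : A = B by [].
apply: contrapT => AB.
have rA : rs A by case: aA. have rB : rs B by case: aB.
have sA := rs_sub rA; have sB := rs_sub rB.
have simA := atom_rsimple sA rq aA; have simB := atom_rsimple sB rq aB.
have AB0 : (A :&: B = 0)%VS.
  case: aA => _ A0 mA; case: aB => _ B0 mB.
  have rAB := rs_cap acQ aff rq rA rB.
  case: (mA _ rAB (capvSl _ _)) => // e; case: (mB _ rAB (capvSr _ _)) => // e'.
  by case: AB; exact: etrans (esym e) e'.
(* A nonzero map T -> R is injective and its image contains S, so the preimage of S is nonzero,
   hence all of T. Thus no map T -> R survives in R / S. *)
have hle T : rsimple T -> (hom T (quomod sS) <= hom (submod sS) (tau T))%N.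
  move=> simT; have [rT _ sT] := simT; have := hom_quo_le T (sub_ses sS).
  suff -> : hom T R = hom T (submod sS) by rewrite addnC leq_add2l.
  have [|I -> IP] := hom_ses_r_gen T (sub_incl_hom sS) hq (sub_incl_inj sS).
    by rewrite sub_incl_img lker_quo_proj.
  suff -> : I = 0%VS by rewrite dimv0 addn0.
  apply/eqP; rewrite -subv0; apply/subvP=> _ /IP[f hf <-].
  rewrite memv0; apply/eqP/lfunP=> u; rewrite comp_lfunE zero_lfunE.
  apply/eqP; rewrite quo_proj0.
  case: (pselect (f = 0)) => [->|f0]; first by rewrite zero_lfunE mem0v.
  have fi := rsimple_inj acQ aff simT rR hf f0.
  have rP := rs_preim acQ aff rT rR hf rS.
  case: (sT _ rP) => e.
    have rI := rs_img acQ aff rT rR hf (rs_full acQ aff rT).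
    have I0 : limg f != 0%VS.
      by apply/eqP=> e'; apply: f0; apply/lfunP=> v; rewrite zero_lfunE; apply/eqP;
        rewrite -memv0 -e' memv_img ?memvf.
    have SI := mS _ rI I0; case/eqP: S0; apply/eqP; rewrite -subv0.
    apply/subvP=> s sinS; have /(subvP SI)/memv_imgP[v _ ev] := sinS.
    have : v \in (f @^-1: S)%VS by rewrite -memv_preim -ev.
    by rewrite e memv0 ev => /eqP->; rewrite linear0 mem0v.
  by rewrite memv_preim e memvf.
have gA : (0 < hom (submod sA) (quomod sS))%N.
  apply/hom_gt0; exists (sub_incl sA); first exact: sub_incl_hom.
  by move=> e; case: aA => _ /eqP A0 _; apply: A0; rewrite -(sub_incl_img sA) e lim0g.
have gB : (0 < hom (submod sB) (quomod sS))%N.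
  apply/hom_gt0; exists (sub_incl sB); first exact: sub_incl_hom.
  by move=> e; case: aB => _ /eqP B0 _; apply: B0; rewrite -(sub_incl_img sB) e lim0g.
(* S is the translate of both A and B, so A and B are isomorphic. Their direct sum inside R / S
   yields twice hom(A, A) on the left of [hle] and hom(A, A) on the right. *)
have iA := rsimple_isom acQ aff simS (tau_rsimple acQ aff simA) (leq_trans gA (hle _ simA)).
have iB := rsimple_isom acQ aff simS (tau_rsimple acQ aff simB) (leq_trans gB (hle _ simB)).
have [rAm nzA _] := simA; have [rSm nzS _] := simS.
have hAB : (0 < hom (submod sA) (submod sB))%N.
  rewrite (tor_hom_tau acQ _ rAm.1) -(hom_isom_l _ iA) -(hom_isom_r _ iB).
  exact: hom_self nzS.
have iAB := rsimple_isom acQ aff simA simB hAB.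
have := hle _ simA; rewrite (hom_isom_l _ iA) -(tor_hom_tau acQ _ rAm.1).
have [f hf fE] := dsum_map (sub_incl_hom sA) (sub_incl_hom sB).
have fi : lker f = 0%VS.
  apply: lker0_intro => -[a b]; rewrite fE !sub_inclE => e.
  have ab : vsval a = - vsval b by apply/eqP; rewrite -addr_eq0; apply/eqP.
  have a0 : vsval a = 0.
    by apply/eqP; rewrite -memv0 -AB0 memv_cap subvsP ab memvN subvsP.
  have b0 : vsval b = 0 by apply/eqP; rewrite -oppr_eq0 -ab a0.
  by congr pair; apply: subvs_inj; rewrite ?a0 ?b0 linear0.
have := hom_mono (submod sA) hf fi; rewrite hom_dsum_r -(hom_isom_r _ iAB).
exact: double_not_le (hom_self nzA).
Qed.

(** Dual to [socle_chain]: maps from R to a regular simple T vanish on S, so Hom(S, T) embeds into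
    Ext^1(R / S, T), dual to Hom(T, tau (R / S)). Two maximal regular submodules of S would make
    this Hom too large. *)
Lemma top_chain R (S : {vspace R}) : reg R -> rs S -> S != fullv ->
  (forall Z : {vspace R}, rs Z -> Z != fullv -> (Z <= S)%VS) -> chain R.
Proof.
have [n] := ubnP (\dim {:R}); elim: n R S => // n IH R S le rR rS S1 mS.
have sS := rs_sub rS; have rm := reg_submod acQ aff sS rR rS.
have cS : coatom S.
  split=> // Z rZ ZS; case: (eqVneq Z fullv) => [->|Z0]; [by right|left].
  by apply/eqP; rewrite eqEsubv ZS mS.
have simS := coatom_rsimple sS rR cS.
have hi := sub_incl_hom sS; have ii := sub_incl_inj sS.
have hq := quo_proj_hom sS; have qs := limg_quo_proj S.
suff cm : chain (submod sS).
  move=> X Y rX rY; case: (eqVneq X fullv) => [->|X1]; first by rewrite subvf orbT.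
  case: (eqVneq Y fullv) => [->|Y1]; first by rewrite subvf.
  have XS := mS _ rX X1; have YS := mS _ rY Y1.
  have E (A B : {vspace R}) : (A <= S)%VS ->
      (sub_incl sS @^-1: A <= sub_incl sS @^-1: B)%VS -> (A <= B)%VS.
    move=> AS AB; apply/subvP=> u uA; have uS := subvP AS _ uA.
    have : vsproj S u \in (sub_incl sS @^-1: A)%VS by rewrite -memv_preim sub_inclE vsprojK.
    by move/(subvP AB); rewrite -memv_preim sub_inclE vsprojK.
  have := cm _ _ (rs_preim acQ aff rm rR hi rX) (rs_preim acQ aff rm rR hi rY).
  by case/orP=> /E-> //; rewrite orbT.
case: (pselect (is_zero (submod sS))) => [/zero_full z|nz].
  move=> X Y _ _; have : (X <= fullv)%VS by exact: subvf.
  by rewrite z subv0 => /eqP->; rewrite sub0v.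
have [|A cA _] := @coatom_ex (submod sS) 0%VS (rs0 d _).
  by apply/eqP=> e; apply: nz; apply/zero_full.
apply: (IH (submod sS) A) => //.
- have : (\dim S < \dim {:R})%N.
    rewrite ltn_neqAle dimvS ?subvf // andbT; apply: contra S1 => /eqP e.
    by rewrite eqEdim subvf e leqnn.
  by have -> : \dim {:submod sS} = \dim S by [rewrite dimvf]; move: le; lia.
- by case: cA.
- by case: cA.
move=> Z rZ Z1; have [B cB ZB] := coatom_ex rZ Z1.
suff -> : A = B by [].
apply: contrapT => AB.
have rA : rs A by case: cA. have rB : rs B by case: cB.
have sA := rs_sub rA; have sB := rs_sub rB.
have simA := coatom_rsimple sA rm cA; have simB := coatom_rsimple sB rm cB.
have AB1 : (A + B = fullv)%VS.
  case: cA => _ A0 mA; case: cB => _ B0 mB.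
  have rAB := rs_add acQ aff rm rA rB.
  case: (mA _ rAB (addvSl _ _)) => // e; case: (mB _ rAB (addvSr _ _)) => // e'.
  by case: AB; exact: etrans (esym e) e'.
have hle T : rsimple T -> (hom (submod sS) T <= hom T (tau (quomod sS)))%N.
  move=> simT; have [rT _ sT] := simT; have := hom_sub_le T (sub_ses sS).
  suff -> : hom R T = hom (quomod sS) T by rewrite addnC leq_add2l.
  have [|I -> IP] := hom_ses_l_gen T hi hq qs.
    by rewrite sub_incl_img lker_quo_proj.
  suff -> : I = 0%VS by rewrite dimv0 addn0.
  apply/eqP; rewrite -subv0; apply/subvP=> _ /IP[f hf <-].
  rewrite memv0; apply/eqP/lfunP=> u; rewrite comp_lfunE zero_lfunE sub_inclE.
  case: (pselect (f = 0)) => [->|f0]; first by rewrite zero_lfunE.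
  have fs := rsimple_surj acQ aff simT rR hf f0.
  have rI := rs_img acQ aff rR rT hf rS.
  case: (sT _ rI) => e.
    by apply/eqP; rewrite -memv0 -e memv_img // subvsP.
  have rK := rs_ker acQ aff rR rT hf.
  have K1 : lker f != fullv.
    apply/eqP=> e'; apply: f0; apply/lfunP=> v; rewrite zero_lfunE; apply/eqP.
    by rewrite -memv_ker e' memvf.
  have KS := mS _ rK K1; case/eqP: S1; apply/vspaceP=> v; rewrite memvf.
  have : f v \in (f @: S)%VS by rewrite e memvf.
  case/memv_imgP=> w wS ew; rewrite -(subrK w v) memvD //; apply: (subvP KS).
  by rewrite memv_ker linearB /= ew subrr.
have gA : (0 < hom (submod sS) (quomod sA))%N.
  apply/hom_gt0; exists (quo_proj A : 'Hom(submod sS, quomod sA)); first exact: quo_proj_hom.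
  move=> e; case: cA => _ /eqP A1 _; apply: A1; rewrite -(lker_quo_proj A) e.
  by apply/vspaceP=> v; rewrite memv_ker zero_lfunE eqxx memvf.
have gB : (0 < hom (submod sS) (quomod sB))%N.
  apply/hom_gt0; exists (quo_proj B : 'Hom(submod sS, quomod sB)); first exact: quo_proj_hom.
  move=> e; case: cB => _ /eqP B1 _; apply: B1; rewrite -(lker_quo_proj B) e.
  by apply/vspaceP=> v; rewrite memv_ker zero_lfunE eqxx memvf.
have simtS := tau_rsimple acQ aff simS.
have iA := rsimple_isom acQ aff simA simtS (leq_trans gA (hle _ simA)).
have iB := rsimple_isom acQ aff simB simtS (leq_trans gB (hle _ simB)).
have [rAm nzA _] := simA.
have iAB : isom (quomod sB) (quomod sA) := isom_trans iB (isom_sym iA).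
have := hle _ simA; rewrite -(hom_isom_r _ iA).
have hA := quo_proj_hom sA; have hB := quo_proj_hom sB.
have [f hf fE] := dsum_pair hA hB.
have fs : limg f = fullv.
  apply: limg_full => -[x y].
  have [u ux] := limg_fullP x (limg_quo_proj A); have [v vy] := limg_fullP y (limg_quo_proj B).
  have : u - v \in (A + B)%VS by rewrite AB1 memvf.
  case/memv_addP=> a aA [b bB e]; exists (u - a); rewrite fE; congr pair.
    have /eqP qa : quo_proj A a == 0 by rewrite quo_proj0.
    by rewrite linearB /= qa subr0.
  have -> : u - a = v + b by apply/eqP; rewrite subr_eq -(subrK v u) e addrC [a + b]addrC addrA.
  have /eqP qb : quo_proj B b == 0 by rewrite quo_proj0.
  by rewrite linearD /= qb addr0.
have := hom_epi (quomod sA) hf fs; rewrite hom_dsum_l (hom_isom_l _ iAB).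
exact: double_not_le (hom_self nzA).
Qed.

(* A uniserial submodule or quotient of maximal dimension splits off. *)
Lemma indec_chain R : reg R -> indecomposable R -> chain R.
Proof.
move=> rR [nz ind].
have nzf : (fullv : {vspace R}) != 0%VS by apply/eqP=> e; apply: nz; apply/zero_full.
pose good n := `[< exists (A : {vspace R}) (sA : is_submod A), rs A /\
  ([/\ chain (submod sA), A != 0%VS & \dim A = n] \/
   [/\ chain (quomod sA), A != fullv & (\dim {:R} - \dim A = n)%N]) >].
have [S aS _] := atom_ex (rs_full acQ aff rR) nzf.
have ex : exists n, good n.
  exists (\dim S); apply/asboolP; have [rS S0 mS] := aS; exists S, (rs_sub rS); split=> //.
  left; split=> // X Y rX _; have [_ _ sS] := atom_rsimple (rs_sub rS) rR aS.
  by case: (sS X rX) => ->; rewrite ?sub0v ?subvf ?orbT.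
have bd n : good n -> (n <= \dim {:R})%N.
  move/asboolP=> [A [sA [_ [[_ _ <-]|[_ _ <-]]]]]; last exact: leq_subr.
  exact/dimvS/subvf.
have conv (A B : {vspace R}) : rs A -> rs B -> (A :&: B = 0)%VS -> (A + B = fullv)%VS ->
    A = 0%VS \/ B = 0%VS.
  move=> rA rB AB0 AB1; have sA := rs_sub rA; have sB := rs_sub rB.
  have [f hf fE] := dsum_map (sub_incl_hom sA) (sub_incl_hom sB).
  have : isom (dsum (submod sA) (submod sB)) R.
    exists f; apply: iso_intro => //.
      apply: lker0_intro => -[a b]; rewrite fE /= !sub_inclE => e.
      have ab : vsval a = - vsval b by apply/eqP; rewrite -addr_eq0 e.
      have a0 : vsval a = 0.
        by apply/eqP; rewrite -memv0 -AB0 memv_cap subvsP ab memvN subvsP.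
      have b0 : vsval b = 0 by apply/eqP; rewrite -oppr_eq0 -ab a0.
      by congr pair; apply: subvs_inj; rewrite ?a0 ?b0 linear0.
    apply: limg_full => u; have : u \in (A + B)%VS by rewrite AB1 memvf.
    case/memv_addP=> a aA [b bB ->]; exists (vsproj A a, vsproj B b).
    by rewrite fE /= !sub_inclE !vsprojK.
  move/isom_sym/ind=> -[]; rewrite /is_zero dimvf => /eqP e; [left|right];
  by apply/eqP; rewrite -dimv_eq0.
case: (ex_maxnP ex bd) => m /asboolP[A [sA [rA [[cA A0 dA]|[cA A1 dA]]]]] mx.
  (* B is maximal with zero intersection with A. Then R / B has the socle of A as its simple socle,
     so it is uniserial, and dim R / B <= dim A makes B a complement of A. *)
  pose goodB n := `[< exists B : {vspace R}, [/\ rs B, (B :&: A = 0)%VS & \dim B = n] >].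
  have exB : exists n, goodB n.
    by exists 0%N; apply/asboolP; exists 0%VS; split; [exact: rs0|exact: cap0v|exact: dimv0].
  have bdB n : goodB n -> (n <= \dim {:R})%N.
    by move/asboolP=> [B [_ _ <-]]; apply/dimvS/subvf.
  case: (ex_maxnP exB bdB) => p /asboolP[B [rB BA dB]] mxB.
  have sB := rs_sub rB; have rqB := reg_quomod acQ aff sB rR rB.
  have hq := quo_proj_hom sB.
  have rmA := reg_submod acQ aff sA rR rA.
  have [S' [rS' S'0 mS'] S'A] := atom_ex rA A0.
  have S'min (Z : {vspace R}) : rs Z -> (Z <= A)%VS -> Z != 0%VS -> (S' <= Z)%VS.
    move=> rZ ZA Z0; have hi := sub_incl_hom sA.
    have := cA _ _ (rs_preim acQ aff rmA rR hi rS') (rs_preim acQ aff rmA rR hi rZ).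
    have E (X Y : {vspace R}) : (X <= A)%VS ->
        (sub_incl sA @^-1: X <= sub_incl sA @^-1: Y)%VS -> (X <= Y)%VS.
      move=> XA XY; apply/subvP=> u uX; have uA := subvP XA _ uX.
      have : vsproj A u \in (sub_incl sA @^-1: X)%VS by rewrite -memv_preim sub_inclE vsprojK.
      by move/(subvP XY); rewrite -memv_preim sub_inclE vsprojK.
    case/orP=> /E; first by apply.
    move/(_ ZA) => ZS; case: (mS' _ rZ ZS) => [e|->//].
    by rewrite e eqxx in Z0.
  have qchain : chain (quomod sB).
    have rI := rs_img acQ aff rR rqB hq rS'.
    apply: (@socle_chain (quomod sB) (quo_proj B @: S')%VS) => //.
      apply/eqP=> e; case/eqP: S'0; apply/eqP; rewrite -subv0 -BA subv_cap S'A andbT.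
      apply/subvP=> u uS; have := memv_img (quo_proj B) uS.
      by rewrite e memv0 quo_proj0.
    move=> Z rZ Z0; have rP := rs_preim acQ aff rR rqB hq rZ.
    have BP : (B <= quo_proj B @^-1: Z)%VS.
      apply/subvP=> u uB; rewrite -memv_preim.
      by have /eqP-> : quo_proj B u == 0 by [rewrite quo_proj0]; exact: mem0v.
    have ZE : (quo_proj B @: (quo_proj B @^-1: Z) = Z)%VS.
      by rewrite lpreimK // limg_quo_proj subvf.
    rewrite -ZE; apply: limgS; apply: subv_trans (capvSl _ A).
    apply: S'min; [exact: rs_cap|exact: capvSr|apply/eqP=> e].
    have le : (\dim (quo_proj B @^-1: Z) <= p)%N.
      by apply: mxB; apply/asboolP; exists (quo_proj B @^-1: Z)%VS; split.
    have PB : (quo_proj B @^-1: Z)%VS = B.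
      by apply/esym/eqP; rewrite eqEdim BP dB.
    case/eqP: Z0; rewrite -ZE PB; apply/eqP; rewrite -subv0; apply/subvP=> _ /memv_imgP[u uB ->].
    by have /eqP-> : quo_proj B u == 0 by [rewrite quo_proj0]; exact: mem0v.
  have dAB := dimv_sum_cap B A; rewrite BA dimv0 addn0 in dAB.
  have ABR : (\dim (B + A) <= \dim {:R})%N by apply/dimvS/subvf.
  have B1 : B != fullv.
    apply: contraNneq A0 => e; by rewrite -(capfv A) -e BA.
  have lem : (\dim {:R} - \dim B <= m)%N.
    by apply: mx; apply/asboolP; exists B, sB; split=> //; right; split.
  have AB1 : (B + A = fullv)%VS.
    apply/eqP; rewrite eqEdim subvf andTb; move: dAB lem dA ABR.
    by move: (\dim A) (\dim B) (\dim (B + A)) (\dim {:R}); clear; lia.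
  case: (conv _ _ rB rA BA AB1) => e; last by rewrite e eqxx in A0.
  have A1 : A = fullv by rewrite -AB1 e add0v.
  move=> X Y rX rY; have hi := sub_incl_hom sA.
  have := cA _ _ (rs_preim acQ aff rmA rR hi rX) (rs_preim acQ aff rmA rR hi rY).
  have E (X' Y' : {vspace R}) :
      (sub_incl sA @^-1: X' <= sub_incl sA @^-1: Y')%VS -> (X' <= Y')%VS.
    move=> XY; apply/subvP=> u uX; have uA : u \in A by rewrite A1 memvf.
    have : vsproj A u \in (sub_incl sA @^-1: X')%VS by rewrite -memv_preim sub_inclE vsprojK.
    by move/(subvP XY); rewrite -memv_preim sub_inclE vsprojK.
  by case/orP=> /E->; rewrite ?orbT.
have rqA := reg_quomod acQ aff sA rR rA; have hq := quo_proj_hom sA.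
(* Dually, B is minimal with A + B = R. Then B has a simple top, so it is uniserial, and dim B <=
   dim R / A makes the sum direct. *)
pose goodB n := `[< exists B : {vspace R}, [/\ rs B, (A + B = fullv)%VS & \dim B = n] >].
have exB : exists n, goodB n.
  exists (\dim {:R}); apply/asboolP; exists fullv.
  by split; [exact: rs_full|exact: addvf|].
case: (ex_minnP exB) => p /asboolP[B [rB AB dB]] mnB.
have sB := rs_sub rB; have rmB := reg_submod acQ aff sB rR rB.
have [W [rW W1 mW] AW] := coatom_ex rA A1.
have Wmax (Z : {vspace R}) : rs Z -> (A <= Z)%VS -> Z != fullv -> (Z <= W)%VS.
  move=> rZ AZ Z1.
  have := cA _ _ (rs_img acQ aff rR rqA hq rW) (rs_img acQ aff rR rqA hq rZ).
  have E (X Y : {vspace R}) : (A <= Y)%VS -> (quo_proj A @: X <= quo_proj A @: Y)%VS -> (X <= Y)%VS.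
    move=> AY XY; apply/subvP=> u uX; have /(subvP XY)/memv_imgP[v vY e] := memv_img (quo_proj A) uX.
    have : u - v \in A by rewrite -quo_proj0 linearB /= e subrr.
    by move/(subvP AY) => h; rewrite -(subrK v u) memvD.
  case/orP=> /E; last by apply.
  move/(_ AZ) => WZ; case: (mW _ rZ WZ) => [->//|e].
  by rewrite e eqxx in Z1.
have BA1 (Z : {vspace R}) : rs Z -> (Z <= B)%VS -> Z != B -> (A + Z)%VS != fullv.
  move=> rZ ZB ZnB; apply/eqP=> e; case/eqP: ZnB; apply/eqP; rewrite eqEdim ZB dB /=.
  by apply: mnB; apply/asboolP; exists Z; split.
have hi := sub_incl_hom sB.
have iB : lker (sub_incl sB) == 0%VS by rewrite sub_incl_inj.
have bchain : chain (submod sB).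
  apply: (@top_chain (submod sB) (sub_incl sB @^-1: W)%VS) => //.
  - exact: (rs_preim acQ aff rmB rR hi rW).
  - apply/eqP=> e; case/eqP: W1; apply/eqP; rewrite eqEsubv subvf -AB subv_add AW /=.
    apply/subvP=> u uB; have : vsproj B u \in (sub_incl sB @^-1: W)%VS by rewrite e memvf.
    by rewrite -memv_preim sub_inclE vsprojK.
  move=> Z rZ Z1; have rI := rs_img acQ aff rmB rR hi rZ.
  have IB : (sub_incl sB @: Z <= B)%VS by rewrite -[X in (_ <= X)%VS](sub_incl_img sB) limgS ?subvf.
  have InB : (sub_incl sB @: Z)%VS != B.
    apply: contra Z1 => /eqP e; by rewrite -(eq_limg_ker0 _ _ iB) e sub_incl_img.
  have := Wmax _ (rs_add acQ aff rR rA rI) (addvSl _ _) (BA1 _ rI IB InB).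
  rewrite subv_add => /andP[_ IW]; apply/subvP=> u uZ; rewrite -memv_preim.
  by apply: (subvP IW); rewrite memv_img.
have dAB := dimv_sum_cap A B; rewrite AB in dAB.
have B0 : B != 0%VS.
  by apply: contra A1 => /eqP e; rewrite -AB e addv0.
have lem : (\dim B <= m)%N.
  by apply: mx; apply/asboolP; exists B, sB; split=> //; left; split.
have AB0 : (A :&: B = 0)%VS.
  apply/eqP; rewrite -dimv_eq0; have : (\dim A <= \dim {:R})%N by apply/dimvS/subvf.
  move: dAB lem dA; move: (\dim A) (\dim B) (\dim (A :&: B)) (\dim {:R}); clear; lia.
case: (conv _ _ rA rB AB0 AB) => e; last by rewrite e eqxx in B0.
move=> X Y rX rY.
have := cA _ _ (rs_img acQ aff rR rqA hq rX) (rs_img acQ aff rR rqA hq rY).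
have E (X' Y' : {vspace R}) : (quo_proj A @: X' <= quo_proj A @: Y')%VS -> (X' <= Y')%VS.
  move=> XY; apply/subvP=> u uX; have /(subvP XY)/memv_imgP[v vY e'] := memv_img (quo_proj A) uX.
  have : u - v \in A by rewrite -quo_proj0 linearB /= e' subrr.
  by rewrite e memv0 subr_eq0 => /eqP->.
by case/orP=> /E->; rewrite ?orbT.
Qed.

End Uniserial.

(** * Preprojective modules of defect -1 *)

(** A division algebra of endomorphisms, encoded as a subspace of End(U). *)
Definition divspace (k : fieldType) (U : vectType k) (D : {vspace 'End(U)}) :=
  [/\ \1%VF \in D, forall f g, f \in D -> g \in D -> (f \o g)%VF \in D &
      forall f, f \in D -> f != 0 -> lker f = 0%VS].

Definition stable (k : fieldType) (U : vectType k) (D : {vspace 'End(U)}) (X : {vspace U}) :=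
  forall f u, f \in D -> u \in X -> f u \in X.

(** X is a vector space over D. A maximal stable subspace Y whose dimension is a multiple of dim D
    could be enlarged by a line D u, which meets Y in 0 and has dimension dim D. *)
Lemma divspace_dvd (k : fieldType) (U : vectType k) (D : {vspace 'End(U)}) (X : {vspace U}) :
  divspace D -> stable D X -> (\dim D %| \dim X)%N.
Proof.
move=> [D1 DM Dinj] sX.
pose good n := `[< exists Y : {vspace U},
  [/\ (Y <= X)%VS, stable D Y, (\dim D %| \dim Y)%N & \dim Y = n] >].
have ex : exists n, good n.
  exists 0%N; apply/asboolP; exists 0%VS; rewrite dimv0 dvdn0 sub0v; split=> // f u _.
  by rewrite memv0 => /eqP->; rewrite linear0 mem0v.
have bd n : good n -> (n <= \dim X)%N by move/asboolP=> [Y [YX _ _ <-]]; exact: dimvS.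
case: (ex_maxnP ex bd) => m /asboolP[Y [YX sY dY Ym]] mx.
suff -> : X = Y by [].
apply/eqP; rewrite eqEsubv YX andbT; apply/subvP=> u uX; apply: contraT => uY.
have u0 : u != 0 by apply: contraNneq uY => ->; exact: mem0v.
have lin : linear (fun f : 'End(U) => f u).
  by move=> c f g; rewrite add_lfunE scale_lfunE.
pose Du := (linfun (fun f : 'End(U) => f u) @: D)%VS.
have DuP w : w \in Du <-> exists2 f, f \in D & f u = w.
  split=> [/memv_imgP[f fD ->]|[f fD <-]]; first by exists f; rewrite ?linfun_id.
  by apply/memv_imgP; exists f; rewrite ?linfun_id.
have finj f : f \in D -> f u = 0 -> f = 0.
  move=> fD fu; apply/eqP; apply: contraNT u0 => f0.
  by apply/eqP/(lker0_inj (Dinj f fD f0)); rewrite fu linear0.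
have dDu : \dim D = \dim Du by apply: dim_bij lin finj DuP.
have cap0 : (Y :&: Du = 0)%VS.
  apply/eqP; rewrite -subv0; apply/subvP=> w; rewrite memv_cap memv0 => /andP[wY /DuP[f fD fu]].
  apply: contraNT uY => w0; have f0 : f != 0 by apply: contraNneq w0 => e; rewrite -fu e zero_lfunE.
  have fi := Dinj f fD f0.
  have fY : (f @: Y)%VS = Y.
    apply/eqP; rewrite eqEdim (limg_dim_eq _) ?fi ?capv0 // leqnn andbT.
    by apply/subvP=> _ /memv_imgP[y yY ->]; exact: sY.
  move: wY; rewrite -{1}fY -fu => /memv_imgP[y yY /(lker0_inj fi) e]; by rewrite e.
have : (\dim (Y + Du) <= m)%N.
  apply: mx; apply/asboolP; exists (Y + Du)%VS; split=> //.
  - rewrite subv_add YX; apply/subvP=> w /DuP[f fD <-]; exact: sX.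
  - move=> f w fD /memv_addP[y yY [w' /DuP[g gD <-] ->]]; rewrite linearD /=.
    apply: memv_add; [exact: sY|apply/DuP; exists (f \o g)%VF; [exact: DM|]].
    by rewrite comp_lfunE.
  - by rewrite dimv_disjoint_sum // -dDu dvdn_addl.
rewrite dimv_disjoint_sum // -Ym -[X in (_ <= X)%N]addn0 leq_add2l leqn0 dimv_eq0 => /eqP Du0.
have : u \in Du by apply/DuP; exists \1%VF; rewrite ?id_lfunE.
by rewrite Du0 memv0 (negPf u0).
Qed.

Section DefectOne.
Variables (k : fieldType) (Q : quiver).
Hypothesis acQ : acyclic Q.
Variable d : {ffun vtx Q -> int}.
Hypothesis aff : affine d.
Implicit Types A B E L M N P : kQmodule k Q.
Local Notation def := (def d).

Lemma euler_dvd (n : nat) (x : {ffun vtx Q -> int}) :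
  (forall i, (n%:Z %| x i)%Z) -> (n%:Z %| euler d x)%Z.
Proof.
move=> h; rewrite /euler; apply: rpredB; apply: rpred_sum => i _; exact: dvdz_mull.
Qed.

Lemma divspace_sdef M (D : {vspace 'End(M)}) (X : {vspace M}) :
  divspace D -> (forall f, f \in D -> is_hom f) -> stable D X ->
  ((\dim D)%:Z %| sdef d X)%Z.
Proof.
move=> dD hD sX; apply: euler_dvd => i; rewrite ffunE.
apply: (divspace_dvd dD) => f _ fD /memv_imgP[u uX ->].
by rewrite (hom_idem _ _ (hD f fD)) memv_img // sX.
Qed.

Lemma homs_divspace M : (forall f : 'End(M), is_hom f -> f <> 0 -> lker f = 0%VS) ->
  divspace (homs M M).
Proof.
move=> h; split=> [|f g|f]; rewrite !mem_homs; first exact: hom_id.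
  by move=> hf hg; exact: hom_comp hg hf.
by move=> hf /eqP; exact: h.
Qed.

(** Kernel and image both lie in [pp]; if both were nonzero, their defects would add up to at most
    -2. *)
Lemma defm1_inj M N (f : 'Hom(M, N)) : pp M -> pp N -> def M = -1 -> is_hom f -> f <> 0 ->
  lker f = 0%VS.
Proof.
move=> pM pN dM hf f0; have sK := submod_ker hf; have sI := submod_img hf (submod_full M).
have := sdef_img d hf (submod_full M); rewrite sdef_full capfv (sdefE d sK) (sdefE d sI) dM.
have := pp_def_lt0 acQ aff (pp_sub sI pN); have := pp_def_lt0 acQ aff (pp_sub sK pM).
case: (pselect (is_zero (submod sK))) => [z _ _ _|nz /(_ nz) h1 h2 h3].
  by apply/eqP; rewrite -dimv_eq0; move: z; rewrite /is_zero dimvf => /eqP.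
have : ~ is_zero (submod sI).
  rewrite /is_zero dimvf => /eqP; rewrite [dim _]/(\dim (limg f)) dimv_eq0 => /eqP z.
  apply: f0; apply/lfunP=> u; rewrite zero_lfunE; apply/eqP; rewrite -memv0 -z.
  by rewrite memv_img ?memvf.
move/h2 => h4; move: h1 h3 h4; move: (def (submod sK)) (def (submod sI)) => x y; lia.
Qed.

(** End P is a division algebra acting on P, so its dimension divides the defect -1. *)
Lemma defm1_end P : pp P -> def P = -1 -> hom P P = 1%N.
Proof.
move=> pP dP; have dD : divspace (homs P P).
  by apply: homs_divspace => f hf f0; exact: (defm1_inj pP pP dP hf f0).
have := @divspace_sdef P (homs P P) fullv dD.
rewrite sdef_full dP -/(hom P P) => h.
have : ((hom P P)%:Z %| -1)%Z.
  by apply: h => [f|f u _ _]; rewrite ?mem_homs ?memvf.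
by rewrite dvdzE /= dvdn1 => /eqP.
Qed.

(** The translate of f embeds tau M into its own translate, so tau M = 0 by induction on the
    exponent, and M embeds into tau M. *)
Lemma pp_tau_inj M (f : 'Hom(M, tau M)) : pp M -> is_hom f -> lker f = 0%VS -> is_zero M.
Proof.
move=> [n]; elim: n M f => [|n IH] M f z hf fi; first exact: z.
apply: (zero_inj fi); apply: (IH _ (tau_map f)); [by rewrite -iterSr|exact: tau_map_hom|exact: tau_map_inj].
Qed.

Lemma defm1_nz P : def P = -1 -> ~ is_zero P.
Proof. by move=> dP z; have := def_zero d z; rewrite dP. Qed.

(** A nonzero map B -> tau A would be injective and, composed with f, would embed A into tau A. *)
Lemma defm1_ext A B (f : 'Hom(A, B)) : pp A -> pp B -> def A = -1 -> def B = -1 ->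
  is_hom f -> lker f = 0%VS -> hom B (tau A) = 0%N.
Proof.
move=> pA pB dA dB hf fi; apply/hom_eq0 => g hg; apply: contrapT => g0.
apply: (defm1_nz dA); have gi := defm1_inj pB (pp_tau' pA) dB hg g0.
apply: (@pp_tau_inj _ (g \o f)%VF pA (hom_comp hf hg)).
by apply: lker0_intro => u; rewrite comp_lfunE => h; apply: (lker0_inj fi);
  apply: (lker0_inj gi); rewrite h !linear0.
Qed.

Lemma defm1_euler P : pp P -> def P = -1 -> euler (dimvec P) (dimvec P) = 1.
Proof.
move=> pP dP; rewrite -(euler_formula acQ) (defm1_end pP dP).
rewrite (@defm1_ext P P \1%VF) ?hom_id ?subr0 //.
by apply: lker0_intro => u; rewrite id_lfunE.
Qed.

Lemma affine_dd : euler d d = 0.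
Proof. case: aff => _ s _ _; have := s d; lia. Qed.

(* The generic module of dimension x has no torsion. *)
Lemma pp_ex (x : {ffun vtx Q -> int}) : (forall i, 0 <= x i) -> euler x x = 1 ->
  euler d x = -1 -> exists L : kQmodule k Q, pp L /\ dimvec L = x.
Proof.
move=> x0 qx dx; pose good n := `[< exists M : kQmodule k Q, dimvec M = x /\ hom M M = n >].
have ex : exists n, good n.
  by have [M dM] := @module_ex k Q x x0; exists (hom M M); apply/asboolP; exists M.
case: (ex_minnP ex) => m /asboolP[M [dM hM]] mn.
have [A [B [tA pB iM]]] := torsion_split acQ M.
have dAB : x = dimvec A + dimvec B.
  by rewrite -dM -(dimvec_isom iM) (dimvec_ses (dsum_ses A B)).
(* M has an endomorphism space of minimal dimension. A nonsplit extension E of A by B has a smaller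
   one than A (+) B: the identity of B does not extend to E, which makes one of the Hom inequalities
   strict. *)
have e0 : hom B (tau A) = 0%N.
  apply/eqP; rewrite -leqn0 leqNgt; apply/negP=> /(nonsplit_ext acQ).
  case=> E [f [g [[hf hg fi fg gs] ns]]].
  have ses : short_exact B E A by exists f, g.
  have : (m <= hom E E)%N.
    by apply: mn; apply/asboolP; exists E; rewrite (dimvec_ses ses) dAB addrC.
  have hMM : m = (hom A A + hom B A + (hom A B + hom B B))%N.
    by rewrite -hM -(hom_isom_l _ iM) -(hom_isom_r _ iM) hom_dsum_r !hom_dsum_l.
  have := hom_ses_r E ses; have := hom_ses_l A ses.
  have [I eI IP] := hom_ses_l_gen B hf hg gs fg.
  have lt : (\dim I < hom B B)%N.
    rewrite ltnNge; apply/negP=> le.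
    have sub : (I <= homs B B)%VS.
      by apply/subvP=> h /IP[h' hh' <-]; rewrite mem_homs (hom_comp hf hh').
    have : \1%VF \in I.
      have /eqP-> : I == homs B B by rewrite eqEdim sub.
      by rewrite mem_homs hom_id.
    case/IP=> r hr /lfunP e; apply: (ns r hr) => u.
    by have := e u; rewrite comp_lfunE id_lfunE.
  move: eI lt hMM; move: (hom E E) (hom E A) (hom E B) (hom A A) (hom A B) (hom B A) (hom B B).
  by clear; move: (\dim I); lia.
have hAB : hom A B = 0%N by exact: tA.
have qA := euler_formula acQ A B; have qB := euler_formula acQ B A.
rewrite e0 hAB subrr in qA; rewrite (ext_pp_tor pB tA) subr0 in qB.
move: qx dx; rewrite dAB eulerDl !eulerDr -qA -qB => qx dx.
have dA := tor_def_ge0 acQ aff tA; rewrite /def in dA.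
case: (aff) => dpos dsym qpos qz.
have qA0 := qpos (dimvec A); have qB0 := qpos (dimvec B).
have qBn : euler (dimvec B) (dimvec B) <> 0.
  move/qz=> [t eB]; move: dx; rewrite eB eulerZr affine_dd mulr0.
  by move: dA; move: (euler d (dimvec A)); lia.
(* 1 = q(x) is the sum of q(A), q(B) and hom(B, A), all nonnegative, and q(B) is positive because B
   has nonzero defect. *)
have [qA1 hBA] : euler (dimvec A) (dimvec A) = 0 /\ hom B A = 0%N.
  move: qA0 qB0 qBn qx; clear; move: (hom B A) (euler (dimvec A) _) (euler (dimvec B) _); lia.
have [t eA] := qz _ qA1.
have t0 : t = 0.
  move: qB; rewrite hBA eA eulerZr => /esym/eqP; rewrite mulf_eq0 => /orP[/eqP//|/eqP h].
  move: dx; rewrite [euler d (dimvec B)]dsym h eA eulerZr affine_dd mulr0; lia.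
have zA : dimvec A = 0 by rewrite eA t0; apply/ffunP=> i; rewrite !ffunE mul0r.
by exists B; rewrite zA add0r.
Qed.

(** hom(P, L) >= <P, P + d> = <P, P> - def P = 2. *)
Lemma pencil_ex P : pp P -> def P = -1 ->
  exists L : kQmodule k Q, [/\ pp L, dimvec L = dimvec P + d & (2 <= hom P L)%N].
Proof.
move=> pP dP; case: (aff) => dpos dsym _ _.
have Pd : euler (dimvec P) d = 1 by have := dsym (dimvec P); rewrite -[euler d _]/(def P) dP; lia.
have qP := defm1_euler pP dP.
have [||| L [pL dL]] := @pp_ex (dimvec P + d).
- by move=> i; rewrite ffunE dimvecE; have := dpos i; move: (d i) (vdim P i) => u v; lia.
- by rewrite eulerDl !eulerDr qP Pd affine_dd -[euler d _]/(def P) dP.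
- by rewrite eulerDr affine_dd -[euler d _]/(def P) dP.
exists L; split=> //; have := euler_formula acQ P L; rewrite dL eulerDr qP Pd.
move: (hom P L) (hom L _); lia.
Qed.

End DefectOne.

(** * Powers of a module and the action of matrices *)

Section PowerMap.
Variables (k : fieldType) (e : nat).
Implicit Types U V : vectType k.

Definition pmap_fun U V (f : 'Hom(U, V)) (x : {ffun 'I_e -> U}) : {ffun 'I_e -> V} :=
  [ffun j => f (x j)].
Definition pmap U V (f : 'Hom(U, V)) : 'Hom({ffun 'I_e -> U}, {ffun 'I_e -> V}) :=
  linfun (pmap_fun f).

Lemma pmapE U V (f : 'Hom(U, V)) x j : pmap f x j = f (x j).
Proof.
rewrite linfun_id ?ffunE // => c y z; apply/ffunP=> i.
by rewrite !ffunE linearP.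
Qed.

(** Right multiplication of row vectors with entries in U; hence composition reverses the product in
    [mactM]. *)
Definition mact_fun U (n : 'M[k]_e) (x : {ffun 'I_e -> U}) : {ffun 'I_e -> U} :=
  [ffun j => \sum_i n i j *: x i].
Definition mact U (n : 'M[k]_e) : 'End({ffun 'I_e -> U}) := linfun (@mact_fun U n).

Lemma mactE U n (x : {ffun 'I_e -> U}) j : mact U n x j = \sum_i n i j *: x i.
Proof.
rewrite linfun_id ?ffunE // => c y z; apply/ffunP=> i.
rewrite !ffunE scaler_sumr -big_split /=; apply: eq_bigr => l _.
by rewrite !ffunE scalerDr !scalerA mulrC.
Qed.

Lemma mact_linear U : linear (@mact U).
Proof.
move=> c n n'; apply/lfunP=> x; apply/ffunP=> j; rewrite add_lfunE scale_lfunE !ffunE.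
rewrite !mactE scaler_sumr -big_split /=; apply: eq_bigr => l _.
by rewrite !mxE scalerDl scalerA.
Qed.

Lemma mactM U n n' : (mact U n \o mact U n')%VF = mact U (n' *m n).
Proof.
apply/lfunP=> x; apply/ffunP=> j; rewrite comp_lfunE !mactE.
under eq_bigr do rewrite mactE scaler_sumr.
rewrite exchange_big /=; apply: eq_bigr => i _.
rewrite mxE scaler_suml; apply: eq_bigr => l _.
by rewrite scalerA mulrC.
Qed.

Lemma mact1 U : mact U 1%:M = \1%VF.
Proof.
apply/lfunP=> x; apply/ffunP=> j; rewrite mactE id_lfunE (bigD1 j) //= big1 ?addr0.
  by rewrite mxE eqxx scale1r.
by move=> i ij; rewrite mxE (negPf ij) scale0r.
Qed.

Lemma mact_pmap U V (f : 'Hom(U, V)) n x : pmap f (mact U n x) = mact V n (pmap f x).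
Proof.
apply/ffunP=> j; rewrite pmapE !mactE linear_sum /=; apply: eq_bigr => i _.
by rewrite linearZ /= pmapE.
Qed.

Definition psingle_fun U (i : 'I_e) (u : U) : {ffun 'I_e -> U} := [ffun j => (j == i)%:R *: u].
Definition psingle U (i : 'I_e) : 'Hom(U, {ffun 'I_e -> U}) := linfun (@psingle_fun U i).

Lemma psingleE U i (u : U) j : psingle U i u j = (j == i)%:R *: u.
Proof.
rewrite linfun_id ?ffunE // => c y z; apply/ffunP=> l.
by rewrite !ffunE scalerDr !scalerA mulrC.
Qed.

Lemma psingle_sum U (x : {ffun 'I_e -> U}) : x = \sum_i psingle U i (x i).
Proof.
apply/ffunP=> j; rewrite sum_ffunE (bigD1 j) //= big1 ?addr0.
  by rewrite psingleE eqxx scale1r.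
by move=> i ij; rewrite psingleE eq_sym (negPf ij) scale0r.
Qed.

Lemma mact_psingle U n i (u : U) : mact U n (psingle U i u) = [ffun j => n i j *: u].
Proof.
apply/ffunP=> j; rewrite mactE ffunE (bigD1 i) //= big1 ?addr0.
  by rewrite psingleE eqxx scale1r.
by move=> l li; rewrite psingleE (negPf li) scale0r scaler0.
Qed.

End PowerMap.

Section PowerModule.
Variables (k : fieldType) (Q : quiver).
Implicit Types L M N : kQmodule k Q.

Section Power.
Variables (e : nat) (M : kQmodule k Q).

Lemma power_idemM i j : (pmap e (idem M i) \o pmap e (idem M j))%VF =
  if i == j then pmap e (idem M i) else 0.
Proof.
apply/lfunP=> x; apply/ffunP=> l; rewrite comp_lfunE !pmapE idem_app.
by case: eqP => _; rewrite ?pmapE // zero_lfunE ffunE.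
Qed.

Lemma power_idem_sum : \sum_i pmap e (idem M i) = \1%VF.
Proof.
apply/lfunP=> x; apply/ffunP=> l; rewrite sum_lfunE id_lfunE sum_ffunE.
by under eq_bigr do rewrite pmapE; rewrite idem_sum_app.
Qed.

Lemma power_arrowE a : pmap e (arrow M a) =
  (pmap e (idem M (tgt a)) \o pmap e (arrow M a) \o pmap e (idem M (src a)))%VF.
Proof.
by apply/lfunP=> x; apply/ffunP=> l; rewrite !comp_lfunE !pmapE arrow_app.
Qed.

Definition power : kQmodule k Q := KQModule power_idemM power_idem_sum power_arrowE.

Lemma power_idemE i (x : power) j : (idem power i x : {ffun _}) j = idem M i (x j).
Proof. exact: pmapE. Qed.

Lemma power_aE a (x : power) j : (arrow power a x : {ffun _}) j = arrow M a (x j).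
Proof. exact: pmapE. Qed.

Lemma vdim_power i : vdim power i = (e * vdim M i)%N.
Proof.
rewrite /vdim (@dim_family _ _ _ (fun=> limg (idem M i))).
  by rewrite sum_nat_const card_ord.
move=> x; split=> [/memv_imgP[y _ ->] j|h].
  by rewrite power_idemE memv_img ?memvf.
apply/memv_imgP; exists x; rewrite ?memvf //; apply/ffunP=> j; rewrite power_idemE.
by have /memv_imgP[u _ ->] := h j; rewrite idem_app eqxx.
Qed.

Lemma dimvec_power : dimvec power = vscale e%:Z (dimvec M).
Proof. by apply/ffunP=> i; rewrite dimvecE [RHS]ffunE dimvecE vdim_power PoszM. Qed.

Lemma mact_hom n : is_hom (mact M n : 'Hom(power, power)).
Proof.
apply/is_homP; split=> [i x|a x]; apply/ffunP=> j; rewrite ?power_idemE ?power_aE !mactE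
  linear_sum; apply: eq_bigr => l _; by rewrite ?power_idemE ?power_aE linearZ.
Qed.

Lemma psingle_hom i : is_hom (psingle M i : 'Hom(M, power)).
Proof.
by apply/is_homP; split=> [l x|a x]; apply/ffunP=> j; rewrite ?power_idemE ?power_aE !psingleE
  linearZ.
Qed.

End Power.

Lemma pmap_hom e M N (f : 'Hom(M, N)) : is_hom f ->
  is_hom (pmap e f : 'Hom(power e M, power e N)).
Proof.
move=> hf; apply/is_homP; split=> [l x|a x]; apply/ffunP=> j;
rewrite ?power_idemE ?power_aE !pmapE ?power_idemE ?power_aE;
[exact: hom_idem | exact: hom_arrow].
Qed.

Lemma power_pp e M : pp M -> pp (power e M).
Proof.
move=> pM; elim: e => [|e IH].
  apply: pp_zero; apply/is_zeroP=> x; apply/ffunP=> -[j jl]; by [].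
pose f : 'Hom(M, power e.+1 M) := psingle M ord0.
pose g0 (x : power e.+1 M) : power e M := [ffun j => (x : {ffun _}) (lift ord0 j)].
have g0l : linear g0 by move=> c x y; apply/ffunP=> j; rewrite !ffunE.
pose g := linfun g0; have gE x j : (g x : {ffun _}) j = (x : {ffun _}) (lift ord0 j).
  by rewrite linfun_id // ffunE.
apply: (pp_ext (f := f) (g := g)) pM IH.
- exact: psingle_hom.
- apply/is_homP; split=> [i x|a x]; apply/ffunP=> j;
  by rewrite ?power_idemE ?power_aE !gE ?power_idemE ?power_aE.
- apply: lker0_intro => u /ffunP/(_ ord0); rewrite psingleE eqxx scale1r => ->.
  by rewrite ffunE.
apply/vspaceP=> x; rewrite memv_ker; apply/memv_imgP/eqP.
  case=> u _ ->; apply/ffunP=> j; rewrite gE psingleE ffunE.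
  by rewrite eq_sym (negPf (neq_lift _ _)) scale0r.
move=> gx; exists ((x : {ffun _}) ord0); rewrite ?memvf //; apply/ffunP=> j.
rewrite psingleE; case: (unliftP ord0 j) => [l ->|->]; last by rewrite eqxx scale1r.
rewrite eq_sym (negPf (neq_lift _ _)) scale0r -gE gx; by rewrite ffunE.
Qed.

End PowerModule.

(** * The commutant of an irreducible matrix *)

Section Commutant.
Variables (k : fieldType) (e : nat) (m : 'M[k]_e).

Definition irr := forall X : {vspace 'rV[k]_e},
  (forall u, u \in X -> u *m m \in X) -> X <> 0%VS -> X = fullv.

Lemma comm_lin c (n n' : 'M[k]_e) : n *m m = m *m n -> n' *m m = m *m n' ->
  (c *: n + n') *m m = m *m (c *: n + n').
Proof. by move=> h h'; rewrite mulmxDl mulmxDr -scalemxAl -scalemxAr h h'. Qed.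

Definition commutant : {vspace 'M[k]_e} :=
  sval (@vspace_ex k 'M[k]_e (fun n => n *m m = m *m n)
    (etrans (mul0mx _ _) (esym (mulmx0 _ _))) comm_lin).

Lemma commutantP n : n \in commutant <-> n *m m = m *m n.
Proof. exact: (svalP (@vspace_ex k 'M[k]_e _ _ _)). Qed.

Hypothesis irrm : irr.

(** Schur's lemma: the rows killed by n form an m-stable subspace. *)
Lemma commutant_unit n : n \in commutant -> n != 0 -> n \in unitmx.
Proof.
move/commutantP=> nm n0; rewrite -row_free_unit -kermx_eq0; apply: contraNT n0 => ker0.
have [||X XP] := @vspace_ex k 'rV[k]_e (fun u => u *m n = 0); first exact: mul0mx.
  by move=> c u v hu hv; rewrite mulmxDl -scalemxAl hu hv scaler0 addr0.
have XF : X = fullv.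
  apply: irrm => [u /XP un|X0]; first by apply/XP; rewrite -mulmxA -nm mulmxA un mul0mx.
  case/negP: ker0; apply/eqP/row_matrixP=> i; rewrite row0.
  have : row i (kermx n) \in X by apply/XP; rewrite -row_mul mulmx_ker row0.
  by rewrite X0 memv0 => /eqP.
apply/eqP/row_matrixP=> i; rewrite row0 rowE; apply/XP; by rewrite XF memvf.
Qed.

(** For a nonzero row v, the rows v n with n in the commutant form an m-stable subspace containing
    v, hence everything. *)
Lemma commutant_dim : (0 < e)%N -> (e <= \dim commutant)%N.
Proof.
move=> e0; pose v : 'rV[k]_e := delta_mx 0 (Ordinal e0).
have v0 : v != 0.
  by apply/eqP=> /matrixP/(_ 0 (Ordinal e0)); rewrite !mxE !eqxx => /eqP; rewrite oner_eq0.
have lin : linear (fun n : 'M[k]_e => v *m n).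
  by move=> c n n'; rewrite mulmxDr -scalemxAr.
pose X := (linfun (fun n : 'M[k]_e => v *m n) @: commutant)%VS.
have XF : X = fullv.
  apply: irrm => [u /memv_imgP[n nC ->]|X0].
    apply/memv_imgP; exists (n *m m); last by rewrite !linfun_id // mulmxA.
    by apply/commutantP; move/commutantP: nC => h; rewrite {1}h mulmxA.
  have : v \in X.
    by apply/memv_imgP; exists 1%:M; rewrite ?linfun_id ?mulmx1 //; apply/commutantP;
      rewrite mul1mx mulmx1.
  by rewrite X0 memv0 (negPf v0).
have dX : \dim X = e by rewrite XF dimvf /dim /= mul1n.
by rewrite -[leqLHS]dX -(limg_ker_dim (linfun (fun n : 'M[k]_e => v *m n)) commutant) leq_addl.
Qed.

Lemma commutant1 : 1%:M \in commutant.
Proof. by apply/commutantP; rewrite mul1mx mulmx1. Qed.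

Lemma commutantM n n' : n \in commutant -> n' \in commutant -> n *m n' \in commutant.
Proof.
move=> /commutantP h /commutantP h'; apply/commutantP.
by rewrite -mulmxA h' !mulmxA h.
Qed.

Definition mspace (U : vectType k) : {vspace 'End({ffun 'I_e -> U})} :=
  (linfun (@mact k e U) @: commutant)%VS.

Lemma mspaceP U f : f \in mspace U <-> exists2 n, n \in commutant & f = mact U n.
Proof.
split=> [/memv_imgP[n nC ->]|[n nC ->]].
  by exists n => //; rewrite linfun_id //; exact: mact_linear.
by apply/memv_imgP; exists n; rewrite ?linfun_id //; exact: mact_linear.
Qed.

Lemma mact_inj0 n (U : vectType k) : n \in commutant -> n != 0 -> lker (mact U n) = 0%VS.
Proof.
move=> nC n0; have nu := commutant_unit nC n0; apply: lker0_intro => x h.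
have : (mact U (invmx n) \o mact U n)%VF x = 0 by rewrite comp_lfunE h linear0.
by rewrite mactM mulmxV // mact1 id_lfunE.
Qed.

Lemma mspace_div (U : vectType k) : divspace (mspace U).
Proof.
split=> [|f g /mspaceP[n nC ->] /mspaceP[n' nC' ->]|f /mspaceP[n nC ->] f0].
- by apply/mspaceP; exists 1%:M; [exact: commutant1 | rewrite mact1].
- by apply/mspaceP; exists (n' *m n); [exact: commutantM | rewrite mactM].
apply: mact_inj0 => //; apply: contraNneq f0 => ->.
apply/eqP/lfunP=> x; apply/ffunP=> j; rewrite mactE zero_lfunE ffunE big1 // => i _.
by rewrite mxE scale0r.
Qed.

Lemma mspace_dim (U : vectType k) (u : U) : u != 0 -> (0 < e)%N -> (e <= \dim (mspace U))%N.
Proof.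
move=> u0 e0; apply: leq_trans (commutant_dim e0) _.
apply: (dim_inj (f := @mact k e U)) => [|n nC n0|n nC]; first exact: mact_linear.
  apply/matrixP=> i j; have := congr1 (fun f : 'End({ffun 'I_e -> U}) => (f (psingle U i u) : {ffun 'I_e -> U}) j) n0.
  rewrite mact_psingle ffunE zero_lfunE ffunE mxE => /eqP.
  by rewrite scaler_eq0 (negPf u0) orbF => /eqP.
by apply/mspaceP; exists n.
Qed.

End Commutant.

(** * Covers of the regular simple modules *)

Import VectorInternalTheory.

Lemma neg_mul_le (t : int) (n e : nat) : t * n%:Z < 0 -> (e <= n)%N -> t * n%:Z <= - e%:Z.
Proof.
move=> h le; have t1 : t <= -1 by case: (lerP 0 t) => t0; [have := mulr_ge0 t0 (isT : 0 <= n%:Z); lia | lia].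
by apply: le_trans (ler_wpM2r _ t1) _ => //; rewrite mulN1r lerN2 lez_nat.
Qed.

Section Pencil.
Variables (k : fieldType) (Q : quiver).
Hypothesis acQ : acyclic Q.
Variable d : {ffun vtx Q -> int}.
Hypothesis aff : affine d.
Local Notation def := (def d).
Local Notation rs := (rs d).
Local Notation rsimple := (rsimple d).
Variables P L : kQmodule k Q.
Hypotheses (pP : pp P) (dP : def P = -1) (pL : pp L) (dL : dimvec L = dimvec P + d).
Implicit Types C M N R S T : kQmodule k Q.

Lemma pp_hom_tor M N : pp M -> tor N -> (hom M N)%:Z = euler (dimvec M) (dimvec N).
Proof. by move=> pM tN; rewrite -(euler_formula acQ) (ext_pp_tor pM tN) subr0. Qed.

Lemma hom_pencil T : reg T -> hom L T = hom P T.
Proof.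
move=> rT; apply/eqP; rewrite -eqz_nat (pp_hom_tor pL rT.1) (pp_hom_tor pP rT.1) dL eulerDl.
by rewrite -[euler d _]/(def T) (reg_def acQ aff rT) addr0.
Qed.

Definition indep (a b : 'Hom(P, L)) := forall c c', c *: a + c' *: b = 0 -> c = 0 /\ c' = 0.

(** c embeds W into Hom(L, T), and on W precomposition with b is f followed by precomposition with
    a. So f plays the part of an eigenvalue of the pencil spanned by a and b. *)
Definition datum T (a b : 'Hom(P, L)) (W : vectType k) (c : 'Hom(W, 'Hom(L, T))) (f : 'End(W)) :=
  [/\ is_hom a /\ is_hom b, indep a b, lker c = 0%VS,
      forall u, is_hom (c u) & forall u, (c u \o b)%VF = (c (f u) \o a)%VF].

(** If a nonzero w satisfies w a = 0, exchange a and b and take the line of w with f = 0. Otherwise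
    precomposition with a is an isomorphism from Hom(L, T) to Hom(P, T), by [hom_pencil], and f is
    its inverse after precomposition with b. *)
Lemma datum_ex T (a b : 'Hom(P, L)) : rsimple T -> (0 < hom P T)%N ->
  is_hom a -> is_hom b -> indep a b ->
  exists a b (W : vectType k) c f, (0 < dim W)%N /\ @datum T a b W c f.
Proof.
move=> [rT _ _] hT ha hb iab.
case: (pselect (exists w : 'Hom(L, T), [/\ is_hom w, w <> 0 & (w \o a)%VF = 0])).
  case=> w [hw w0 wa].
  have lin : linear (fun t : k^o => t *: w) by move=> s t u; rewrite scalerDl scalerA.
  exists b, a, k^o, (linfun (fun t : k^o => t *: w)), 0; split; first by rewrite /dim.
  split=> //.
  - by move=> s s' h; have [] := iab s' s; [rewrite addrC | move=> -> ->].
  - apply: lker0_intro => t; rewrite linfun_id // => /eqP; rewrite scaler_eq0.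
    by case/orP=> /eqP.
  - by move=> t; rewrite linfun_id // -mem_homs memvZ // mem_homs.
  by move=> t; rewrite zero_lfunE !linfun_id // scale0r comp_lfun0l -comp_lfunZl wa scaler0.
move=> na; pose W := subvs_of (homs L T).
pose c : 'Hom(W, 'Hom(L, T)) := linfun vsval; have cE u : c u = vsval u by rewrite lfunE.
have la : linear (fun u : W => (vsval u \o a)%VF).
  by move=> t u v; rewrite linearP comp_lfunDl comp_lfunZl.
have lb : linear (fun u : W => (vsval u \o b)%VF).
  by move=> t u v; rewrite linearP comp_lfunDl comp_lfunZl.
have hW (u : W) : is_hom (vsval u) by rewrite -mem_homs subvsP.
pose A := linfun (fun u : W => (vsval u \o a)%VF); pose B := linfun (fun u : W => (vsval u \o b)%VF).
have AE u : A u = (vsval u \o a)%VF by rewrite linfun_id.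
have BE u : B u = (vsval u \o b)%VF by rewrite linfun_id.
have Ai : lker A = 0%VS.
  apply: lker0_intro => u; rewrite AE => h; apply: subvs_inj; rewrite linear0.
  by apply: contrapT => u0; apply: na; exists (vsval u).
have AF : limg A = homs P T.
  apply/eqP; rewrite eqEdim; apply/andP; split.
    by apply/subvP=> _ /memv_imgP[u _ ->]; rewrite AE mem_homs (hom_comp ha (hW u)).
  rewrite limg_dim_eq ?Ai ?capv0 // dimvf; apply: eq_leq.
  by have := hom_pencil rT; rewrite /hom => <-.
exists a, b, W, c, (A^-1 \o B)%VF; split.
  by rewrite (_ : dim W = hom L T) // hom_pencil.
split=> // [|u|u]; rewrite ?cE //.
  by apply: lker0_intro => u; rewrite cE => h; apply: subvs_inj; rewrite h linear0.
rewrite -AE comp_lfunE limg_lfunVK ?BE // AF mem_homs; exact: hom_comp hb (hW u).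
Qed.

(** Take W of minimal dimension: a nonzero f-stable subspace carries a datum again. *)
Lemma irr_datum_ex T (a b : 'Hom(P, L)) : rsimple T -> (0 < hom P T)%N ->
  is_hom a -> is_hom b -> indep a b ->
  exists a b e (m : 'M[k]_e) (c : 'Hom('rV[k]_e, 'Hom(L, T))),
    [/\ (0 < e)%N, irr m & [/\ is_hom a /\ is_hom b, indep a b, lker c = 0%VS,
      forall u, is_hom (c u) & forall u, (c u \o b)%VF = (c (u *m m) \o a)%VF]].
Proof.
move=> sT hT ha hb iab.
pose good n := `[< exists a b (W : vectType k) c f, (0 < dim W)%N /\ dim W = n /\ @datum T a b W c f >].
have ex : exists n, good n.
  have [a' [b' [W [c [f [W0 D]]]]]] := datum_ex sT hT ha hb iab.
  by exists (dim W); apply/asboolP; exists a', b', W, c, f.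
case: (ex_minnP ex) => e /asboolP[a' [b' [W [c [f [e0 [eW [[ha' hb'] iab' ci hc cf]]]]]]]] mn.
rewrite -{}eW in e0 mn *.
have lr : linear (@r2v k W) by move=> t u v; rewrite linearP.
pose r := linfun (@r2v k W); have rE u : r u = r2v u by rewrite linfun_id.
have rK u : r2v (u *m f2mx f) = f (r2v u) by apply: (can_inj v2rK); rewrite v2r_app !r2vK.
exists a', b', (dim W), (f2mx f), (c \o r)%VF; split=> //; last split=> //.
- move=> X sX X0.
  pose c' : 'Hom(subvs_of X, 'Hom(L, T)) := (c \o r \o linfun vsval)%VF.
  have c'E u : c' u = c (r2v (vsval u)) by rewrite !comp_lfunE rE lfunE.
  pose f0 (u : subvs_of X) : subvs_of X := vsproj X (vsval u *m f2mx f).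
  have f0l : linear f0.
    by move=> t u v; rewrite /f0 linearP mulmxDl -scalemxAl linearP.
  apply/eqP; rewrite eqEdim subvf /=; have -> : \dim (fullv : {vspace 'rV[k]_(dim W)}) = dim W.
    by rewrite dimvf /dim /= mul1n.
  apply: mn; apply/asboolP; exists a', b', (subvs_of X), c', (linfun f0); split.
    by rewrite /dim /= lt0n dimv_eq0; apply/eqP.
  split=> //; split=> // [|u|u]; rewrite ?c'E //.
    apply: lker0_intro => u; rewrite c'E => h; apply: subvs_inj; rewrite linear0.
    by apply: (can_inj r2vK); apply: (lker0_inj ci); rewrite h !linear0.
  by rewrite linfun_id // vsprojK ?sX ?subvsP // rK cf.
- apply: lker0_intro => u; rewrite comp_lfunE rE => h.
  by apply: (can_inj r2vK); apply: (lker0_inj ci); rewrite h !linear0.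
- by move=> u; rewrite comp_lfunE.
by move=> u; rewrite !comp_lfunE !rE rK cf.
Qed.

Section Cokernel.
Variables (e : nat) (m : 'M[k]_e) (a b : 'Hom(P, L)).
Hypotheses (e0 : (0 < e)%N) (irrm : irr m) (ha : is_hom a) (hb : is_hom b) (iab : indep a b).

(** This is m (x) a - 1 (x) b, a member of the pencil with a matrix as parameter; for e = 1 it is t
    a - b with a scalar t. *)
Definition theta : 'Hom(power e P, power e L) := (mact L m \o pmap e a - pmap e b)%VF.

Lemma thetaE x : theta x = mact L m (pmap e a x) - pmap e b x.
Proof. by rewrite /theta add_lfunE opp_lfunE comp_lfunE. Qed.

Lemma theta_hom : is_hom theta.
Proof.
rewrite -mem_homs /theta memvB // mem_homs; last exact: pmap_hom.
exact: hom_comp (pmap_hom e ha) (mact_hom L m).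
Qed.

Lemma theta_comm n x : n \in commutant m -> theta (mact P n x) = mact L n (theta x).
Proof.
move/commutantP=> nm; rewrite !thetaE linearB /= !mact_pmap; congr (_ - _).
by rewrite -[LHS]comp_lfunE -[RHS]comp_lfunE !mactM nm.
Qed.

Lemma theta_neq0 : theta <> 0.
Proof.
move=> t0; pose i := Ordinal e0; have : (m i i) *: a + (-1) *: b = 0.
  apply/lfunP=> u; have := congr1 (fun f : 'Hom(power e P, power e L) =>
    (f (psingle P i u) : {ffun 'I_e -> L}) i) t0.
  rewrite thetaE !ffunE mactE (bigD1 i) //= big1 => [|j ji].
    rewrite !pmapE psingleE eqxx scale1r addr0 zero_lfunE ffunE => h.
    by rewrite add_lfunE !scale_lfunE scaleN1r zero_lfunE h.
  by rewrite pmapE psingleE (negPf ji) scale0r linear0 scaler0.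
by case/iab=> _ /eqP; rewrite oppr_eq0 oner_eq0.
Qed.

Let LE := power e L.
Let PE := power e P.
Let ppL : pp LE := power_pp e pL.
Let ppP : pp PE := power_pp e pP.

Lemma dL1 : def L = -1.
Proof. by rewrite /def dL eulerDr (affine_dd aff) addr0. Qed.

Lemma def_power M : def M = -1 -> def (power e M) = - e%:Z.
Proof. by move=> h; rewrite /def dimvec_power eulerZr -[euler d _]/(def M) h mulrN1. Qed.

(* A submodule stable under the commutant has defect divisible by e. *)
Lemma stable_defect M (X : {vspace power e M}) : ~ is_zero M -> pp (power e M) ->
  is_submod X -> stable (mspace m M) X -> X = 0%VS \/ sdef d X <= - e%:Z.
Proof.
move=> nz ppM sX stX; have [u u0] : exists u : M, u != 0.
  apply: contrapT => n; apply: nz; apply/is_zeroP=> u; apply: contrapT => /eqP u0.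
  by apply: n; exists u.
have hD f : f \in mspace m M -> is_hom (f : 'End(power e M)).
  by move/mspaceP=> [n _ ->]; exact: mact_hom.
have /dvdzP[t et] := @divspace_sdef k Q d (power e M) (mspace m M) X (mspace_div irrm M) hD stX.
have dm := mspace_dim irrm u0 e0.
have := pp_def_lt0 acQ aff (pp_sub sX ppM); rewrite -(sdefE d sX).
case: (pselect (is_zero (submod sX))) => [z _|nzX /(_ nzX) lt]; [left|right].
  by apply/eqP; rewrite -dimv_eq0; move: z; rewrite /is_zero dimvf => /eqP.
by rewrite et in lt *; exact: neg_mul_le lt dm.
Qed.

(** The kernel is stable under the commutant. If nonzero, its defect is at most -e, the defect of
    P^e; so the image, a submodule of L^e, has defect at least 0 and vanishes, contrary to
    [theta_neq0]. *)
Lemma theta_inj : lker theta = 0%VS.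
Proof.
have sK := submod_ker theta_hom; have nzP := defm1_nz dP.
have stK : stable (mspace m P) (lker theta).
  move=> f u /mspaceP[n nC ->]; rewrite !memv_ker => /eqP h.
  by rewrite theta_comm // h linear0.
case: (stable_defect nzP ppP sK stK) => // h.
have sI := submod_img theta_hom (submod_full PE).
have := sdef_img d theta_hom (submod_full PE).
rewrite sdef_full capfv (def_power dP) (sdefE d sI) => h'.
case: theta_neq0; have := pp_def_lt0 acQ aff (pp_sub sI ppL).
case: (pselect (is_zero (submod sI))) => [|nz /(_ nz) h'']; last by lia.
rewrite /is_zero dimvf => /eqP; rewrite [dim _]/(\dim (limg theta)) dimv_eq0 => /eqP z _.
by apply/lfunP=> u; rewrite zero_lfunE; apply/eqP; rewrite -memv0 -z memv_img ?memvf.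
Qed.

Lemma theta_sub : is_submod (limg theta : {vspace LE}).
Proof. exact: submod_img theta_hom (submod_full PE). Qed.

Definition coker := quomod theta_sub.
Let p : 'Hom(LE, coker) := quo_proj (limg theta).

Lemma coker_hom : is_hom p. Proof. exact: quo_proj_hom. Qed.
Lemma coker_surj : limg p = fullv. Proof. exact: limg_quo_proj. Qed.
Lemma coker_ker : lker p = limg theta. Proof. exact: lker_quo_proj. Qed.

Lemma coker_ses : short_exact PE LE coker.
Proof.
exists theta, p; split; rewrite ?theta_hom ?theta_inj ?coker_ker ?coker_surj //.
exact: coker_hom.
Qed.

Lemma dimvec_coker : dimvec coker = vscale e%:Z d.
Proof.
have := dimvec_ses coker_ses; rewrite !dimvec_power dL => /ffunP h.
apply/ffunP=> i; have := h i.
have -> : vscale e%:Z (dimvec P + d) i = e%:Z * dimvec P i + e%:Z * d i by rewrite !ffunE mulrDr.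
rewrite [X in _ = X]ffunE [vscale _ (dimvec P) i]ffunE => /addrI <-.
by rewrite [RHS]ffunE.
Qed.

Lemma coker_act n : n \in commutant m ->
  exists2 f : 'End(coker), is_hom f & forall x, f (p x) = p (mact L n x).
Proof.
move=> nC; have hpn := hom_comp (mact_hom L n) coker_hom.
have [|f hf fE] := factor_epi coker_hom coker_surj hpn.
  rewrite coker_ker; apply/subvP=> _ /memv_imgP[x _ ->]; rewrite memv_ker comp_lfunE.
  by rewrite -theta_comm // -memv_ker coker_ker memv_img ?memvf.
by exists f => // x; rewrite fE comp_lfunE.
Qed.

(** The cokernel C has defect 0, so it suffices to show that it is torsion. Let C / X be its
    preprojective quotient: the kernel of L^e -> C / X is nonzero and stable under the commutant, so
    its defect is at most -e, that of L^e. Hence C / X has defect at least 0 and vanishes. *)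
Lemma coker_reg : reg coker.
Proof.
have [X [sX [tX pX]]] := torsion_ses coker.
have d0 : def coker = 0 by rewrite /def dimvec_coker eulerZr (affine_dd aff) mulr0.
apply: (tor_def0_reg acQ aff) => //.
have hq := quo_proj_hom sX; have hpq := hom_comp coker_hom hq.
have sK := submod_ker hpq.
have stK : stable (mspace m L) (lker (quo_proj X \o p)%VF).
  move=> _ u /mspaceP[n nC ->]; rewrite !memv_ker !comp_lfunE !quo_proj0 => uX.
  have [f hf fE] := coker_act nC; rewrite -fE -quo_proj0.
  have z : ((quo_proj X \o f) \o sub_incl sX)%VF = 0.
    have /hom_eq0 := tX _ pX; apply.
    exact: hom_comp (sub_incl_hom sX) (hom_comp hf hq).
  have := congr1 (fun g : 'Hom(submod sX, quomod sX) => g (vsproj X (p u))) z.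
  by rewrite !comp_lfunE sub_inclE vsprojK // zero_lfunE => ->.
have nzL := defm1_nz dL1.
have pqs : limg (quo_proj X \o p)%VF = fullv.
  by rewrite limg_comp coker_surj limg_quo_proj.
have := sdef_img d hpq (submod_full LE).
rewrite sdef_full capfv (def_power dL1) pqs sdef_full => h.
case: (stable_defect nzL ppL sK stK) => [K0|le].
  case: theta_neq0; apply/lfunP=> u; rewrite zero_lfunE; apply/eqP; rewrite -memv0 -K0.
  rewrite memv_ker comp_lfunE; have : theta u \in lker p by rewrite coker_ker memv_img ?memvf.
  by rewrite memv_ker => /eqP->; rewrite linear0.
have zq : is_zero (quomod sX).
  apply: contrapT => nz; have := pp_def_lt0 acQ aff pX nz; move: h le.
  by move: (sdef d (lker _)) (def (quomod sX)) => x y; lia.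
have XF : X = fullv.
  by apply/vspaceP=> u; rewrite memvf -quo_proj0; apply/eqP; exact: ((is_zeroP _).1 zq).
apply: tor_isom tX; exists (sub_incl sX); apply: iso_intro;
  rewrite ?sub_incl_hom ?sub_incl_inj ?sub_incl_img //.
Qed.

Lemma coker_hom_pp : hom P coker = e.
Proof.
apply/eqP; rewrite -eqz_nat (pp_hom_tor pP coker_reg.1) dimvec_coker eulerZr.
by case: aff => _ /(_ (dimvec P)) + _ _; rewrite -[euler d _]/(def P) dP; lia.
Qed.

(** The map is nonzero on some copy of L in L^e, and hom(L, S) = hom(P, S). *)
Lemma coker_quo S (f : 'Hom(coker, S)) : rsimple S -> is_hom f -> f <> 0 -> (0 < hom P S)%N.
Proof.
move=> sS hf f0; have [rS _ _] := sS; rewrite -(hom_pencil rS); apply/hom_gt0.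
have [i fi] : exists i, (f \o p \o psingle L i)%VF <> 0.
  apply: contrapT => n; apply: f0; apply/lfunP=> y; rewrite zero_lfunE.
  have [x <-] := limg_fullP y coker_surj.
  rewrite (psingle_sum x) !linear_sum big1 //= => i _.
  have : (f \o p \o psingle L i)%VF = 0 by apply: contrapT => ni; apply: n; exists i.
  by move/lfunP/(_ (x i)); rewrite !comp_lfunE zero_lfunE.
exists (f \o p \o psingle L i)%VF => //.
exact: hom_comp (psingle_hom L i) (hom_comp coker_hom hf).
Qed.

Variables (T : kQmodule k Q) (c : 'Hom('rV[k]_e, 'Hom(L, T))).
Hypotheses (sT : rsimple T) (ci : lker c = 0%VS) (hc : forall u, is_hom (c u))
  (cm : forall u, (c u \o b)%VF = (c (u *m m) \o a)%VF).

(** c extended to L^e; the relation c(u) b = c(u m) a says that this map kills the image of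
    [theta]. *)
Definition ev_fun (x : LE) : T := \sum_j c (delta_mx 0 j) ((x : {ffun _}) j).

Lemma ev_linear : linear ev_fun.
Proof.
move=> t x y; rewrite /ev_fun scaler_sumr -big_split; apply: eq_bigr => j _ /=.
by rewrite !ffunE linearP.
Qed.

Definition ev : 'Hom(LE, T) := linfun ev_fun.

Lemma evE x : ev x = \sum_j c (delta_mx 0 j) ((x : {ffun _}) j).
Proof. by rewrite linfun_id //; exact: ev_linear. Qed.

Lemma ev_hom : is_hom ev.
Proof.
apply/is_homP; split=> [i x|r x]; rewrite !evE linear_sum; apply: eq_bigr => j _.
  by rewrite power_idemE (hom_idem _ _ (hc _)).
by rewrite power_aE (hom_arrow _ _ (hc _)).
Qed.

Lemma ev_scale (u : 'rV[k]_e) (x : L) : \sum_j c (delta_mx 0 j) (u 0 j *: x) = c u x.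
Proof.
rewrite {2}(row_sum_delta u) linear_sum sum_lfunE; apply: eq_bigr => j _.
by rewrite !linearZ scale_lfunE.
Qed.

Lemma ev_theta x : ev (theta x) = 0.
Proof.
rewrite (psingle_sum x) !linear_sum big1 //= => i _; rewrite thetaE linearB /=.
have hs (f : 'Hom(P, L)) : pmap e f (psingle P i (x i)) = psingle L i (f (x i)).
  by apply/ffunP=> j; rewrite pmapE !psingleE linearZ.
rewrite !hs mact_psingle !evE.
under eq_bigr do rewrite ffunE.
have E (y : L) (n : 'M[k]_e) : \sum_j c (delta_mx 0 j) (n i j *: y) = c (row i n) y.
  by rewrite -(ev_scale (row i n)); apply: eq_bigr => j _; rewrite mxE.
rewrite E rowE; have := cm (delta_mx 0 i) => /lfunP/(_ (x i)); rewrite !comp_lfunE => <-.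
rewrite -(ev_scale (delta_mx 0 i)); apply/eqP; rewrite subr_eq0; apply/eqP; apply: eq_bigr => j _.
by rewrite psingleE mxE eqxx.
Qed.

(** hom(P, -) is additive on regular modules, so the quotient T of C has hom(P, T) <= hom(P, C) = e.
    Conversely c embeds the rows of length e into Hom(L, T), of dimension hom(P, T). *)
Lemma coker_top : exists pi : 'Hom(coker, T),
  [/\ is_hom pi, limg pi = fullv, forall x, pi (p x) = ev x & hom P T = e].
Proof.
have [|pi hpi piE] := factor_epi coker_hom coker_surj ev_hom.
  by rewrite coker_ker; apply/subvP=> _ /memv_imgP[x _ ->]; rewrite memv_ker ev_theta.
have [rT _ _] := sT.
have pi0 : pi <> 0.
  move=> z; pose i := Ordinal e0.
  have : c (delta_mx 0 i) = 0.
    apply/lfunP=> x; have := piE (psingle L i x); rewrite z zero_lfunE evE => h; rewrite zero_lfunE [RHS]h.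
    rewrite -(ev_scale (delta_mx 0 i)); apply: eq_bigr => j _.
    by rewrite psingleE mxE eqxx.
  move=> h; have : delta_mx 0 i = 0 :> 'rV[k]_e by apply: (lker0_inj ci); rewrite h linear0.
  by move/matrixP/(_ 0 i); rewrite !mxE !eqxx => /eqP; rewrite oner_eq0.
have ps := rsimple_surj acQ aff sT coker_reg hpi pi0.
exists pi; split=> //; apply/eqP; rewrite eqn_leq; apply/andP; split.
  rewrite -[X in (_ <= X)%N]coker_hom_pp -lez_nat (pp_hom_tor pP rT.1) (pp_hom_tor pP coker_reg.1).
  have sK := submod_ker hpi.
  have ses : short_exact (submod sK) coker T.
    by exists (sub_incl sK), pi; split; rewrite ?sub_incl_hom ?sub_incl_inj ?sub_incl_img.
  have rK := reg_submod acQ aff sK coker_reg (rs_ker acQ aff coker_reg rT hpi).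
  rewrite (dimvec_ses ses) eulerDr -(pp_hom_tor pP rK.1); lia.
rewrite -(hom_pencil rT); have -> : e = \dim (fullv : {vspace 'rV[k]_e}).
  by rewrite dimvf /dim /= mul1n.
apply: (dim_inj (f := c)) => [t u v|u _ h|u _]; first by rewrite linearP.
  by apply: (lker0_inj ci); rewrite h linear0.
by rewrite mem_homs.
Qed.

(** The quotient T already accounts for all of hom(P, C) = e, so P has no map to ker pi. A maximal
    regular submodule J other than ker pi would still map onto T, while C / J is seen by P by
    [coker_quo]: too many maps. For the last bound, e is at most the dimension of the commutant,
    which embeds into Hom(C, T), and all maps C -> T factor through pi. *)
Lemma coker_cover : exists pi : 'Hom(coker, T),
  [/\ is_hom pi, limg pi = fullv,
      forall Z : {vspace coker}, rs Z -> Z != fullv -> (Z <= lker pi)%VS,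
      forall f : 'Hom(P, coker), is_hom f -> (pi \o f)%VF = 0 -> f = 0 &
      (hom P T <= hom T T)%N].
Proof.
have [pi [hpi ps piE hT]] := coker_top; have [rT nzT simT] := sT; have rC := coker_reg.
have sK := submod_ker hpi; have rsK := rs_ker acQ aff rC rT hpi.
have rK := reg_submod acQ aff sK rC rsK.
have ses : short_exact (submod sK) coker T.
  by exists (sub_incl sK), pi; split; rewrite ?sub_incl_hom ?sub_incl_inj ?sub_incl_img.
have hK : hom P (submod sK) = 0%N.
  have := pp_hom_tor pP rC.1; rewrite coker_hom_pp (dimvec_ses ses) eulerDr.
  rewrite -(pp_hom_tor pP rT.1) -(pp_hom_tor pP rK.1) hT; move: (hom P _) => x; lia.
have uniq (Z : {vspace coker}) : rs Z -> Z != fullv -> (Z <= lker pi)%VS.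
  move=> rZ Z1; have [J cJ ZJ] := coatom_ex rZ Z1; apply: subv_trans ZJ _.
  have [rsJ J1 _] := cJ; have sJ := rs_sub rsJ.
  have simS := coatom_rsimple acQ aff sJ rC cJ; have [rS _ _] := simS.
  have rJ := reg_submod acQ aff sJ rC rsJ.
  case: (simT _ (rs_img acQ aff rC rT hpi rsJ)) => e'.
    by apply/subvP=> u uJ; rewrite memv_ker -memv0 -e' memv_img.
  have seen : (0 < hom P (quomod sJ))%N.
    apply: (coker_quo simS (quo_proj_hom sJ)) => z; case/eqP: J1.
    apply/vspaceP=> u; rewrite memvf -quo_proj0; apply/eqP.
    by have := congr1 (fun f : 'Hom(coker, quomod sJ) => f u) z; rewrite zero_lfunE.
  have := pp_hom_tor pP rC.1; rewrite coker_hom_pp (dimvec_ses (sub_ses sJ)) eulerDr.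
  have hr := hom_comp (sub_incl_hom sJ) hpi.
  have sK' := submod_ker hr; have rK' := reg_submod acQ aff sK' rJ (rs_ker acQ aff rJ rT hr).
  have ses' : short_exact (submod sK') (submod sJ) T.
    exists (sub_incl sK'), (pi \o sub_incl sJ)%VF.
    split; rewrite ?sub_incl_hom ?sub_incl_inj ?sub_incl_img //.
    by rewrite limg_comp sub_incl_img.
  rewrite (dimvec_ses ses') eulerDr -(pp_hom_tor pP rT.1) hT.
  rewrite -(pp_hom_tor pP rK'.1) -(pp_hom_tor pP rS.1).
  move: (hom P (submod sK')) (hom P (quomod sJ)) seen => x y; clear; lia.
exists pi; split=> // [f hf pf|].
  have [|f' hf' fE] := factor_mono (sub_incl_hom sK) (sub_incl_inj sK) hf.
    rewrite sub_incl_img; apply/subvP=> _ /memv_imgP[u _ ->]; rewrite memv_ker.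
    by move/lfunP/(_ u): pf; rewrite comp_lfunE zero_lfunE => ->.
  have f0 : f' = 0 by move/hom_eq0: hK; apply.
  by apply/lfunP=> u; rewrite -fE f0 zero_lfunE linear0 zero_lfunE.
rewrite hT; apply: leq_trans (commutant_dim irrm e0) _.
have lF : linear (fun f : 'Hom(coker, T) => (f \o p)%VF).
  by move=> t f g; rewrite comp_lfunDl comp_lfunZl.
have lG : linear (fun g : 'Hom(T, T) => (g \o pi)%VF).
  by move=> t f g; rewrite comp_lfunDl comp_lfunZl.
pose F := linfun (fun f : 'Hom(coker, T) => (f \o p)%VF).
pose G := linfun (fun g : 'Hom(T, T) => (g \o pi)%VF).
apply: (@leq_trans (\dim (F @: homs coker T)%VS)).
  apply: (dim_inj (f := fun n => (ev \o mact L n)%VF)) => [t n n'|n nC h|n nC].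
  - by rewrite mact_linear comp_lfunDr comp_lfunZr.
  - apply: contrapT => /eqP n0; apply: nzT; apply/is_zeroP=> y.
    have [z <-] := limg_fullP y ps; have [x <-] := limg_fullP z coker_surj; rewrite piE.
    have nu := commutant_unit irrm nC n0.
    move/lfunP/(_ (mact L (invmx n) x)): h; rewrite zero_lfunE comp_lfunE.
    by rewrite -[mact L n _]comp_lfunE mactM mulVmx // mact1 id_lfunE.
  have [f hf fE] := coker_act nC; apply/memv_imgP; exists (pi \o f)%VF.
    by rewrite mem_homs (hom_comp hf hpi).
  by rewrite linfun_id //; apply/lfunP=> x; rewrite !comp_lfunE fE piE.
have le1 : (\dim (F @: homs coker T) <= \dim (homs coker T))%N.
  by rewrite -[leqRHS](limg_ker_dim F) leq_addl.
apply: leq_trans le1 _; apply: (@leq_trans (\dim (G @: homs T T)%VS)); last first.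
  by rewrite /hom -[leqRHS](limg_ker_dim G) leq_addl.
apply/dimvS/subvP=> f; rewrite mem_homs => hf; case: (pselect (f = 0)) => [->|f0].
  exact: mem0v.
have fs := rsimple_surj acQ aff sT rC hf f0.
have K1 : lker f != fullv.
  apply/eqP=> h; apply: f0; apply/lfunP=> u; rewrite zero_lfunE; apply/eqP.
  by rewrite -memv_ker h memvf.
have le := uniq _ (rs_ker acQ aff rC rT hf) K1.
have eK : lker f = lker pi.
  apply/eqP; rewrite eqEdim le; have := limg_ker_dim f fullv; have := limg_ker_dim pi fullv.
  rewrite !capfv fs ps; move: (\dim (lker f)) (\dim (lker pi)) => x y; lia.
have [|g hg gE] := factor_epi hpi ps hf; first by rewrite eK.
apply/memv_imgP; exists g; first by rewrite mem_homs.
by rewrite linfun_id //; apply/lfunP=> u; rewrite comp_lfunE gE.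
Qed.

End Cokernel.

End Pencil.

(* Every regular simple T with Hom(P, T) <> 0 is the top of a local regular   *)
(* module C of dimension e delta, all maps from P to C being seen by the top. *)
Lemma cover_ex (k : fieldType) (Q : quiver) (acQ : acyclic Q) (d : {ffun vtx Q -> int})
    (aff : affine d) (P T : kQmodule k Q) :
  pp P -> def d P = -1 -> rsimple d T -> (0 < hom P T)%N ->
  exists (C : kQmodule k Q) (pi : 'Hom(C, T)),
    [/\ reg C, forall M : kQmodule k Q, reg M -> euler (dimvec C) (dimvec M) = 0 &
    [/\ is_hom pi, limg pi = fullv,
      forall Z : {vspace C}, rs d Z -> Z != fullv -> (Z <= lker pi)%VS,
      forall f : 'Hom(P, C), is_hom f -> (pi \o f)%VF = 0 -> f = 0 &
      (hom P T <= hom T T)%N]].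
Proof.
move=> pP dP sT hT; have [L [pL dL h2]] := pencil_ex acQ aff pP dP.
have [a [b [ha hb iab]]] : exists a b : 'Hom(P, L), [/\ is_hom a, is_hom b & indep a b].
  have fr := basis_free (vbasisP (homs P L)).
  have s2 : size (vbasis (homs P L)) = hom P L by rewrite size_tuple.
  pose X := vbasis (homs P L); exists X`_0, X`_1; split.
  - by rewrite -mem_homs vbasis_mem // mem_nth // s2; apply: leq_trans h2.
  - by rewrite -mem_homs vbasis_mem // mem_nth // s2.
  move=> c c' h; have /freeP fX := fr.
  pose i0 : 'I_(hom P L) := Ordinal (ltnW h2); pose i1 : 'I_(hom P L) := Ordinal h2.
  pose w (i : 'I_(hom P L)) := if i == i0 then c else if i == i1 then c' else 0.
  have := fX w; rewrite (bigD1 i0) //= (bigD1 i1) //= big1 => [|i /andP[ni0 ni1]]; last first.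
    by rewrite /w (negPf ni0) (negPf ni1) scale0r.
  rewrite /w eqxx addr0 => /(_ h) hw; split; first by have := hw i0; rewrite eqxx.
  by have := hw i1; rewrite eqxx.
have [a' [b' [e [m [c [e0 irrm [[ha' hb'] iab' ci hc cm]]]]]]] :=
  irr_datum_ex acQ aff pP pL dL sT hT ha hb iab.
have rC := coker_reg acQ aff pP dP pL dL e0 irrm ha' hb' iab'.
have [pi piP] := coker_cover acQ aff pP dP pL dL e0 irrm ha' hb' iab' sT ci hc cm.
exists (coker m ha' hb'), pi; split=> // M rM.
rewrite (dimvec_coker acQ aff pP dP pL dL e0 irrm ha' hb' iab') eulerZl.
by rewrite -[euler d _]/(def d M) (reg_def acQ aff rM) mulr0.
Qed.

(** * Transitivity of the automorphism group *)

Section Transitivity.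
Variables (k : fieldType) (Q : quiver).
Hypothesis acQ : acyclic Q.
Variable d : {ffun vtx Q -> int}.
Hypothesis aff : affine d.
Local Notation def := (def d).
Local Notation rs := (rs d).
Local Notation rsimple := (rsimple d).
Local Notation chain := (chain d).
Implicit Types C M N R S T X Y Z : kQmodule k Q.

Lemma chain_quo M Z (g : 'Hom(M, Z)) : reg M -> reg Z -> is_hom g -> limg g = fullv ->
  chain M -> chain Z.
Proof.
move=> rM rZ hg gs cM A B rA rB.
have E (D : {vspace Z}) : (g @: (g @^-1: D) = D)%VS by rewrite lpreimK // gs subvf.
have := cM _ _ (rs_preim acQ aff rM rZ hg rA) (rs_preim acQ aff rM rZ hg rB).
by case/orP=> /(limgS g); rewrite !E => ->; rewrite ?orbT.
Qed.

Lemma chain_top M T (q : 'Hom(M, T)) (Z : {vspace M}) : reg M -> rsimple T -> is_hom q ->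
  chain M -> rs Z -> Z != fullv -> q <> 0 -> (Z <= lker q)%VS.
Proof.
move=> rM sT hq cM rZ Z1 q0; have [rT _ simT] := sT.
case/orP: (cM _ _ rZ (rs_ker acQ aff rM rT hq)) => // KZ.
case: (simT _ (rs_img acQ aff rM rT hq rZ)) => e.
  by apply/subvP=> u uZ; rewrite memv_ker -memv0 -e memv_img.
case/eqP: Z1; apply/vspaceP=> u; rewrite memvf.
have : q u \in (q @: Z)%VS by rewrite e memvf.
case/memv_imgP=> v vZ ev; rewrite -(subrK v u) memvD //; apply: (subvP KZ).
by rewrite memv_ker linearB /= ev subrr.
Qed.

Section Seen.
Variable P : kQmodule k Q.
Hypotheses (pP : pp P) (dP : def P = -1).

(** The kernel of g is regular, hence torsion, so Ext^1 from P to it vanishes. *)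
Lemma pp_lift M N (g : 'Hom(M, N)) (f : 'Hom(P, N)) : reg M -> reg N ->
  is_hom g -> limg g = fullv -> is_hom f ->
  exists2 s : 'Hom(P, M), is_hom s & forall u, g (s u) = f u.
Proof.
move=> rM rN hg gs hf; have sK := submod_ker hg.
have rK := reg_submod acQ aff sK rM (rs_ker acQ aff rM rN hg).
apply: (ext0_lift acQ (i := sub_incl sK)) => //; rewrite ?sub_incl_img ?sub_incl_inj //.
  exact: ext_pp_tor pP rK.1.
exact: sub_incl_hom.
Qed.

(* Among the regular simple subquotients of M, P only sees T. *)
Definition only T M := forall Y S (i : 'Hom(Y, M)) (p : 'Hom(Y, S)),
  is_hom i -> lker i = 0%VS -> is_hom p -> limg p = fullv ->
  reg Y -> rsimple S -> (0 < hom P S)%N -> isom S T.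

Lemma only_quo T M Z (g : 'Hom(M, Z)) : reg M -> reg Z -> is_hom g -> limg g = fullv ->
  only T M -> only T Z.
Proof.
move=> rM rZ hg gs oM Y S i p hi ii hp ps rY sS seen.
have rI := rs_img acQ aff rY rZ hi (rs_full acQ aff rY).
have rW := rs_preim acQ aff rM rZ hg rI; set W := (g @^-1: _)%VS in rW.
have sW := rs_sub rW; have rWm := reg_submod acQ aff sW rM rW.
have hgW := hom_comp (sub_incl_hom sW) hg.
have [|h hh hE] := factor_mono hi ii hgW.
  apply/subvP=> _ /memv_imgP[u _ ->]; rewrite comp_lfunE sub_inclE memv_preim; exact: subvsP.
apply: (oM _ _ (sub_incl sW) (p \o h)%VF) => //.
- exact: sub_incl_hom.
- exact: sub_incl_inj.
- exact: hom_comp hh hp.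
apply: limg_full => s; have [y <-] := limg_fullP s ps; have [x ex] := limg_fullP (i y) gs.
have xW : x \in W by rewrite -memv_preim ex memv_img ?memvf.
exists (vsproj W x); rewrite comp_lfunE; congr (p _); apply: (lker0_inj ii).
by rewrite hE comp_lfunE sub_inclE vsprojK.
Qed.

Lemma only_sub T M Z (f : 'Hom(Z, M)) : is_hom f -> lker f = 0%VS -> only T M -> only T Z.
Proof.
move=> hf fi oM Y S i p hi ii hp ps rY sS seen.
apply: (oM _ _ (f \o i)%VF p) => //; first exact: hom_comp hi hf.
apply: lker0_intro => u; rewrite comp_lfunE => h.
by apply: (lker0_inj ii); apply: (lker0_inj fi); rewrite h !linear0.
Qed.

(** The part of Y lying in X maps to S either onto or by 0. In the first case S is a subquotient of
    X, in the second of Z. *)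
Lemma only_ext T X M Z (f : 'Hom(X, M)) (g : 'Hom(M, Z)) : reg M -> reg Z ->
  is_hom f -> is_hom g -> lker f = 0%VS -> limg f = lker g ->
  only T X -> only T Z -> only T M.
Proof.
move=> rM rZ hf hg fi fg oX oZ Y S i p hi ii hp ps rY sS seen.
have [rS _ simS] := sS; have hgi := hom_comp hi hg.
have rK := rs_ker acQ aff rY rZ hgi; have sK := rs_sub rK.
case: (simS _ (rs_img acQ aff rY rS hp rK)) => e; last first.
  have hiK := hom_comp (sub_incl_hom sK) hi.
  have [|h hh hE] := factor_mono hf fi hiK.
    rewrite fg; apply/subvP=> _ /memv_imgP[u _ ->]; rewrite memv_ker.
    have : sub_incl sK u \in lker (g \o i)%VF by rewrite sub_inclE; exact: subvsP.
    by rewrite memv_ker !comp_lfunE.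
  apply: (oX _ _ h (p \o sub_incl sK)%VF) => //.
  - apply: lker0_intro => u hu; have := hE u; rewrite hu linear0 comp_lfunE => h0.
    by apply: (lker0_inj (sub_incl_inj sK)); apply: (lker0_inj ii); rewrite -h0 !linear0.
  - exact: hom_comp (sub_incl_hom sK) hp.
  - by rewrite limg_comp sub_incl_img.
  exact: (reg_submod acQ aff sK rY rK).
have rI := rs_img acQ aff rY rZ hgi (rs_full acQ aff rY); have sI := rs_sub rI.
have [|h hh hE] := factor_mono (sub_incl_hom sI) (sub_incl_inj sI) hgi.
  by rewrite sub_incl_img.
have hs : limg h = fullv.
  apply: limg_full => w; have /memv_imgP[u _ ew] := subvsP w; exists u.
  by apply: subvs_inj; rewrite -(sub_inclE (sX := sI)) hE ew.
have [|p' hp' pE] := factor_epi hh hs hp.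
  apply/subvP=> u; rewrite !memv_ker => /eqP hu.
  rewrite -memv0 -e memv_img // memv_ker -hE hu; exact/eqP/linear0.
apply: (oZ _ _ (sub_incl sI) p') => //.
- exact: sub_incl_hom.
- exact: sub_incl_inj.
- by apply: limg_full => s; have [y <-] := limg_fullP s ps; exists (h y).
exact: (reg_submod acQ aff sI rZ rI).
Qed.

(** If Y is all of C, then S is the top T. Otherwise Y lies in ker pi, so Hom(P, Y) = 0, and Hom(P,
    S) = 0 because maps from P lift along Y -> S. *)
Lemma only_cover T C (pi : 'Hom(C, T)) : reg C -> rsimple T -> is_hom pi -> limg pi = fullv ->
  (forall Z : {vspace C}, rs Z -> Z != fullv -> (Z <= lker pi)%VS) ->
  (forall f : 'Hom(P, C), is_hom f -> (pi \o f)%VF = 0 -> f = 0) -> only T C.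
Proof.
move=> rC sT hpi pis loc inj Y S i p hi ii hp ps rY sS seen.
have [rT _ _] := sT; have [rS nzS _] := sS.
have rI := rs_img acQ aff rY rC hi (rs_full acQ aff rY).
case: (eqVneq (limg i) fullv) => [iF|/(loc _ rI) le].
  have [j [/and3P[hj /eqP ji /eqP js] ji1 ji2]] := iso_inv (iso_intro hi ii iF).
  have hpj := hom_comp hj hp.
  have pjs : limg (p \o j)%VF = fullv by rewrite limg_comp js.
  have K1 : lker (p \o j)%VF != fullv.
    apply/eqP=> h; apply: nzS; apply/zero_full; rewrite -pjs; apply/eqP; rewrite -subv0.
    by apply/subvP=> _ /memv_imgP[u _ ->]; rewrite memv0 -memv_ker h memvf.
  have [|g hg gE] := factor_epi hpj pjs hpi.
    exact: loc (rs_ker acQ aff rC rS hpj) K1.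
  apply: (rsimple_isom acQ aff) => //; apply/hom_gt0; exists g => // g0.
  have [_ nzT _] := sT; apply: nzT; apply/is_zeroP=> t.
  by have [x <-] := limg_fullP t pis; rewrite -gE g0 zero_lfunE.
case/hom_gt0: seen => f hf f0; have [s hs sE] := pp_lift rY rS hp ps hf.
case: f0; apply/lfunP=> u; rewrite -sE zero_lfunE.
have is0 : (i \o s)%VF = 0.
  apply: inj; first exact: hom_comp hs hi.
  apply/lfunP=> v; rewrite !comp_lfunE zero_lfunE; apply/eqP; rewrite -memv_ker.
  by apply: (subvP le); rewrite memv_img ?memvf.
have -> : s u = 0.
  by apply: (lker0_inj ii); move/lfunP/(_ u): is0; rewrite comp_lfunE zero_lfunE linear0.
exact: linear0.
Qed.

(** Let M = ker q. If the cover C of T maps nontrivially to M, the image is a quotient of C, and R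
    modulo it is shorter, again uniserial with top T. If not, <C, M> = 0 gives Ext^1(C, M) = 0, so
    pi lifts to C -> R, which is onto as R is local; then R is a quotient of C. *)
Lemma chain_only T R (q : 'Hom(R, T)) : rsimple T -> (0 < hom P T)%N ->
  reg R -> chain R -> is_hom q -> q <> 0 -> only T R.
Proof.
move=> sT seen; have [C [pi [rC eC [hpi pis loc inj _]]]] := cover_ex acQ aff pP dP sT seen.
have [rT nzT _] := sT; have oC := only_cover rC sT hpi pis loc inj.
have [n] := ubnP (\dim {:R}); elim: n R q => // n IH R q le rR cR hq q0.
have qs := rsimple_surj acQ aff sT rR hq q0.
have sM := submod_ker hq; have rsM := rs_ker acQ aff rR rT hq.
have rM := reg_submod acQ aff sM rR rsM.
case: (pselect (hom C (submod sM) = 0%N)) => [h0|/eqP]; last first.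
  rewrite -lt0n => /hom_gt0[f hf f0]; have hf1 := hom_comp hf (sub_incl_hom sM).
  set f1 := (_ \o f)%VF in hf1.
  have rX := rs_img acQ aff rC rR hf1 (rs_full acQ aff rC); have sX := rs_sub rX.
  have [|h hh hE] := factor_mono (sub_incl_hom sX) (sub_incl_inj sX) hf1.
    by rewrite sub_incl_img.
  have hs : limg h = fullv.
    apply: limg_full => w; have /memv_imgP[u _ ew] := subvsP w; exists u.
    by apply: subvs_inj; rewrite -(sub_inclE (sX := sX)) hE ew.
  have oX := only_quo rC (reg_submod acQ aff sX rR rX) hh hs oC.
  have rqX := reg_quomod acQ aff sX rR rX; have hp := quo_proj_hom sX.
  have pF := limg_quo_proj (limg f1).
  have [|q' hq' qE] := factor_epi hp pF hq.
    rewrite lker_quo_proj; apply/subvP=> _ /memv_imgP[u _ ->].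
    rewrite /f1 comp_lfunE sub_inclE; exact: subvsP.
  have X0 : limg f1 != 0%VS.
    apply/eqP=> e; apply: f0; apply/lfunP=> u; rewrite zero_lfunE.
    apply: (lker0_inj (sub_incl_inj sM)); apply/eqP; rewrite linear0 -memv0 -e.
    by apply/memv_imgP; exists u; rewrite ?memvf // /f1 comp_lfunE.
  have oq : only T (quomod sX).
    apply: (IH _ q') => //.
    - rewrite ltnS in le; apply: leq_trans le; rewrite -(limg_ker_dim (quo_proj (limg f1)) fullv) capfv pF lker_quo_proj.
      by rewrite -addn1 addnC leq_add2r lt0n dimv_eq0.
    - exact: chain_quo rR rqX hp pF cR.
    by move=> q'0; apply: q0; apply/lfunP=> u; rewrite -qE q'0 !zero_lfunE.
  apply: (only_ext rR rqX (sub_incl_hom sX) hp) oX oq; first exact: sub_incl_inj.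
  by rewrite sub_incl_img lker_quo_proj.
have ext0 : hom (submod sM) (tau C) = 0%N.
  have := euler_formula acQ C (submod sM); rewrite h0 (eC _ rM); move: (hom _ _) => x; lia.
have [|s hs sE] := ext0_lift acQ ext0 (sub_incl_hom sM) hq (sub_incl_inj sM) _ qs hpi.
  by rewrite sub_incl_img.
have sF : limg s = fullv.
  apply: contrapT => /eqP s1.
  have := chain_top rR sT hq cR (rs_img acQ aff rC rR hs (rs_full acQ aff rC)) s1 q0.
  move/subvP=> h; apply: nzT; apply/is_zeroP=> t; have [x <-] := limg_fullP t pis.
  by rewrite -sE; apply/eqP; rewrite -memv_ker h // memv_img ?memvf.
exact: only_quo rC rR hs sF oC.
Qed.

Definition generates R (g : 'Hom(P, R)) :=
  forall Z : {vspace R}, rs Z -> (limg g <= Z)%VS -> Z = fullv.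

Lemma hull_ex M (g : 'Hom(P, M)) : reg M -> exists2 I : {vspace M}, rs I &
  (limg g <= I)%VS /\ forall Z : {vspace M}, rs Z -> (limg g <= Z)%VS -> (I <= Z)%VS.
Proof.
move=> rM; pose good n := `[< exists I : {vspace M}, [/\ rs I, (limg g <= I)%VS & \dim I = n] >].
have ex : exists n, good n.
  by exists (\dim {:M}); apply/asboolP; exists fullv; rewrite subvf; split=> //; exact: rs_full.
case: (ex_minnP ex) => m /asboolP[I [rI gI dI]] mn; exists I => //; split=> // Z rZ gZ.
apply/capv_idPl/eqP; rewrite eqEdim capvSl dI; apply: mn; apply/asboolP.
exists (I :&: Z)%VS; split=> //; first exact: rs_cap.
by rewrite subv_cap gI.
Qed.

Lemma generates_inj R N (g : 'Hom(P, R)) (f : 'Hom(R, N)) : reg R -> reg N -> generates g ->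
  is_hom f -> (f \o g)%VF = 0 -> f = 0.
Proof.
move=> rR rN gen hf fg; have /gen : rs (lker f) by exact: (rs_ker acQ aff rR rN hf).
have le : (limg g <= lker f)%VS.
  apply/subvP=> _ /memv_imgP[u _ ->]; rewrite memv_ker.
  by move/lfunP/(_ u): fg; rewrite comp_lfunE zero_lfunE => ->.
by move/(_ le)=> e; apply/lfunP=> u; rewrite zero_lfunE; apply/eqP; rewrite -memv_ker e memvf.
Qed.

(** Composition with h1 is injective on End T, so its image has dimension at least hom(P, T) and is
    all of Hom(P, T). *)
Lemma rsimple_factor T (h1 h2 : 'Hom(P, T)) : rsimple T -> (hom P T <= hom T T)%N ->
  is_hom h1 -> is_hom h2 -> h1 <> 0 ->
  exists2 al : 'End(T), is_hom al & (al \o h1)%VF = h2.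
Proof.
move=> sT le hh1 hh2 h10; have [rT _ _] := sT.
have lF : linear (fun f : 'End(T) => (f \o h1)%VF).
  by move=> t f g; rewrite comp_lfunDl comp_lfunZl.
pose F := linfun (fun f : 'End(T) => (f \o h1)%VF).
have : (F @: homs T T)%VS == homs P T.
  rewrite eqEdim; apply/andP; split.
    apply/subvP=> _ /memv_imgP[f + ->]; rewrite linfun_id // !mem_homs => hf.
    exact: hom_comp hh1 hf.
  rewrite limg_dim_eq //; apply/eqP; rewrite -subv0; apply/subvP=> f.
  rewrite memv_cap mem_homs memv_ker linfun_id // memv0 => /andP[hf /eqP f0].
  apply/eqP; apply: contrapT => fn; have fi := rsimple_inj acQ aff sT rT hf fn.
  apply: h10; apply/lfunP=> u; rewrite zero_lfunE; apply: (lker0_inj fi).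
  by move/lfunP/(_ u): f0; rewrite comp_lfunE zero_lfunE linear0.
move/eqP=> e; have : h2 \in homs P T by rewrite mem_homs.
by rewrite -e => /memv_imgP[f + ->]; rewrite linfun_id // mem_homs => hf; exists f.
Qed.

(* The submodule of R^2 generated by the image of (g, g') is local, hence     *)
(* uniserial, hence the graph of an endomorphism.                             *)
Lemma chain_transitive R (g g' : 'Hom(P, R)) : reg R -> chain R -> is_hom g -> is_hom g' ->
  generates g -> exists2 al : 'End(R), is_hom al & (al \o g)%VF = g'.
Proof.
move=> rR cR hg hg' gen.
case: (eqVneq (fullv : {vspace R}) 0%VS) => [/zero_full/is_zeroP z|nz].
  by exists 0; [exact: hom_0 | apply/lfunP=> u; rewrite comp_lfun0l zero_lfunE [RHS]z].
have [|J0 cJ0 _] := coatom_ex (rs0 d R); first by rewrite eq_sym.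
have [rJ0 J01 _] := cJ0; have sJ0 := rs_sub rJ0.
have sT := coatom_rsimple acQ aff sJ0 rR cJ0; set T := quomod sJ0 in sT.
have hq : is_hom (quo_proj J0 : 'Hom(R, T)) by exact: quo_proj_hom.
set q : 'Hom(R, T) := quo_proj J0 in hq.
have [rT nzT _] := sT.
have qs : limg q = fullv by exact: limg_quo_proj.
have q0 : q <> 0.
  by move=> e; apply: nzT; apply/zero_full; rewrite -qs e lim0g.
have qg0 : (q \o g)%VF <> 0 by move/(generates_inj rR rT gen hq).
have seen : (0 < hom P T)%N.
  by apply/hom_gt0; exists (q \o g)%VF => //; exact: hom_comp hg hq.
have oR := chain_only sT seen rR cR hq q0.
have [_ [_ [_ _ [_ _ _ _ hTT]]]] := cover_ex acQ aff pP dP sT seen.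
have rW : reg (dsum R R) := reg_ses (dsum_ses R R) rR rR.
have oW : only T (dsum R R).
  exact: (only_ext rW rR (dinl_hom R R) (dsnd_hom R R) (dinl_inj R R) (dinl_img R R) oR oR).
have [gg hgg ggE] := dsum_pair hg hg'.
have [I rI [ggI Imin]] := hull_ex gg rW; have sI := rs_sub rI.
have rIm := reg_submod acQ aff sI rW rI.
have [|gI hgI gIE] := factor_mono (sub_incl_hom sI) (sub_incl_inj sI) hgg.
  by rewrite sub_incl_img.
have genI : generates gI.
  move=> Z rZ gZ; have rZ' := rs_img acQ aff rIm rW (sub_incl_hom sI) rZ.
  have := Imin _ rZ'; rewrite (_ : (limg gg <= _)%VS) => [/(_ isT) IZ|]; last first.
    apply/subvP=> _ /memv_imgP[u _ ->]; rewrite -gIE memv_img // (subvP gZ) //.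
    by rewrite memv_img ?memvf.
  apply/vspaceP=> w; rewrite memvf; have /(subvP IZ)/memv_imgP[z zZ e] := subvsP w.
  by move: e; rewrite sub_inclE => /subvs_inj->.
have oI : only T (submod sI) := only_sub (sub_incl_hom sI) (sub_incl_inj sI) oW.
(* As the image of [gI] generates I, the quotient I / J is seen by P, so it is isomorphic to T by
   [oI]. *)
have topT (J : {vspace submod sI}) : coatom d J ->
    exists2 p : 'Hom(submod sI, T), is_hom p & lker p = J /\ (p \o gI)%VF <> 0.
  move=> cJ; have [rJ J1 _] := cJ; have sJ := rs_sub rJ.
  have sS := coatom_rsimple acQ aff sJ rIm cJ; have [rS _ _] := sS.
  have hp := quo_proj_hom sJ.
  have pg0 : (quo_proj J \o gI)%VF <> 0 :> 'Hom(P, quomod sJ).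
    move/(generates_inj rIm rS genI hp) => e; case/eqP: J1; rewrite -(lker_quo_proj J) e.
    by apply/vspaceP=> w; rewrite memv_ker zero_lfunE eqxx memvf.
  have seenS : (0 < hom P (quomod sJ))%N.
    by apply/hom_gt0; exists (quo_proj J \o gI)%VF => //; exact: hom_comp hgI hp.
  have [|f /and3P[hf /eqP fi _]] := oI _ _ \1%VF _ (hom_id _) _ hp (limg_quo_proj J) rIm sS seenS.
    by apply: lker0_intro => u; rewrite id_lfunE.
  exists (f \o quo_proj J)%VF; first exact: hom_comp hp hf.
  split.
    apply/vspaceP=> w; rewrite memv_ker comp_lfunE -quo_proj0.
    apply/eqP/eqP => [h|->]; last exact: linear0.
    by apply: (lker0_inj fi); rewrite h linear0.
  move=> e; apply: pg0; apply/lfunP=> u; rewrite comp_lfunE zero_lfunE; apply: (lker0_inj fi).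
  by move/lfunP/(_ u): e; rewrite !comp_lfunE zero_lfunE linear0.
have cI : chain (submod sI).
  case: (eqVneq (fullv : {vspace submod sI}) 0%VS) => [e|nzI].
    move=> A B _ _; have : (A <= fullv)%VS by exact: subvf.
    by rewrite e subv0 => /eqP->; rewrite sub0v.
  have [|J cJ _] := coatom_ex (rs0 d (submod sI)); first by rewrite eq_sym.
  have [rJ J1 mJ] := cJ; have [p hp [pJ pg]] := topT _ cJ.
  apply: (top_chain acQ aff rIm rJ J1) => Z rZ Z1; have [J' cJ' ZJ'] := coatom_ex rZ Z1.
  apply: subv_trans ZJ' _; have [rJ' J'1 mJ'] := cJ'; have [p' hp' [pJ' pg']] := topT _ cJ'.
  (* The composites of p and p' with [gI] differ by an endomorphism of T. Since [gI] generates I, so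
     do p and p' themselves, hence J lies in J' and J is the only maximal regular submodule. *)
  have [al hal alE] := rsimple_factor sT hTT (hom_comp hgI hp) (hom_comp hgI hp') pg.
  have e : p' - (al \o p)%VF = 0.
    apply: (generates_inj rIm rT genI).
      by rewrite -mem_homs memvB // mem_homs //; exact: hom_comp hp hal.
    by rewrite comp_lfunDl comp_lfunNl -comp_lfunA alE subrr.
  have JJ' : (J <= J')%VS.
    rewrite -pJ -pJ'; apply/subvP=> u; rewrite !memv_ker => /eqP pu.
    move/lfunP/(_ u): e; rewrite add_lfunE opp_lfunE comp_lfunE pu linear0 subr0 zero_lfunE => ->.
    exact: eqxx.
  by case: (mJ _ rJ' JJ') => [->//|e']; rewrite e' eqxx in J'1.
have hp1 := hom_comp (sub_incl_hom sI) (dfst_hom R R).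
have hp2 := hom_comp (sub_incl_hom sI) (dsnd_hom R R).
set p1 := (_ \o _)%VF in hp1; set p2 := (_ \o _)%VF in hp2.
have p1E w : p1 w = (vsval w).1 by rewrite /p1 comp_lfunE sub_inclE dfstE.
have p2E w : p2 w = (vsval w).2 by rewrite /p2 comp_lfunE sub_inclE dsndE.
have p1g u : p1 (gI u) = g u by rewrite p1E -(sub_inclE (sX := sI)) gIE ggE.
have p2g u : p2 (gI u) = g' u by rewrite p2E -(sub_inclE (sX := sI)) gIE ggE.
have p1s : limg p1 = fullv.
  apply: gen; first exact: (rs_img acQ aff rIm rR hp1 (rs_full acQ aff rIm)).
  by apply/subvP=> _ /memv_imgP[u _ ->]; rewrite -p1g memv_img ?memvf.
have k12 w : p1 w = 0 -> p2 w = 0 -> w = 0.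
  rewrite p1E p2E => h1 h2; apply: subvs_inj; rewrite linear0.
  by rewrite [LHS]surjective_pairing h1 h2.
(* The two kernels are comparable and meet in 0, so one of them is 0. If it is that of [p2], then
   dim I <= dim R, and the surjection [p1] is injective as well. *)
have p1i : lker p1 = 0%VS.
  case/orP: (cI _ _ (rs_ker acQ aff rIm rR hp1) (rs_ker acQ aff rIm rR hp2)) => /subvP le.
    apply: lker0_intro => w h; apply: k12 => //; apply/eqP; rewrite -memv_ker; apply: le.
    by rewrite memv_ker h.
  have p2i : lker p2 = 0%VS.
    apply: lker0_intro => w h; apply: k12 => //; apply/eqP; rewrite -memv_ker; apply: le.
    by rewrite memv_ker h.
  apply/eqP; rewrite -dimv_eq0; have := limg_ker_dim p1 fullv; have := limg_ker_dim p2 fullv.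
  rewrite !capfv p1s p2i dimv0; have : (\dim (limg p2) <= \dim {:R})%N by apply/dimvS/subvf.
  move: (\dim (lker p1)) (\dim (limg p2)) (\dim {:R}) (\dim {:submod sI}) => x y z t; clear; lia.
have [j [/and3P[hj _ _] j1 _]] := iso_inv (iso_intro hp1 p1i p1s).
exists (p2 \o j)%VF; first exact: hom_comp hj hp2.
by apply/lfunP=> u; rewrite 2!comp_lfunE -p1g j1 p2g.
Qed.

End Seen.

End Transitivity.

(** * Extended Dynkin quivers *)

Section TitsForm.
Variables (Q : quiver) (w : vtx Q -> nat).
Hypotheses (w0 : forall i, (0 < w i)%N)
  (harm : forall i, (\sum_(a : arr Q) ((src a == i) * w (tgt a) + (tgt a == i) * w (src a)))%N
                    = (w i).*2)
  (conn : forall p : pred (vtx Q), (forall a : arr Q, p (src a) = p (tgt a)) ->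
     forall i j, p i -> p j).

(** Harmonicity of w paired with z, resummed over the arrows; it is used with values in [int] and in
    [rat]. *)
Lemma handshake (F : comPzRingType) (z : vtx Q -> F) :
  \sum_(a : arr Q) ((w (tgt a))%:R * z (src a) + (w (src a))%:R * z (tgt a)) =
  \sum_i 2 * (w i)%:R * z i.
Proof.
have sel (i : vtx Q) (y : F) : \sum_j (i == j)%:R * (y * z j) = y * z i.
  rewrite (bigD1 i) //= big1 ?addr0 ?eqxx ?mul1r // => j ji.
  by rewrite eq_sym (negPf ji) mul0r.
under [RHS]eq_bigr do rewrite -natrM mul2n -harm natr_sum mulr_suml.
rewrite exchange_big /=; apply: eq_bigr => a _; rewrite -!sel -big_split /=.
by apply: eq_bigr => j _; rewrite natrD !natrM mulrDl !mulrA.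
Qed.

Definition wvec : {ffun vtx Q -> int} := [ffun i => (w i)%:Z].

Lemma wvec_sym y : euler wvec y = - euler y wvec.
Proof.
apply/eqP; rewrite -subr_eq0 opprK /euler.
have := handshake (fun i => y i); rewrite big_split /= => h.
rewrite addrACA -opprD [X in _ - X]addrC.
under [X in _ - (X + _)]eq_bigr do rewrite ffunE mulrC -[(w _)%:Z]natz.
under [X in _ - (_ + X)]eq_bigr do rewrite ffunE -[(w _)%:Z]natz.
rewrite h -big_split /= subr_eq0; apply/eqP; apply: eq_bigr => i _.
by rewrite ffunE -[(w _)%:Z]natz; ring.
Qed.

(** Expanding the squares, the mixed terms give the arrow part of the Euler form, and the pure ones
    are [handshake] for x^2 / w. *)
Lemma tits_squares (x : {ffun vtx Q -> int}) :
  2 * (euler x x)%:~R = \sum_(a : arr Q) (w (src a))%:R * (w (tgt a))%:R *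
    ((x (src a))%:~R / (w (src a))%:R - (x (tgt a))%:~R / (w (tgt a))%:R) ^+ 2 :> rat.
Proof.
have wn i : (w i)%:R != 0 :> rat by rewrite pnatr_eq0 -lt0n.
have := handshake (fun i => (x i)%:~R ^+ 2 / (w i)%:R : rat) => h.
rewrite /euler rmorphB !rmorph_sum mulrBr !mulr_sumr.
have -> : \sum_i 2 * (x i * x i)%:~R = \sum_i 2 * (w i)%:R * ((x i)%:~R ^+ 2 / (w i)%:R) :> rat.
  by apply: eq_bigr => i _; rewrite intrM; field.
rewrite -h -sumrB; apply: eq_bigr => a _; rewrite /= intrM.
by field; rewrite !wn.
Qed.

(** A vanishing sum of squares makes x / w equal at the two ends of every arrow, hence constant by
    connectedness; w i0 = 1 makes the constant an integer. *)
Lemma wvec_affine i0 : w i0 = 1%N -> affine wvec.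
Proof.
move=> wi0; have wn i : (w i)%:R != 0 :> rat by rewrite pnatr_eq0 -lt0n.
have sq_ge0 (x : {ffun vtx Q -> int}) (a : arr Q) : 0 <= (w (src a))%:R * (w (tgt a))%:R *
    ((x (src a))%:~R / (w (src a))%:R - (x (tgt a))%:~R / (w (tgt a))%:R) ^+ 2 :> rat.
  by rewrite mulr_ge0 ?sqr_ge0 // mulr_ge0 // ler0n.
split=> [i|y|x|x qx]; first by rewrite ffunE ltz_nat.
- exact: wvec_sym.
- rewrite -(ler0z rat) -(pmulr_rge0 _ (isT : 0 < 2 :> rat)) tits_squares; exact: sumr_ge0.
have := tits_squares x; rewrite qx mulr0 => /esym/eqP.
rewrite psumr_eq0 => [/allP sq|a _]; last exact: sq_ge0.
pose p i := (x i)%:~R / (w i)%:R == (x i0)%:~R :> rat.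
exists (x i0); apply/ffunP=> i; rewrite !ffunE.
have : p i.
  apply: (conn _ (i := i0)) => [a|]; last by rewrite /p wi0 divr1.
  have := sq a (mem_index_enum _); rewrite !mulf_eq0 !(negPf (wn _)) /= orbb subr_eq0.
  by rewrite /p => /eqP->.
rewrite /p eq_sym => /eqP e; apply/eqP; rewrite -(eqr_int rat) intrM e; apply/eqP.
by rewrite -pmulrn divfK.
Qed.

(** delta is isotropic, hence a positive integral multiple of w; minimality makes it w. *)
Lemma min_root_affine i0 (delta : {ffun vtx Q -> int}) : w i0 = 1%N ->
  min_pos_imag_root delta -> affine delta.
Proof.
move=> wi0 [[dn dpos qd] min]; have aw := wvec_affine wi0; suff <- : wvec = delta by [].
have [wpos wsym _ wz] := aw; have [t dt] := wz _ qd.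
have qw : euler wvec wvec = 0 by have := wsym wvec; lia.
apply: min; first split=> //.
- by apply/eqP=> /ffunP/(_ i0); rewrite !ffunE wi0.
- by move=> i; apply: ltW.
have t0 : t = delta i0 by rewrite dt !ffunE wi0 mulr1.
have t1 : 0 < t.
  rewrite lt_neqAle t0 dpos andbT eq_sym; apply: contra dn => /eqP d0.
  by apply/eqP/ffunP=> i; rewrite dt !ffunE t0 d0 mul0r.
by move=> i; rewrite dt [vscale _ _ _]ffunE -[leLHS]mul1r (ler_wpM2r (ltW (wpos i))) //; move: t1; lia.
Qed.

End TitsForm.

Definition nbsum (e : seq (nat * nat)) (w : nat -> nat) (i : nat) : nat :=
  \sum_(x <- e) (if x.1 == i then w x.2 else if x.2 == i then w x.1 else 0%N).

Lemma graph_affine (Q : quiver) (n : nat) (e : seq (nat * nat)) (w : nat -> nat) i0 delta :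
  acyclic Q -> underlying_graph_is Q n e ->
  (forall x, x \in e -> (x.1 < n)%N && (x.2 < n)%N) ->
  (forall i, (i < n)%N -> (0 < w i)%N) ->
  (forall i, (i < n)%N -> nbsum e w i = (w i).*2) ->
  (forall p : pred nat, (forall x, x \in e -> p x.1 = p x.2) ->
     forall i, (i < n)%N -> p i = p 0%N) ->
  (i0 < n)%N -> w i0 = 1%N -> min_pos_imag_root delta -> @affine Q delta.
Proof.
move=> acQ [f [[g fK gK] fe]] range w0 harm conn i0n wi0.
have nl (a : arr Q) : src a != tgt a.
  by apply/eqP=> l; have := acQ (src a) [:: a]; rewrite /= eqxx => /(_ isT (esym l)).
apply: (@min_root_affine Q (fun i => w (f i)) _ _ _ (g (Ordinal i0n))).
- by move=> i; apply: w0.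
- move=> i; rewrite -harm // /nbsum.
  transitivity (\sum_j arrow_mult i j * w (f j))%N.
    rewrite /arrow_mult; under [RHS]eq_bigr => j _.
      rewrite -sum1dep_card big_distrl big_mkcond /=. over.
    rewrite exchange_big /=; apply: eq_bigr => a _.
    have := nl a; case: (eqVneq (src a) i) => [si|si]; case: (eqVneq (tgt a) i) => [ti|ti].
    + by rewrite si ti eqxx.
    + rewrite mul1n mul0n addn0 => _; rewrite (bigD1 (tgt a)) //= !xpair_eqE si !eqxx /= mul1n.
      rewrite big1 ?addn0 // => j jt; rewrite !xpair_eqE eq_sym (negPf jt) andbF /=.
      by rewrite (negPf ti) andbF.
    + rewrite mul1n mul0n add0n => _; rewrite (bigD1 (src a)) //= !xpair_eqE ti !eqxx orbT mul1n.
      rewrite big1 ?addn0 // => j jt; rewrite !xpair_eqE (negPf si) /= eq_sym (negPf jt) //.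
    rewrite !mul0n => _; rewrite big1 // => j _; rewrite !xpair_eqE (negPf si) (negPf ti).
    by rewrite andbF.
  transitivity (\sum_(j : 'I_n) edge_mult e (f i) j * w j)%N.
    rewrite (reindex f) /=; last by exists g => j _.
    by apply: eq_bigr => j _; rewrite fe.
  rewrite /edge_mult; under [LHS]eq_bigr => j _.
    rewrite -sum1_count big_distrl big_mkcond /=. over.
  rewrite exchange_big /= big_seq [RHS]big_seq; apply: eq_bigr => -[x y] /range /= /andP[xn yn].
  case: (eqVneq x (f i)) => [xi|xi].
    rewrite (bigD1 (Ordinal yn)) //= !xpair_eqE xi !eqxx /= mul1n big1 ?addn0 // => j jy.
    have yj : (y == j) = false by rewrite eq_sym; exact: negPf.
    rewrite !xpair_eqE yj andbF /=; case: eqP => //= e1; case: eqP => //= e2.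
    by move: yj; rewrite e2 e1 eqxx.
  case: (eqVneq y (f i)) => [yi|yi].
    rewrite (bigD1 (Ordinal xn)) //= !xpair_eqE yi !eqxx /= orbT mul1n big1 ?addn0 // => j jx.
    have xj : (x == j) = false by rewrite eq_sym; exact: negPf.
    by rewrite !xpair_eqE xj (negPf xi).
  by rewrite big1 // => j _; rewrite !xpair_eqE (negPf xi) (negPf yi) andbF.
- move=> p pa i j; pose p' (x : nat) := if insub x is Some y then p (g y) else false.
  have p'E (l : vtx Q) : p' (f l) = p l by rewrite /p' valK fK.
  suff hp' x : x \in e -> p' x.1 = p' x.2 by rewrite -!p'E !(conn p' hp').
  case: x => [x y] xe; have /andP[/= xn yn] := range _ xe.
  have := fe (g (Ordinal xn)) (g (Ordinal yn)); rewrite !gK /edge_mult /= => am.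
  have : (0 < arrow_mult (g (Ordinal xn)) (g (Ordinal yn)))%N.
    by rewrite am -has_count; apply/hasP; exists (x, y) => //=; rewrite eqxx.
  rewrite /arrow_mult card_gt0 => /set0Pn[a]; rewrite inE !xpair_eqE.
  have p'x : p' x = p (g (Ordinal xn)) by rewrite /p' insubT.
  have p'y : p' y = p (g (Ordinal yn)) by rewrite /p' insubT.
  rewrite /= p'x p'y; case/orP=> /andP[/eqP<- /eqP<-]; rewrite ?pa //.
by rewrite /= gK.
Qed.

Lemma nbsum_cons x e w i : nbsum (x :: e) w i =
  ((if x.1 == i then w x.2 else if x.2 == i then w x.1 else 0) + nbsum e w i)%N.
Proof. exact: big_cons. Qed.

Lemma path_nbsum w i s m :
  nbsum [seq (j, j.+1) | j <- iota s m] w i =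
  ((if (s <= i < s + m)%N then w i.+1 else 0) + (if (s < i <= s + m)%N then w i.-1 else 0))%N.
Proof.
rewrite /nbsum; elim: m s => [|m IH] s; first by rewrite big_nil; do 2?case: ifP; lia.
rewrite /= big_cons IH /=; case: (eqVneq s i) => [->|si].
  by repeat case: ifP => ?; lia.
case: (eqVneq s.+1 i) => [<-|si'] /=.
  by repeat case: ifP => ?; lia.
by repeat case: ifP => ?; lia.
Qed.

(** In each case w is the classical minimal imaginary root in the numbering of the edge list, and i0
    a vertex of weight 1. *)
Lemma tame_affine (Q : quiver) (delta : {ffun vtx Q -> int}) :
  tame Q -> acyclic Q -> min_pos_imag_root delta -> affine delta.
Proof.
move=> tQ acQ; case: tQ => [[n gr]|[n n4 gr]|[gr|gr|gr]].
(* For n = 0 the edge list is a single loop, which acyclicity excludes. *)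
- have n0 : (0 < n)%N.
    case: n gr => // -[f [[g fK gK] fe]].
    have := fe (g ord0) (g ord0); rewrite gK /edge_mult /= => am.
    have : (0 < arrow_mult (g ord0) (g ord0))%N by rewrite am.
    rewrite /arrow_mult card_gt0 => /set0Pn[a]; rewrite inE !xpair_eqE orbb => /andP[/eqP s /eqP t].
    by have := acQ (src a) [:: a]; rewrite /= eqxx => /(_ isT); rewrite /qend /= s t => /(_ erefl).
  apply: (graph_affine (w := fun=> 1%N) (i0 := 0%N) acQ gr) => //.
  + move=> x; rewrite inE => /orP[/eqP->|/mapP[j +] ->] /=; first by rewrite ltnSn.
    by rewrite mem_iota; lia.
  + move=> i le; rewrite /edges_affA nbsum_cons path_nbsum /=.
    by do !case: ifP; lia.
  move=> p hp; have st j : (j < n)%N -> p j = p j.+1.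
    move=> jn; have := hp (j, j.+1); apply; rewrite inE; apply/orP; right.
    by apply/mapP; exists j => //; rewrite mem_iota.
  by elim=> [//|i IH] le; rewrite -st ?IH //; lia.
- apply: (graph_affine (w := fun i => if (i < 2)%N then 1%N else if (i < n - 1)%N then 2 else 1%N)
    (i0 := 0%N) acQ gr) => //.
  + move=> x; rewrite /edges_affD mem_cat !inE.
    case/orP=> [/or4P[]/eqP->|/mapP[j +] ->] /=; try lia.
    by rewrite mem_iota; lia.
  + by move=> i _; do !case: ifP.
  + move=> i le; rewrite /edges_affD /= !nbsum_cons path_nbsum /=.
    by repeat (case: ifP => ?; try by lia).
  move=> p hp; have he x y : (x, y) \in edges_affD n -> p x = p y by exact: (hp (x, y)).
  have h02 : p 0%N = p 2%N by apply: he; rewrite /edges_affD mem_cat !inE eqxx.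
  have h12 : p 1%N = p 2%N by apply: he; rewrite /edges_affD mem_cat !inE eqxx orbT.
  have st j : (2 <= j)%N -> (j < n - 2)%N -> p j = p j.+1.
    move=> j2 jn; apply: he; rewrite mem_cat; apply/orP; right.
    by apply/mapP; exists j => //; rewrite mem_iota; lia.
  have mid j : (2 <= j)%N -> (j <= n - 2)%N -> p j = p 0%N.
    rewrite h02; elim: j => [//|j IH] j2 jn; case: (eqVneq j 1%N) => [->//|j1].
    by rewrite -st ?IH //; lia.
  have hn1 : p (n - 2)%N = p (n - 1)%N.
    by apply: he; rewrite /edges_affD mem_cat !inE eqxx !orbT.
  have hn : p (n - 2)%N = p n by apply: he; rewrite /edges_affD mem_cat !inE eqxx !orbT.
  move=> i le; case: (ltnP i 2) => i2; first by case: i i2 {le} => [|[|]] // _; rewrite h12.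
  case: (leqP i (n - 2)) => i3; first exact: mid.
  have /orP[/eqP->|/eqP->] : (i == n - 1)%N || (i == n) by lia.
    by rewrite -hn1 mid //; lia.
  by rewrite -hn mid //; lia.
- apply: (graph_affine (w := nth 0%N [:: 3; 2; 1; 2; 1; 2; 1]) (i0 := 2) acQ gr) => //.
  + by apply/allP.
  + by do 7?[case=> //].
  + by move=> i le; rewrite /nbsum unlock; do 7?[case: i le => [|i] le //].
  move=> p hp; have he x y : (x, y) \in edges_affE6 -> p x = p y by exact: (hp (x, y)).
  have := (he 0 1 isT, he 1 2 isT, he 0 3 isT, he 3 4 isT, he 0 5 isT, he 5 6 isT)%N.
  by move=> [[[[[h1 h2] h3] h4] h5] h6]; do 7?[case=> //]; rewrite -?h6 -?h5 -?h4 -?h3 -?h2 -?h1.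
- apply: (graph_affine (w := nth 0%N [:: 4; 3; 2; 1; 3; 2; 1; 2]) (i0 := 3) acQ gr) => //.
  + by apply/allP.
  + by do 8?[case=> //].
  + by move=> i le; rewrite /nbsum unlock; do 8?[case: i le => [|i] le //].
  move=> p hp; have he x y : (x, y) \in edges_affE7 -> p x = p y by exact: (hp (x, y)).
  have := (he 0 1 isT, he 1 2 isT, he 2 3 isT, he 0 4 isT, he 4 5 isT, he 5 6 isT, he 0 7 isT)%N.
  by move=> [[[[[[h1 h2] h3] h4] h5] h6] h7]; do 8?[case=> //];
    rewrite -?h7 -?h6 -?h5 -?h4 -?h3 -?h2 -?h1.
apply: (graph_affine (w := nth 0%N [:: 6; 5; 4; 3; 2; 1; 4; 2; 3]) (i0 := 5) acQ gr) => //.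
+ by apply/allP.
+ by do 9?[case=> //].
+ by move=> i le; rewrite /nbsum unlock; do 9?[case: i le => [|i] le //].
move=> p hp; have he x y : (x, y) \in edges_affE8 -> p x = p y by exact: (hp (x, y)).
have := (he 0 1 isT, he 1 2 isT, he 2 3 isT, he 3 4 isT, he 4 5 isT, he 0 6 isT, he 6 7 isT, he 0 8 isT)%N.
by move=> [[[[[[[h1 h2] h3] h4] h5] h6] h7] h8]; do 9?[case=> //];
  rewrite -?h8 -?h7 -?h6 -?h5 -?h4 -?h3 -?h2 -?h1.
Qed.

(** * Short exact sequences and Hall numbers *)

Section IndecomposableRegular.
Variables (k : fieldType) (Q : quiver).
Implicit Types L M N X Y : kQmodule k Q.

Lemma inj_iso M N (f : 'Hom(M, N)) : is_hom f -> lker f = 0%VS -> dimvec M = dimvec N ->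
  is_iso f.
Proof.
move=> hf fi e; apply: iso_intro => //; apply/eqP; rewrite eqEdim subvf.
rewrite limg_dim_eq ?fi ?capv0 // !dim_vdim; apply: eq_leq; apply: eq_bigr => i _.
by move/ffunP/(_ i): e; rewrite !dimvecE => -[].
Qed.

Lemma indec_dual M : indecomposable M -> indecomposable (dual M).
Proof.
move=> [nz ind]; split=> [/is_zero_dual //|X Y iXY].
have [X' iX] := predual X; have [Y' iY] := predual Y.
case: (isom_sym iXY) => v /and3P[hv _ /eqP vs].
case: (iX) => v1 /and3P[hv1 _ /eqP v1s]; case: (iY) => v2 /and3P[hv2 _ /eqP v2s].
have [f1 e1] := dual_map_surj (v \o (dinl X Y \o v1))%VF.
have [f2 e2] := dual_map_surj (v \o (dinr X Y \o v2))%VF.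
have hf1 := hom_comp (hom_comp hv1 (dinl_hom X Y)) hv; rewrite -e1 in hf1.
have {}hf1 := (dual_map_hom f1).1 hf1.
have hf2 := hom_comp (hom_comp hv2 (dinr_hom X Y)) hv; rewrite -e2 in hf2.
have {}hf2 := (dual_map_hom f2).1 hf2.
have [f hf fE] := dsum_pair hf1 hf2.
have fi : lker f = 0%VS.
  apply: lker0_intro => u; rewrite fE => -[fu1 fu2]; apply: functional_sep => h.
  rewrite linear0; have [[x y] hE] := limg_fullP (h : dual M) vs.
  have [x' xE] := limg_fullP x v1s; have [y' yE] := limg_fullP y v2s.
  have hE' : (h : dual M) = dual_map f1 x' + dual_map f2 y'.
    rewrite e1 e2 !comp_lfunE xE yE -linearD /= dinlE dinrE -[h]hE; congr (v _).
    by rewrite [RHS](_ : _ = (x + 0, 0 + y)) // addr0 add0r.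
  have -> : h u = (dual_map f1 x' + dual_map f2 y' : 'Hom(M, k^o)) u by rewrite -hE'.
  by rewrite add_lfunE !dual_mapE fu1 fu2 !linear0 addr0.
have iM : isom M (dsum X' Y').
  exists f; apply: inj_iso => //; rewrite (dimvec_ses (dsum_ses X' Y')).
  rewrite -(dimvec_dual M) -(dimvec_dual X') -(dimvec_dual Y').
  by rewrite (dimvec_isom iX) (dimvec_isom iY) (dimvec_isom iXY) (dimvec_ses (dsum_ses X Y)).
by case: (ind _ _ iM) => z; [left; apply: isom_zero iX _ | right; apply: isom_zero iY _];
  exact/is_zero_dual.
Qed.

Lemma indec_regular_reg M : acyclic Q -> indec_regular M -> reg M.
Proof.
move=> acQ [ind npp npi]; split.
  by apply: (indec_tor acQ ind) => pM; apply: npp; split.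
apply/cotorP; apply: (indec_tor (acyclic_op acQ)); first exact: indec_dual.
by move=> pM; apply: npi; split.
Qed.

Lemma zero_mod_reg : reg (zero_mod : kQmodule k Q).
Proof.
split=> N _; apply/hom_eq0=> f _; apply/lfunP=> u; rewrite zero_lfunE.
  by have -> : u = 0; [exact: thinmx0 | rewrite linear0].
exact: thinmx0.
Qed.

Lemma regular_reg M : acyclic Q -> regular M -> reg M.
Proof.
move=> acQ [Rs [hRs iM]]; apply: reg_isom (isom_sym iM) _.
elim: Rs hRs {iM} => [|R Rs IH] hRs /=; first exact: zero_mod_reg.
apply: reg_ses (dsum_ses _ _) _ _; first exact: indec_regular_reg (hRs 0%N isT).
by apply: IH => n nR; exact: (hRs n.+1).
Qed.

End IndecomposableRegular.

(** * The two components of an exact sequence *)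

Section Sequences.
Variables (k : fieldType) (Q : quiver).
Implicit Types L M N P R X Y Z : kQmodule k Q.

Definition exact_pair X Y Z (f : 'Hom(X, Y)) (g : 'Hom(Y, Z)) :=
  [/\ is_hom f, is_hom g, lker f = 0%VS, limg f = lker g & limg g = fullv].

(** Replaces isomorphisms with [submod] and [quomod] by explicit maps, so that counting submodules
    becomes counting kernels of surjections. *)
Lemma hall_memP L M N (Y : {vspace L}) :
  (exists sY : is_submod Y, isom (submod sY) N /\ isom (quomod sY) M) <->
  exists (f : 'Hom(N, L)) (g : 'Hom(L, M)), exact_pair f g /\ lker g = Y.
Proof.
split=> [[sY [/isom_sym[f /and3P[hf /eqP fi /eqP fs]] [g /and3P[hg /eqP gi /eqP gs]]]]|].
  exists (sub_incl sY \o f)%VF, (g \o quo_proj Y)%VF.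
  have gY : lker (g \o quo_proj Y)%VF = Y.
    apply/vspaceP=> u; rewrite memv_ker comp_lfunE -quo_proj0; apply/eqP/eqP => [h|->].
      by apply: (lker0_inj gi); rewrite h linear0.
    exact: linear0.
  split=> //; split.
  - exact: hom_comp hf (sub_incl_hom sY).
  - exact: hom_comp (quo_proj_hom sY) hg.
  - apply: lker0_intro => u; rewrite comp_lfunE => h.
    by apply: (lker0_inj fi); apply: (lker0_inj (sub_incl_inj sY)); rewrite h !linear0.
  - by rewrite gY limg_comp fs sub_incl_img.
  by rewrite limg_comp limg_quo_proj gs.
move=> [f [g [[hf hg fi fg gs] <-]]]; have sY := submod_ker hg; exists sY; split.
  have [|h hh hE] := factor_mono (sub_incl_hom sY) (sub_incl_inj sY) hf.
    by rewrite sub_incl_img fg.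
  apply: isom_sym; exists h; apply: iso_intro => //.
    by apply: lker0_intro => u hu; apply: (lker0_inj fi); rewrite -hE hu !linear0.
  apply: limg_full => w; have : vsval w \in limg f by [rewrite fg; exact: subvsP]; case/memv_imgP=> u _ e.
  by exists u; apply: subvs_inj; rewrite -(sub_inclE (sX := sY)) hE e.
have [|h hh hE] := factor_epi (quo_proj_hom sY) (limg_quo_proj _) hg.
  by rewrite lker_quo_proj.
exists h; apply: iso_intro => //.
  apply: lker0_intro => u; have [v <-] := limg_fullP u (limg_quo_proj (lker g)).
  by rewrite hE => gv; apply/eqP; rewrite quo_proj0 memv_ker gv.
by apply: limg_full => w; have [v <-] := limg_fullP w gs; exists (quo_proj (lker g) v).
Qed.

Lemma factor_iso L M N (g : 'Hom(L, M)) (g' : 'Hom(L, N)) :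
  is_hom g -> is_hom g' -> limg g = fullv -> limg g' = fullv -> lker g = lker g' ->
  exists2 al : 'Hom(M, N), is_iso al & forall u, al (g u) = g' u.
Proof.
move=> hg hg' gs gs' e; have [|al hal alE] := factor_epi hg gs hg'; first by rewrite e.
exists al => //; apply: iso_intro => //.
  apply: lker0_intro => v; have [u <-] := limg_fullP v gs; rewrite alE => h.
  by apply/eqP; rewrite -memv_ker e memv_ker h.
by apply: limg_full => w; have [u <-] := limg_fullP w gs'; exists (g u).
Qed.

Variables (d : {ffun vtx Q -> int}) (P P' R R' : kQmodule k Q).
Hypotheses (acQ : acyclic Q) (aff : affine d).
Hypotheses (pP : pp P) (dP : def d P = -1) (pP' : pp P') (dP' : def d P' = -1).
Hypotheses (rR : reg R) (cR : chain d R) (rR' : reg R').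

(** If P -> P' were 0, the projection to P' would factor through R, and Hom(R, P') = 0. So it is
    nonzero, hence injective by [defm1_inj]; an element of R' mapping to 0 in R comes from P and has
    first component 0. *)
Lemma mono_parts (f : 'Hom(P, dsum P' R')) (g : 'Hom(dsum P' R', R)) : exact_pair f g ->
  lker (dfst P' R' \o f)%VF = 0%VS /\ lker (g \o dinr P' R')%VF = 0%VS.
Proof.
move=> [hf hg fi fg gs]; have f1i : lker (dfst P' R' \o f)%VF = 0%VS.
  apply: (defm1_inj acQ aff pP pP' dP (hom_comp hf (dfst_hom P' R'))) => z.
  have [|h hh hE] := factor_epi hg gs (dfst_hom P' R').
    rewrite -fg; apply/subvP=> _ /memv_imgP[u _ ->]; rewrite memv_ker.
    by move/lfunP/(_ u): z; rewrite comp_lfunE zero_lfunE => ->.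
  have h0 : h = 0 by have /hom_eq0 := rR.1 _ pP'; apply.
  apply: (defm1_nz dP'); apply/is_zeroP=> u.
  by have := hE (dinl P' R' u); rewrite h0 zero_lfunE dfstE dinlE.
split=> //; apply: lker0_intro => r; rewrite comp_lfunE => gr.
have : dinr P' R' r \in limg f by rewrite fg memv_ker gr.
case/memv_imgP=> u _ e; have u0 : u = 0.
  by apply: (lker0_inj f1i); rewrite linear0 comp_lfunE -e dfstE dinrE.
by apply: (lker0_inj (dinr_inj P' R')); rewrite e u0 !linear0.
Qed.

Lemma split_submod (f : 'Hom(P, dsum P' R')) (g : 'Hom(dsum P' R', R)) : exact_pair f g ->
  exists (X : {vspace R}) (sX : is_submod X),
     isom (submod sX) R' /\ short_exact P P' (quomod sX).
Proof.
move=> ex; have [f1i g2i] := mono_parts ex; have [hf hg fi fg gs] := ex.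
have hg1 := hom_comp (dinl_hom P' R') hg; have hg2 := hom_comp (dinr_hom P' R') hg.
set g1 := (g \o dinl P' R')%VF in hg1; set g2 := (g \o dinr P' R')%VF in hg2 g2i.
have sX := submod_img hg2 (submod_full R'); exists (limg g2), sX; split.
  have [|h hh hE] := factor_mono (sub_incl_hom sX) (sub_incl_inj sX) hg2.
    by rewrite sub_incl_img.
  apply: isom_sym; exists h; apply: iso_intro => //.
    by apply: lker0_intro => u hu; apply: (lker0_inj g2i); rewrite -hE hu !linear0.
  apply: limg_full => w; have /memv_imgP[u _ e] := subvsP w; exists u.
  by apply: subvs_inj; rewrite -(sub_inclE (sX := sX)) hE e.
have gE p r : g (p, r) = g1 p + g2 r.
  rewrite /g1 /g2 !comp_lfunE -linearD /= dinlE dinrE; congr (g _).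
  by rewrite [RHS](_ : _ = (p + 0, 0 + r)) // addr0 add0r.
exists (dfst P' R' \o f)%VF, (quo_proj (limg g2) \o g1)%VF; split=> //.
- exact: hom_comp hf (dfst_hom P' R').
- exact: hom_comp hg1 (quo_proj_hom sX).
- apply/vspaceP=> p; rewrite memv_ker comp_lfunE quo_proj0; apply/memv_imgP/memv_imgP.
    case=> u _ ->; have : f u \in lker g by rewrite -fg memv_img ?memvf.
    rewrite memv_ker [f u]surjective_pairing gE addr_eq0 => /eqP e.
    exists (- (f u).2); rewrite ?memvf // comp_lfunE dfstE e.
    by rewrite linearN.
  case=> r _ e; have : (p, - r) \in lker g by rewrite memv_ker gE linearN /= e subrr.
  rewrite -fg => /memv_imgP[u _ eu]; exists u; rewrite ?memvf //.
  by rewrite comp_lfunE dfstE -eu.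
apply: limg_full => w; have [r <-] := limg_fullP w (limg_quo_proj (limg g2)).
have [[p r'] e] := limg_fullP r gs; exists p; rewrite comp_lfunE; apply: quo_projE.
by rewrite -e gE opprD addrA subrr add0r memvN memv_img ?memvf.
Qed.

(** Ext^1(P', X) = 0 lifts P' -> R / X to a map P' -> R. On P the lift takes values in X, and minus
    this restriction is the component P -> R'. *)
Lemma glue_submod (X : {vspace R}) (sX : is_submod X) : isom (submod sX) R' ->
  short_exact P P' (quomod sX) -> short_exact P (dsum P' R') R.
Proof.
move=> /isom_sym[et /and3P[het /eqP eti /eqP ets]] [f1 [q [hf1 hq f1i f1q qs]]].
have hg2 := hom_comp het (sub_incl_hom sX); set g2 := (_ \o et)%VF in hg2.
have g2i : lker g2 = 0%VS.
  apply: lker0_intro => u; rewrite /g2 comp_lfunE => h.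
  by apply: (lker0_inj eti); apply: (lker0_inj (sub_incl_inj sX)); rewrite h !linear0.
have g2X : limg g2 = X by rewrite /g2 limg_comp ets sub_incl_img.
have tX : tor (submod sX).
  apply: tor_isom rR'.1; exists et; exact: iso_intro.
have [|g1 hg1 g1E] := ext0_lift acQ (ext_pp_tor pP' tX) (sub_incl_hom sX) (quo_proj_hom sX)
  (sub_incl_inj sX) _ (limg_quo_proj X) hq.
  by rewrite sub_incl_img lker_quo_proj.
have hgf := hom_comp hf1 hg1.
have [|f2 hf2 f2E] := factor_mono hg2 g2i hgf.
  rewrite g2X; apply/subvP=> _ /memv_imgP[u _ ->]; rewrite comp_lfunE -quo_proj0.
  have -> : quo_proj X (g1 (f1 u)) = q (f1 u) by exact: g1E.
  by rewrite -memv_ker -f1q memv_img ?memvf.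
have [g hg gE] := dsum_map hg1 hg2.
have hf2' : is_hom (- f2)%R by rewrite -mem_homs memvN mem_homs.
have [f hf fE] := dsum_pair hf1 hf2'.
exists f, g; split=> //.
- by apply: lker0_intro => u; rewrite fE => -[fu _]; apply: (lker0_inj f1i); rewrite fu linear0.
- apply/vspaceP=> -[p r]; rewrite memv_ker gE /=; apply/memv_imgP/eqP.
    case=> u _; rewrite fE => -[-> ->]; rewrite opp_lfunE linearN /= f2E comp_lfunE.
    exact: subrr.
  move=> e; have : q p = 0.
    rewrite -g1E; apply/eqP; rewrite quo_proj0 -g2X.
    have -> : g1 p = - g2 r by apply/eqP; rewrite -addr_eq0 e.
    by rewrite memvN memv_img ?memvf.
  move/eqP; rewrite -memv_ker -f1q => /memv_imgP[u _ ep]; exists u; rewrite ?memvf // fE -ep.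
  congr pair; apply: (lker0_inj g2i); rewrite opp_lfunE linearN /= f2E comp_lfunE -ep.
  by apply/eqP; rewrite -addr_eq0 addrC e.
apply: limg_full => w; have [p ep] := limg_fullP (quo_proj X w : quomod sX) qs.
have : w - g1 p \in X by rewrite -quo_proj0 linearB /= [quo_proj X (g1 p)]g1E ep subrr.
rewrite -g2X => /memv_imgP[r _ er]; exists (p, r); rewrite gE /= -er addrC.
exact: subrK.
Qed.

Definition gmap (g1 : 'Hom(P', R)) (g2 : 'Hom(R', R)) : 'Hom(dsum P' R', R) :=
  (g1 \o dfst P' R')%VF + (g2 \o dsnd P' R')%VF.

Lemma gmapE g1 g2 u : gmap g1 g2 u = g1 u.1 + g2 u.2.
Proof. by rewrite add_lfunE !comp_lfunE dfstE dsndE. Qed.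

Lemma app_parts (g : 'Hom(dsum P' R', R)) u :
  g u = (g \o dinl P' R')%VF u.1 + (g \o dinr P' R')%VF u.2.
Proof.
case: u => p r; rewrite !comp_lfunE -linearD /= dinlE dinrE; congr (g _).
by rewrite [RHS](_ : _ = (p + 0, 0 + r)) // addr0 add0r.
Qed.

Lemma gmap_hom g1 g2 : is_hom g1 -> is_hom g2 -> is_hom (gmap g1 g2).
Proof.
move=> h1 h2; rewrite -mem_homs memvD // mem_homs.
  exact: hom_comp (dfst_hom P' R') h1.
exact: hom_comp (dsnd_hom P' R') h2.
Qed.

(** If Z contains the image of P', then Z and the image of R' span R. They are comparable, so Z = R,
    or R' -> R is onto and hence an isomorphism. *)
Lemma exact_generates (f : 'Hom(P, dsum P' R')) (g : 'Hom(dsum P' R', R)) :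
  exact_pair f g -> ~ isom R R' -> generates d (g \o dinl P' R')%VF.
Proof.
move=> ex ni Z rZ le; have [_ g2i] := mono_parts ex; have [hf hg fi fg gs] := ex.
have hg2 := hom_comp (dinr_hom P' R') hg.
have rX := rs_img acQ aff rR' rR hg2 (rs_full acQ aff rR').
have XZ : (limg (g \o dinr P' R')%VF + Z = fullv)%VS.
  apply/eqP; rewrite eqEsubv subvf /= -gs; apply/subvP=> _ /memv_imgP[u _ ->].
  rewrite app_parts addrC memv_add ?memv_img ?memvf //.
  by apply: (subvP le); rewrite memv_img ?memvf.
case/orP: (cR rX rZ) => h; first by rewrite -XZ; apply/esym/addv_idPr.
case: ni; apply: isom_sym; exists (g \o dinr P' R')%VF; apply: iso_intro => //.
by rewrite -XZ; apply/esym/addv_idPl.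
Qed.

(* Up to Aut R every surjection has the same first component, and then the    *)
(* second one is determined up to Aut R', its image being prescribed by its   *)
(* dimension.                                                                 *)
Lemma exact_transitive (f f' : 'Hom(P, dsum P' R')) (g g' : 'Hom(dsum P' R', R)) :
  exact_pair f g -> exact_pair f' g' -> ~ isom R R' ->
  exists2 be : 'End(R'), is_iso be &
    lker (gmap (g \o dinl P' R')%VF ((g \o dinr P' R') \o be)%VF) = lker g'.
Proof.
move=> ex ex' ni; have gen := exact_generates ex ni; have gen' := exact_generates ex' ni.
have [_ g2i] := mono_parts ex; have [_ g2i'] := mono_parts ex'.
have [hf hg fi fg gs] := ex; have [hf' hg' fi' fg' gs'] := ex'.
have h1 := hom_comp (dinl_hom P' R') hg; have h1' := hom_comp (dinl_hom P' R') hg'.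
have h2 := hom_comp (dinr_hom P' R') hg; have h2' := hom_comp (dinr_hom P' R') hg'.
have [al hal alE] := chain_transitive acQ aff pP' dP' rR cR h1' h1 gen'.
have [al' hal' alE'] := chain_transitive acQ aff pP' dP' rR cR h1 h1' gen.
(* al' al - 1 vanishes on the generating map, hence is 0. *)
have alK u : al' (al u) = u.
  have : (al' \o al)%VF - \1%VF = 0.
    apply: (generates_inj acQ aff rR rR gen').
      rewrite -mem_homs memvB // mem_homs ?hom_id //; exact: hom_comp hal hal'.
    by rewrite comp_lfunDl comp_lfunNl comp_lfun1l -comp_lfunA alE alE' subrr.
  by move/eqP; rewrite subr_eq0 => /eqP/lfunP/(_ u); rewrite comp_lfunE id_lfunE.
have ali : lker al = 0%VS by apply: lker0_intro => u h; rewrite -(alK u) h linear0.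
set g2 := (g \o dinr P' R')%VF in g2i h2 *.
have h3 := hom_comp h2' hal; set g3 := (al \o _)%VF in h3.
have g3i : lker g3 = 0%VS.
  apply: lker0_intro => u; rewrite /g3 comp_lfunE => h; apply: (lker0_inj g2i').
  by apply: (lker0_inj ali); rewrite h !linear0.
have r2 := rs_img acQ aff rR' rR h2 (rs_full acQ aff rR').
have r3 := rs_img acQ aff rR' rR h3 (rs_full acQ aff rR').
have d23 : \dim (limg g2) = \dim (limg g3).
  by rewrite !limg_dim_eq ?g2i ?g3i ?capv0.
have e23 : limg g2 = limg g3.
  case/orP: (cR r2 r3) => le; apply/eqP; first by rewrite eqEdim le d23 /=.
  by rewrite eq_sym eqEdim le d23 /=.
have [|be hbe beE] := factor_mono h2 g2i h3; first by rewrite e23.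
exists be.
  apply: inj_iso => //; apply: lker0_intro => u hu; apply: (lker0_inj g3i).
  by rewrite -beE hu !linear0.
have E u : gmap (g \o dinl P' R')%VF (g2 \o be)%VF u = al (g' u).
  rewrite gmapE (app_parts g') linearD /=; congr (_ + _); first by rewrite -alE comp_lfunE.
  rewrite [LHS]comp_lfunE beE; exact: comp_lfunE.
apply/vspaceP=> u; rewrite !memv_ker E; apply/eqP/eqP => [h|->]; last exact: linear0.
by apply: (lker0_inj ali); rewrite h linear0.
Qed.

End Sequences.

Lemma ncard_bij (T U : choiceType) (A : set T) (B : set U) (F : T -> U) : finite_set A ->
  (forall x, A x -> B (F x)) -> (forall x y, A x -> A y -> F x = F y -> x = y) ->
  (forall y, B y -> exists2 x, A x & F x = y) -> ncard A = ncard B.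
Proof.
move=> fA FB Fi Fs; have -> : B = (F @` A)%classic.
  apply/seteqP; split=> [y /Fs[x Ax <-]|_ [x Ax <-]]; [by exists x|exact: FB].
rewrite /ncard fset_set_image // card_in_imfset // => x y.
by rewrite !in_fset_set // => /set_mem Ax /set_mem Ay; exact: Fi.
Qed.

(** * The Hall number *)

Section Counting.
Variables (k : finFieldType) (Q : quiver) (d : {ffun vtx Q -> int}).
Variables P P' R R' : kQmodule k Q.
Hypotheses (acQ : acyclic Q) (aff : affine d).
Hypotheses (pP : pp P) (dP : def d P = -1) (pP' : pp P') (dP' : def d P' = -1).
Hypotheses (rR : reg R) (cR : chain d R) (rR' : reg R').
Variables (f : 'Hom(P, dsum P' R')) (g : 'Hom(dsum P' R', R)).
Hypothesis ex : exact_pair f g.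

(* Every submodule counted is the graph of a map from P to R'. *)
Lemma hall_isom : isom R R' -> hall R P (dsum P' R') = ncard (hom_set P R).
Proof.
move=> iR; have [f1i _] := mono_parts acQ aff pP dP pP' dP' rR ex.
have [hf hg fi fg gs] := ex; have hf1 := hom_comp hf (dfst_hom P' R').
have dPP' : dimvec P = dimvec P'.
  have ses : short_exact P (dsum P' R') R by exists f, g.
  have := dimvec_ses ses; rewrite (dimvec_ses (dsum_ses P' R')) (dimvec_isom iR).
  by move/addIr.
have iso1 := inj_iso hf1 f1i dPP'; set ph := (dfst P' R' \o f)%VF in hf1 f1i iso1; clearbody ph.
have [ph' [/and3P[hph' _ _] phK phK']] := iso_inv iso1.
case: iR => ps ips; have [hps /eqP psi /eqP pss] := and3P ips.
have [ps' [/and3P[hps' _ _] psK psK']] := iso_inv ips.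
pose gr (h : 'Hom(P, R)) : 'Hom(P, dsum P' R') :=
  (dinl P' R' \o ph)%VF + (dinr P' R' \o (ps \o h))%VF.
have grE h u : gr h u = (ph u, ps (h u)).
  rewrite add_lfunE !comp_lfunE dinlE dinrE.
  by rewrite [LHS](_ : _ = (ph u + 0, 0 + ps (h u))) // ?addr0 ?add0r.
apply/esym; apply: (@ncard_bij _ _ _ _ (fun h => limg (gr h))).
- exact: finite_lfun_set.
- move=> h hh; apply/hall_memP.
  have hk : is_hom ((ps' \o dsnd P' R') - ((h \o ph') \o dfst P' R'))%VF.
    rewrite -mem_homs memvB // mem_homs; first exact: hom_comp (dsnd_hom P' R') hps'.
    exact: hom_comp (dfst_hom P' R') (hom_comp hph' hh).
  set q := (_ - _)%VF in hk.
  have qE u : q u = ps' u.2 - h (ph' u.1).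
    by rewrite /q add_lfunE opp_lfunE !comp_lfunE dfstE dsndE.
  have grq : limg (gr h) = lker q.
    apply/vspaceP=> -[p r]; rewrite memv_ker qE subr_eq0 /=; apply/memv_imgP/eqP.
      by case=> u _; rewrite grE => -[-> ->]; rewrite psK phK.
    move=> e; exists (ph' p); rewrite ?memvf // grE phK'.
    by congr pair; rewrite -e psK'.
  exists (gr h), q; split=> //; split=> //.
  + rewrite -mem_homs memvD // mem_homs; first exact: hom_comp hf1 (dinl_hom P' R').
    exact: hom_comp (hom_comp hh hps) (dinr_hom P' R').
  + by apply: lker0_intro => u; rewrite grE => -[pu _]; apply: (lker0_inj f1i); rewrite pu linear0.
  apply: limg_full => x; exists (0, ps x); rewrite qE /= psK [ph' 0]linear0.
  by rewrite (linear0 (h : 'Hom(P, R))) subr0.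
- move=> h h' _ _ e; apply/lfunP=> u; apply: (lker0_inj psi).
  have : gr h u \in limg (gr h') by rewrite -e memv_img ?memvf.
  case/memv_imgP=> u' _; rewrite !grE => -[e1 e2]; rewrite e2.
  by rewrite (lker0_inj f1i e1).
move=> Y /hall_memP[f' [g' [ex' <-]]].
have [f1i' _] := mono_parts acQ aff pP dP pP' dP' rR ex'.
have [hf' hg' fi' fg' gs'] := ex'; have hf1' := hom_comp hf' (dfst_hom P' R').
have iso1' := inj_iso hf1' f1i' dPP'; set ph1 := (dfst P' R' \o f')%VF in hf1' f1i' iso1'.
have [ph1' [/and3P[hph1' _ _] ph1K ph1K']] := iso_inv iso1'.
(* f' is reparametrized by an automorphism of P so that its first component becomes [ph]; h is the
   second component, carried from R' to R. *)
have hh : is_hom (ps' \o (dsnd P' R' \o (f' \o (ph1' \o ph))))%VF.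
  exact: hom_comp (hom_comp (hom_comp (hom_comp hf1 hph1') hf') (dsnd_hom P' R')) hps'.
set h := (ps' \o _)%VF in hh; exists h => //; rewrite -fg'.
have E u : gr h u = f' (ph1' (ph u)).
  rewrite grE /h !comp_lfunE psK' dsndE [RHS]surjective_pairing; congr pair.
  by have := ph1K' (ph u); rewrite /ph1 comp_lfunE dfstE.
apply/vspaceP=> w; apply/memv_imgP/memv_imgP => -[u _ ->]; first by exists (ph1' (ph u)); rewrite ?memvf.
exists (ph' (ph1 u)); rewrite ?memvf // E phK' ph1K.
by [].
Qed.

(** An automorphism be of R' is sent to the kernel of (g1, g2 be). Equal kernels give an
    automorphism of R fixing g1; it is 1 because g1 generates R, and g2 is injective. Surjectivity
    is [exact_transitive]. *)
Lemma hall_nisom : ~ isom R R' -> hall R P (dsum P' R') = ncard (aut_set R').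
Proof.
move=> ni; have [_ g2i] := mono_parts acQ aff pP dP pP' dP' rR ex.
have [hf hg fi fg gs] := ex.
have h1 := hom_comp (dinl_hom P' R') hg; have h2 := hom_comp (dinr_hom P' R') hg.
have gen := exact_generates acQ aff pP dP pP' dP' rR cR rR' ex ni.
have gE := app_parts g.
set g1 := (g \o dinl P' R')%VF in gE h1 gen; set g2 := (g \o dinr P' R')%VF in gE h2 g2i.
have fs (be : 'End(R')) : is_iso be -> limg (gmap g1 (g2 \o be)%VF) = fullv.
  case/and3P=> hbe _ /eqP bs; apply: limg_full => x; have [[p r] <-] := limg_fullP x gs.
  have [r' <-] := limg_fullP r bs; exists (p, r'); rewrite gmapE gE /=.
  by rewrite [(_ \o be)%VF _]comp_lfunE.
apply/esym; apply: (@ncard_bij _ _ _ _ (fun be => lker (gmap g1 (g2 \o be)%VF))).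
- exact: finite_lfun_set.
- move=> be ibe; apply/hall_memP; have [hbe /eqP bi /eqP bs] := and3P ibe.
  have [be' [/and3P[hbe' _ _] bK bK']] := iso_inv ibe.
  pose f' := ((dinl P' R' \o (dfst P' R' \o f)) + (dinr P' R' \o (be' \o (dsnd P' R' \o f))))%VF.
  have f'E u : f' u = ((f u).1, be' (f u).2).
    rewrite /f' add_lfunE !comp_lfunE dinlE dinrE dfstE dsndE.
    by rewrite [LHS](_ : _ = ((f u).1 + 0, 0 + be' (f u).2)) // addr0 add0r.
  exists f', (gmap g1 (g2 \o be)%VF); split=> //; split.
  + rewrite -mem_homs memvD // mem_homs.
      exact: hom_comp (hom_comp hf (dfst_hom P' R')) (dinl_hom P' R').
    exact: hom_comp (hom_comp (hom_comp hf (dsnd_hom P' R')) hbe') (dinr_hom P' R').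
  + exact: gmap_hom h1 (hom_comp hbe h2).
  + apply: lker0_intro => u; rewrite f'E => -[u1 u2]; apply: (lker0_inj fi).
    rewrite linear0 [LHS]surjective_pairing u1.
    by have -> : (f u).2 = 0 by rewrite -(bK' (f u).2) u2 linear0.
  + apply/vspaceP=> -[p r]; rewrite memv_ker gmapE /= [(_ \o be)%VF _]comp_lfunE.
    have -> : g1 p + g2 (be r) = g (p, be r) by rewrite gE.
    rewrite -memv_ker -fg; apply/memv_imgP/memv_imgP => -[u _ e]; exists u; rewrite ?memvf //.
      by move: e; rewrite f'E => -[-> ->]; rewrite bK' -surjective_pairing.
    by rewrite f'E -e bK.
  exact: fs.
- move=> be be' ibe ibe' e; have [hbe _ _] := and3P ibe; have [hbe' _ _] := and3P ibe'.
  have [al /and3P[hal _ _] alE] := factor_iso (gmap_hom h1 (hom_comp hbe h2))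
    (gmap_hom h1 (hom_comp hbe' h2)) (fs _ ibe) (fs _ ibe') e.
  have al1 u : al u = u.
    have : al - \1%VF = 0.
      apply: (generates_inj acQ aff rR rR gen); first by rewrite -mem_homs memvB // mem_homs ?hom_id.
      apply/lfunP=> p; rewrite comp_lfunE add_lfunE opp_lfunE id_lfunE zero_lfunE.
      by have := alE (p, 0); rewrite !gmapE /= !linear0 !addr0 => ->; exact: subrr.
    by move/eqP; rewrite subr_eq0 => /eqP->; rewrite id_lfunE.
  apply/lfunP=> r; apply: (lker0_inj g2i); have := alE (0, r); rewrite al1 !gmapE /= !linear0 !add0r.
  by rewrite ![(_ \o _)%VF r]comp_lfunE.
move=> Y /hall_memP[f' [g' [ex' <-]]].
by have [be ibe e] := exact_transitive acQ aff pP dP pP' dP' rR cR rR' ex ex' ni; exists be.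
Qed.

End Counting.

Theorem proposition5p3 (k : finFieldType) (Q : quiver)
    (tameQ : tame Q) (acyclicQ : acyclic Q)
    (delta : {ffun vtx Q -> int}) (delta_root : min_pos_imag_root delta)
    (P P' R R' : kQmodule k Q)
    (preprojP : preprojective P) (defectP : defect delta P = -1)
    (preprojP' : preprojective P') (defectP' : defect delta P' = -1)
    (regR : indec_regular R) (regR' : regular R') :
  (short_exact P (dsum P' R') R <->
   exists (X : {vspace R}) (sX : is_submod X),
     isom (submod sX) R' /\ short_exact P P' (quomod sX)) /\
  (short_exact P (dsum P' R') R ->
   (isom R R' -> hall R P (dsum P' R') = ncard (hom_set P R)) /\
   (~ isom R R' -> hall R P (dsum P' R') = ncard (aut_set R'))).
Proof.
have aff := tame_affine tameQ acyclicQ delta_root.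
have pP : pp P := preprojP.2; have pP' : pp P' := preprojP'.2.
have rR := indec_regular_reg acyclicQ regR; have rR' := regular_reg acyclicQ regR'.
have cR : chain delta R by apply: (indec_chain acyclicQ aff rR); case: regR.
split.
  split=> [[f [g ex]]|[X [sX [iX sesX]]]].
    exact: (split_submod acyclicQ aff pP defectP pP' defectP' rR ex).
  exact: (glue_submod acyclicQ pP' rR' iX sesX).
move=> [f [g ex]]; split.
  exact: (hall_isom acyclicQ aff pP defectP pP' defectP' rR ex).
exact: (hall_nisom acyclicQ aff pP defectP pP' defectP' rR cR rR' ex).
Qed.
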